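(* Let $p\in\mathbb{R}[X]$ be a polynomial of degree at least $2$. Then the sequence $(p(n))_{n\in\mathbb{N}}$ is metric Poissonian.
   Context: A real sequence $(y_n)_{n\in\mathbb{N}}$ has Poissonian pair correlation if for every $s>0$, $$\lim_{N\to\infty}\frac1N\left|\left\{1\le n_1\neq n_2\le N:\ \|y_{n_1}-y_{n_2}\|\le \frac sN\right\}\right|=2s,$$ where $\|\cdot\|$ denotes the distance to the nearest integer. A sequence $(x_n)_{n\in\mathbb{N}}$ is metric Poissonian if $(\alpha x_n)_{n\in\mathbb{N}}$ has Poissonian pair correlation for Lebesgue almost all $\alpha\in\mathbb{R}$. *)

(* Defs.v *)
From HB Require Import structures.
From mathcomp Require Import all_boot all_order all_algebra.
From mathcomp Require Import all_classical all_reals all_analysis.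
Import Order.TTheory GRing.Theory Num.Theory.
Import numFieldNormedType.Exports.

Set Implicit Arguments.
Unset Strict Implicit.
Unset Printing Implicit Defensive.

Local Open Scope classical_set_scope.
Local Open Scope ring_scope.

Definition dist_int (R : realType) (x : R) : R :=
  inf [set `|x - m%:~R| | m in [set: int]].

(* Ordered pairs of distinct indices in {1, ..., N}: the ordinal i : 'I_N
   stands for the index i.+1, so the value y 0 is never used. *)
Definition pair_count (R : realType) (y : nat -> R) (s : R) (N : nat) : nat :=
  #|[pred ij : 'I_N * 'I_N | (ij.1 != ij.2) &&
      (dist_int (y ij.1.+1 - y ij.2.+1) <= s / N%:R)]|.

Definition poissonian_pair_correlation (R : realType) (y : nat -> R) : Prop :=
  forall s : R, 0 < s ->
    (fun N : nat => N%:R^-1 * (pair_count y s N)%:R : R) @ \oo --> 2 * s.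

Definition metric_poissonian (R : realType) (x : nat -> R) : Prop :=
  {ae @lebesgue_measure R, forall alpha : R,
     poissonian_pair_correlation (fun n : nat => alpha * x n)}.

(* Main.v *)
Require Import Defs.
From HB Require Import structures.
From mathcomp Require Import all_boot all_order all_algebra.
From mathcomp Require Import all_classical all_reals all_analysis.
From mathcomp Require Import measurable_realfun.
From mathcomp Require Import zify ring lra.
Import Order.TTheory GRing.Theory Num.Theory.
Import numFieldNormedType.Exports.

(** Fix [N = l ^ C] points and let [D q = p q.1 - p q.2] for a pair [q] of indices.
    The indicator of the points within [s / N] of the integers is replaced by
    [bump], its convolution with a Fejer kernel of order slightly larger than
    [N]. This is a cosine polynomial with mean [2 s / N] and all coefficients at most
    [4 s / N]. The means of the bumps at [alpha * D q] add up to the expected number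
    of pairs, and it remains to show that the rest, a sum of terms
    [cos (2 pi j (D q) alpha)] over [q] and [j], is of smaller order for almost all
    [alpha]. Its square is integrated over an interval [[- A, A]] against the weight
    [A ^ 2 - alpha ^ 2], whose Fourier transform decays quadratically. By
    [second_moment_le] the integral is at most a constant times the number of
    coincidences [floor (j * D q) = floor (j' * D q')]. A bound for that number that
    gains a factor [l ^ 2] over the trivial order [N ^ 4] makes the integrals
    summable over [l], and [ae_cvg0] gives convergence almost everywhere. Finally
    pair counts are monotone and [l.+1 ^ C / l ^ C] tends to one, so the limit along
    these [N] is enough ([poissonian_of_bumps]).

    The arithmetic heart is therefore the bound for coincidences of products
    [j * D q] ([count_bound]). Let [d] be the degree of [p]. Taking logarithms at a
    suitable scale turns products into sums of integers [ell q + L j]. The number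
    [M r] of coincidences of [ell q + L j_1 + ... + L j_r] is log-convex in [r] by the
    Cauchy-Schwarz inequality, so [M 1 ^ (d + 1) <= M 0 ^ d * M (d + 1)]. Here [M 0]
    is essentially the energy of the sequence, the number of coincidences of
    [floor (D q)]. For [M (d + 1)] only the words in the [j] matter, and a product of
    integers leaves few possibilities for its factors by the divisor bound. The
    energy is small because the sequence is strictly convex if [d >= 3]
    ([convex_energy]), and because the differences factor if [d = 2]
    ([quadratic_energy]). The choice [d + 1] is dictated by scales: [j] goes up to
    about [N], so products of [d + 1] such integers have about the size of [j * D q]
    and are still told apart by their logarithms.

    Pairs with a small index or a small gap, for which [D q] may be too small for
    this argument, are rare, and their bumps are estimated by their first moments
    ([bump_integral_le]). *)

Set Implicit Arguments.
Unset Strict Implicit.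
Unset Printing Implicit Defensive.

(** * Coincidences of functions on finite families *)

Lemma sum_cauchy_schwarz (T : Type) (s : seq T) (a b : T -> nat) :
  (\sum_(t <- s) a t * b t) ^ 2 <=
  (\sum_(t <- s) a t ^ 2) * (\sum_(t <- s) b t ^ 2).
Proof.
rewrite -(leq_pmul2l (isT : 0 < 2)).
have -> : 2 * ((\sum_(t <- s) a t ^ 2) * (\sum_(t <- s) b t ^ 2)) =
   \sum_(t <- s) \sum_(u <- s) ((a t * b u) ^ 2 + (a u * b t) ^ 2).
  rewrite mul2n -addnn {1}big_distrlr /= [in X in _ + X]mulnC big_distrlr /=.
  rewrite -big_split /=; apply: eq_bigr => t _.
  rewrite -big_split /=; apply: eq_bigr => u _.
  by rewrite !expnMn [X in _ + X]mulnC.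
rewrite -mulnn big_distrlr /= big_distrr /=.
apply: leq_sum => t _; rewrite big_distrr /=; apply: leq_sum => u _.
have := (nat_Cauchy (a t * b u) (a u * b t)).1; lia.
Qed.

Section Coincidences.
Variables (B : eqType).
Implicit Types (I J : Type).

Definition cross I J (s : seq I) (r : seq J) (f : I -> B) (g : J -> B) : nat :=
  \sum_(i <- s) \sum_(j <- r) (f i == g j).

(** Equivalently, the sum of the squares of the fibre sizes of [f]. For the
    differences of a sequence this is its additive energy. *)
Definition coin I (s : seq I) (f : I -> B) : nat := cross s s f f.

Lemma cross_fibres I J (s : seq I) (r : seq J) f g (V : seq B) :
    uniq V -> {subset map f s <= V} ->
  cross s r f g =
  \sum_(v <- V) (\sum_(i <- s) (f i == v)) * (\sum_(j <- r) (g j == v)).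
Proof.
move=> uV sV.
under [RHS]eq_bigr => v _ do rewrite big_distrlr /=.
rewrite exchange_big /= /cross.
elim: s sV => [|i s IH] sV; first by rewrite !big_nil.
rewrite !big_cons IH; last first.
  by move=> v vs; apply: sV; rewrite /= inE vs orbT.
congr (_ + _); rewrite exchange_big /=; apply: eq_bigr => j _.
have fV : f i \in V by apply: sV; rewrite inE eqxx.
rewrite (bigD1_seq (f i)) //= eqxx mul1n big1 ?addn0 1?eq_sym// => v.
by rewrite eq_sym => /negbTE ->; rewrite mul0n.
Qed.

(** Summed over the fibres, this is the Cauchy-Schwarz inequality for the two
    vectors of fibre sizes. *)
Lemma cross_le I J (s : seq I) (r : seq J) f g :
  cross s r f g ^ 2 <= coin s f * coin r g.
Proof.
pose V := undup (map f s ++ map g r).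
have uV : uniq V := undup_uniq _.
have fV : {subset map f s <= V}.
  by move=> v vs; rewrite mem_undup mem_cat vs.
have gV : {subset map g r <= V}.
  by move=> v vs; rewrite mem_undup mem_cat vs orbT.
rewrite /coin (cross_fibres _ _ uV fV) (cross_fibres _ _ uV fV).
rewrite (cross_fibres _ _ uV gV).
exact: sum_cauchy_schwarz.
Qed.

Lemma cross_le_coin I J (s : seq I) (r : seq J) f g :
  coin r g <= coin s f -> cross s r f g <= coin s f.
Proof.
move=> h; rewrite -leq_sqr (leq_trans (cross_le s r f g))//.
by rewrite -mulnn leq_mul2l h orbT.
Qed.

(** Composing with an injection preserves the internal coincidences, so
    Cauchy-Schwarz bounds the mutual ones. *)
Lemma cross_inj_le I (s : seq I) f (h : B -> B) :
  injective h -> cross s s f (h \o f) <= coin s f.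
Proof.
move=> hI; apply: cross_le_coin; apply: leq_sum => i _; apply: leq_sum => j _.
by rewrite /= (inj_eq hI).
Qed.

End Coincidences.

Lemma coin_coarser (B B' I : eqType) (s : seq I) (f : I -> B) (g : I -> B') :
    {in s &, forall i j, f i = f j -> g i = g j} -> coin s f <= coin s g.
Proof.
move=> fg; rewrite /coin /cross big_seq [leqRHS]big_seq; apply: leq_sum => i si.
rewrite big_seq [leqRHS]big_seq; apply: leq_sum => j sj.
by case: eqP => // /(fg _ _ si sj) ->; rewrite eqxx.
Qed.

Lemma coin_filter (B : eqType) I (P : pred I) (s : seq I) (f : I -> B) :
  coin [seq i <- s | P i] f <= coin s f.
Proof.
rewrite /coin /cross big_filter.
apply: (@leq_trans (\sum_(i <- s | P i) \sum_(j <- s) (f i == f j))).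
  apply: leq_sum => i _; rewrite big_filter [leqRHS](bigID P) /=.
  exact: leq_addr.
by rewrite [leqRHS](bigID P) /= leq_addr.
Qed.

Section Classes.
Variables (B : eqType) (H : nat) (I : Type) (s : seq I) (f : I -> B) (c : I -> nat).
Hypothesis cH : forall i, c i < H.

Let cls k := [seq i <- s | c i == k].

Let class_unique i : \sum_(k < H) (c i == k) = 1.
Proof.
rewrite (bigD1 (Ordinal (cH i))) //= eqxx big1 ?addn0// => k.
by rewrite -val_eqE /= eq_sym => /negbTE ->.
Qed.

Let cross_class k l : cross (cls k) (cls l) f f =
  \sum_(i <- s) \sum_(j <- s) (f i == f j) * ((c i == k) * (c j == l)).
Proof.
rewrite /cross big_filter big_mkcond /=; apply: eq_bigr => i _.
case: (c i == k); last by rewrite big1// => j _; rewrite muln0.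
rewrite big_filter big_mkcond /=; apply: eq_bigr => j _.
by case: (c j == l); rewrite ?muln1 ?muln0.
Qed.

Lemma coin_split : coin s (fun i => (f i, c i)) = \sum_(k < H) coin (cls k) f.
Proof.
under [RHS]eq_bigr => k _ do rewrite /coin cross_class.
rewrite exchange_big /=; apply: eq_bigr => i _.
rewrite exchange_big /=; apply: eq_bigr => j _.
rewrite -big_distrr /= xpair_eqE.
have -> : \sum_(k < H) (c i == k) * (c j == k) = (c i == c j).
  rewrite (bigD1 (Ordinal (cH i))) //= eqxx mul1n eq_sym big1 ?addn0// => k.
  by rewrite -val_eqE /= eq_sym => /negbTE ->.
by case: (f i == f j); rewrite ?mul1n ?mul0n.
Qed.

(** Sorting the indices into [H] classes loses a factor [H] only, because two
    classes have at most as many mutual coincidences as they have, on average,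
    internal ones. *)
Lemma coin_classes : coin s f <= H * \sum_(k < H) coin (cls k) f.
Proof.
have -> : coin s f = \sum_(k < H) \sum_(l < H) cross (cls k) (cls l) f f.
  under [RHS]eq_bigr => k _ do under eq_bigr => l _ do rewrite cross_class.
  under [RHS]eq_bigr => k _ do rewrite exchange_big /=.
  rewrite exchange_big /=; apply: eq_bigr => i _.
  under [RHS]eq_bigr => k _ do rewrite exchange_big /=.
  rewrite exchange_big /=; apply: eq_bigr => j _.
  under [RHS]eq_bigr => k _ do
    rewrite -big_distrr -big_distrr /= class_unique muln1.
  by rewrite -big_distrr /= class_unique muln1.
rewrite -(leq_pmul2l (isT : 0 < 2)) mulnA.
apply: (@leq_trans (\sum_(k < H) \sum_(l < H)
  (coin (cls k) f + coin (cls l) f))).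
  rewrite big_distrr /=; apply: leq_sum => k _; rewrite big_distrr /=.
  apply: leq_sum => l _.
  have := cross_le (cls k) (cls l) f f.
  have := (nat_Cauchy (coin (cls k) f) (coin (cls l) f)).1.
  nia.
under eq_bigr => k _ do rewrite big_split /= sum_nat_const card_ord.
by rewrite big_split /= sum_nat_const card_ord -big_distrr /=; lia.
Qed.

End Classes.

Section LogConvexity.
Local Open Scope ring_scope.

Lemma sum_allpairs2 I J (s : seq I) (t : seq J) (F : I * J -> nat) :
  (\sum_(x <- [seq (i, j) | i <- s, j <- t]) F x =
   \sum_(i <- s) \sum_(j <- t) F (i, j))%N.
Proof. by rewrite big_allpairs. Qed.

(** Writing [f i + L j = f i' + L k] as [f i = f i' + L k - L j] turns the
    coincidences of [f + L] into mutual ones of [f] and [f + L - L], and the latter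
    family has as many internal coincidences as [f + L + L]. *)
Lemma coin_add_logconvex I J (s : seq I) (t : seq J) (f : I -> int)
    (L : J -> int) :
  (coin [seq (i, j) | i <- s, j <- t] (fun x => f x.1 + L x.2)%R ^ 2 <=
   coin s f *
   coin [seq (x, k) | x <- [seq (i, j) | i <- s, j <- t], k <- t]
     (fun y => f y.1.1 + L y.1.2 + L y.2)%R)%N.
Proof.
have := cross_le s
  [seq (x, k) | x <- [seq (i, j) | i <- s, j <- t], k <- t]
  f (fun y => f y.1.1 + L y.1.2 - L y.2)%R.
congr (_ ^ 2 <= _ * _)%N.
  rewrite /coin /cross sum_allpairs2; apply: eq_bigr => i _.
  under [RHS]eq_bigr => j _ do rewrite sum_allpairs2.
  rewrite sum_allpairs2 [RHS]exchange_big /=.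
  rewrite sum_allpairs2; apply: eq_bigr => i' _ /=.
  rewrite exchange_big /=.
  apply: eq_bigr => j _; apply: eq_bigr => k _ /=.
  by rewrite eq_sym subr_eq eq_sym.
rewrite /coin /cross !sum_allpairs2; apply: eq_bigr => i _; apply: eq_bigr => j _.
under [LHS]eq_bigr => k _ do rewrite !sum_allpairs2.
under [RHS]eq_bigr => k _ do rewrite !sum_allpairs2.
rewrite [LHS]exchange_big [RHS]exchange_big /=; apply: eq_bigr => i' _.
rewrite [LHS]exchange_big [RHS]exchange_big /=; apply: eq_bigr => j' _.
rewrite exchange_big /=; apply: eq_bigr => k' _; apply: eq_bigr => k _.
by congr nat_of_bool; apply/eqP/eqP => /=; lia.
Qed.

Fixpoint words J (r : nat) (t : seq J) : seq (seq J) :=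
  if r is r'.+1 then [seq j :: u | u <- words r' t, j <- t] else [:: [::]].

Definition wsum J (L : J -> int) (u : seq J) : int := \sum_(j <- u) L j.

(** As a function of [r] this is a sequence of moments: expanded in characters
    [e] it is the mean of [|F e| ^ 2 * |H e| ^ (2 r)], with [F] and [H] the
    exponential sums of [f] and [L]. Hence the log-convexity in [r]. *)
Definition mixed_coin I J (s : seq I) (t : seq J) (f : I -> int) (L : J -> int)
    (r : nat) : nat :=
  coin [seq (i, u) | i <- s, u <- words r t] (fun x => f x.1 + wsum L x.2).

Lemma sum_words_cons J r (t : seq J) (F : seq J -> nat) :
  (\sum_(u <- words r.+1 t) F u =
   \sum_(u <- words r t) \sum_(j <- t) F (j :: u))%N.
Proof. by rewrite /= big_allpairs_dep. Qed.

Lemma coin_pairs (B : eqType) I J (s : seq I) (t : seq J) (f : I * J -> B) :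
  coin [seq (i, j) | i <- s, j <- t] f =
  (\sum_(i <- s) \sum_(j <- t) \sum_(i' <- s) \sum_(j' <- t)
     (f (i, j) == f (i', j')))%N.
Proof.
rewrite /coin /cross sum_allpairs2.
by apply: eq_bigr => i _; apply: eq_bigr => j _; rewrite sum_allpairs2.
Qed.

Lemma wsum_cons J (L : J -> int) j u : wsum L (j :: u) = L j + wsum L u.
Proof. exact: big_cons. Qed.

Lemma mixed_coin_step I J (s : seq I) (t : seq J) f (L : J -> int) r :
  mixed_coin s t f L r.+1 =
  coin [seq (x, j) | x <- [seq (i, u) | i <- s, u <- words r t], j <- t]
    (fun y => f y.1.1 + wsum L y.1.2 + L y.2).
Proof.
rewrite /mixed_coin !coin_pairs sum_allpairs2; apply: eq_bigr => i _.
rewrite sum_words_cons; apply: eq_bigr => u _; apply: eq_bigr => j _.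
rewrite sum_allpairs2; apply: eq_bigr => i' _.
rewrite sum_words_cons; apply: eq_bigr => u' _; apply: eq_bigr => j' _.
by rewrite /= !wsum_cons !(addrCA (f _)) !(addrC (L _)).
Qed.

Lemma mixed_coin_logconvex I J (s : seq I) (t : seq J) f (L : J -> int) r :
  (mixed_coin s t f L r.+1 ^ 2 <=
   mixed_coin s t f L r * mixed_coin s t f L r.+2)%N.
Proof.
rewrite !mixed_coin_step.
have h := coin_add_logconvex [seq (i, u) | i <- s, u <- words r t] t
  (fun x => f x.1 + wsum L x.2) L.
apply: leq_trans h _; rewrite leq_mul2l.
apply/orP; right; rewrite /coin /cross.
rewrite !sum_allpairs2 leq_eqVlt; apply/orP; left; apply/eqP.
apply: eq_bigr => i _; rewrite sum_words_cons.
apply: eq_bigr => u _; apply: eq_bigr => j _; apply: eq_bigr => k _.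
rewrite !sum_allpairs2; apply: eq_bigr => i' _; rewrite sum_words_cons.
apply: eq_bigr => u' _; apply: eq_bigr => j' _; apply: eq_bigr => k' _.
by rewrite /= !wsum_cons !(addrCA (f _)) !(addrC (L j)) !(addrC (L j')).
Qed.

End LogConvexity.

(** The ratios [a r.+1 / a r] increase, so the first one is at most the geometric
    mean of the first [m.+1] of them. *)
Lemma logconvex_first (a : nat -> nat) :
    (forall r, a r.+1 ^ 2 <= a r * a r.+2) ->
  forall m, a 1 ^ m.+1 <= a 0 ^ m * a m.+1.
Proof.
move=> lc.
have ratio r : a 1 * a r <= a 0 * a r.+1.
  elim: r => [|r IH]; first by rewrite mulnC.
  have [->|pos] := posnP (a r.+1); first by rewrite muln0.
  rewrite -(leq_pmul2r pos).
  apply: (@leq_trans (a 1 * a r * a r.+2)).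
    by rewrite -!mulnA leq_mul2l mulnn lc orbT.
  by apply: leq_trans (leq_mul IH (leqnn _)) _; rewrite mulnAC.
elim=> [|m IH]; first by rewrite mul1n.
rewrite expnS [a 0 ^ _]expnSr -mulnA.
apply: leq_trans (leq_mul (leqnn _) IH) _.
by rewrite mulnCA leq_mul2l ratio orbT.
Qed.

Local Open Scope ring_scope.

Lemma mixed_coin0 I J (s : seq I) (t : seq J) f (L : J -> int) :
  mixed_coin s t f L 0 = coin s f.
Proof.
rewrite /mixed_coin coin_pairs /coin /cross; apply: eq_bigr => i _.
rewrite /= big_seq1; apply: eq_bigr => i' _.
by rewrite big_seq1 /wsum !big_nil !addr0.
Qed.

(** For fixed [i] and [i'] one counts mutual coincidences of [wsum L] and one of
    its translates. *)
Lemma mixed_coin_le I J (s : seq I) (t : seq J) f (L : J -> int) r :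
  (mixed_coin s t f L r <= size s ^ 2 * coin (words r t) (wsum L))%N.
Proof.
rewrite /mixed_coin coin_pairs.
have -> : (size s ^ 2 * coin (words r t) (wsum L) =
  \sum_(i <- s) \sum_(i' <- s) coin (words r t) (wsum L))%N.
  under eq_bigr => i _ do rewrite big_const_seq count_predT iter_addn_0 mulnC.
  by rewrite big_const_seq count_predT iter_addn_0 -mulnn; lia.
apply: leq_sum => i _; rewrite exchange_big /=; apply: leq_sum => i' _.
have hI : injective (fun x => f i' + x - f i) by move=> x y /(addIr _)/(addrI _).
apply: leq_trans (cross_inj_le (words r t) (wsum L) hI).
apply: leq_sum => u _; apply: leq_sum => u' _ /=.
by apply/eq_leq; congr nat_of_bool; apply/eqP/eqP => /=; lia.
Qed.

(** Each of the [2 X + 1] possible values of [g i - g j] contributes the mutual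
    coincidences of [g] and one of its translates. *)
Lemma coin_near (B : eqType) (I : eqType) (s : seq I) (f : I -> B)
    (g : I -> int) (X : nat) :
    {in s &, forall i j, f i = f j -> `|g i - g j| <= X%:Z} ->
  (coin s f <= (2 * X + 1) * coin s g)%N.
Proof.
move=> near; pose sh (k : nat) (x : int) := x + (k%:Z - X%:Z).
apply: (@leq_trans (\sum_(k < 2 * X + 1) cross s s g (sh k \o g))%N); last first.
  have -> : ((2 * X + 1) * coin s g = \sum_(k < 2 * X + 1) coin s g)%N.
    by rewrite sum_nat_const card_ord.
  by apply: leq_sum => k _; apply: cross_inj_le => x y /addIr.
rewrite exchange_big /=; rewrite /coin /cross big_seq [leqRHS]big_seq.
apply: leq_sum => i si.
rewrite exchange_big /=; rewrite big_seq [leqRHS]big_seq; apply: leq_sum => j sj.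
case: eqP => // /(near _ _ si sj); rewrite ler_norml => /andP[h1 h2].
have hk : (`|(g i - g j + X%:Z)%R| < 2 * X + 1)%N by lia.
rewrite (bigD1 (Ordinal hk)) //=.
suff -> : g i == sh `|(g i - g j + X%:Z)%R|%N (g j) by [].
by apply/eqP; rewrite /sh; lia.
Qed.

Lemma size_words J r (t : seq J) : size (words r t) = (size t ^ r)%N.
Proof. by elim: r => //= r IH; rewrite size_allpairs IH expnSr. Qed.

Local Open Scope nat_scope.

(** * The divisor bound and words with a given product *)

(** An entry of a word of product [n] divides [n], which leaves [D] choices for
    each entry. *)
Lemma words_prod_le (t : seq nat) (B D : nat) :
    uniq t -> all (fun j => 0 < j) t ->
    (forall n, 0 < n <= B -> size (divisors n) <= D) ->
  forall r n, 0 < n <= B ->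
  \sum_(u <- words r t) (\prod_(j <- u) j == n) <= D ^ r.
Proof.
move=> ut tpos hD; elim=> [|r IH] n nB.
  by rewrite /= big_seq1; case: eqP.
rewrite sum_words_cons exchange_big /=.
have npos : 0 < n by case/andP: nB.
apply: (@leq_trans (\sum_(j <- t | j %| n) D ^ r)).
  rewrite [leqRHS]big_mkcond /= big_seq [leqRHS]big_seq.
  apply: leq_sum => j jt; have jpos := allP tpos _ jt.
  case: ifPn => [/dvdnP[q nq]|ndiv].
    apply: (@leq_trans (\sum_(u <- words r t) (\prod_(i <- u) i == q))).
      apply: leq_sum => u _; rewrite big_cons nq mulnC.
      by rewrite eqn_pmul2r.
    apply: IH; move: nB; rewrite nq muln_gt0 => /andP[/andP[-> _] h].
    by rewrite (leq_trans _ h)// leq_pmulr.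
  rewrite big1// => u _; rewrite big_cons; case: eqP => // e.
  by rewrite -e dvdn_mulr in ndiv.
rewrite big_const_seq iter_addn_0 expnSr leq_mul2l.
apply/orP; right; apply: leq_trans (hD _ nB).
rewrite -size_filter uniq_leq_size ?filter_uniq// => j.
by rewrite mem_filter -dvdn_divisors// => /andP[].
Qed.

Lemma size_divisors n :
  0 < n -> size (divisors n) = \prod_(f <- prime_decomp n) f.2.+1.
Proof.
move=> _; rewrite /divisors; elim: (prime_decomp n) => [|[p e] l IH] /=.
  by rewrite big_nil.
rewrite big_cons -IH /=; set d := foldr _ _ _.
elim: e => [|e IHe]; first by rewrite mul1n.
by rewrite iterS size_merge size_cat size_map IHe mulSnr [in RHS]mulSn addnC [_ + size d]addnC.
Qed.

Lemma exp_le_exp2 k e : 0 < k -> e.+1 ^ k <= (2 * k ^ k) * 2 ^ e.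
Proof.
move=> k0; have h : e.+1 <= k * 2 ^ (e.+1 %/ k).
  apply: (@leq_trans (k * (e.+1 %/ k).+1)); last by rewrite leq_mul2l ltn_expl ?orbT.
  by rewrite mulnC ltnW// ltn_ceil.
apply: (@leq_trans ((k * 2 ^ (e.+1 %/ k)) ^ k)); first by rewrite leq_exp2r.
rewrite expnMn mulnAC -expnS mulnC leq_mul2r -expnM leq_exp2l//.
by rewrite leq_trunc_div orbT.
Qed.

(** The quotient [size (divisors n) ^ k / n] is the product of
    [e.+1 ^ k / p ^ e] over the prime powers [p ^ e] of [n]. A prime above [2 ^ k]
    contributes at most one, each of the others at most [2 * k ^ k]. *)
Theorem divisor_bound k : 0 < k ->
  exists C, forall n, 0 < n -> size (divisors n) ^ k <= C * n.
Proof.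
move=> k0; pose A := 2 * k ^ k; pose B := 2 ^ k.
have A1 : 0 < A by rewrite muln_gt0 expn_gt0 k0.
exists (A ^ B) => n n0.
pose c p := if p < B then A else 1.
rewrite size_divisors// [X in _ * X]prod_prime_decomp//.
apply: (@leq_trans (\prod_(f <- prime_decomp n) (c f.1 * f.1 ^ f.2))).
  have -> : (\prod_(f <- prime_decomp n) f.2.+1) ^ k =
      \prod_(f <- prime_decomp n) f.2.+1 ^ k.
    by apply: (big_morph (fun x => x ^ k)) => [x y|]; rewrite ?expnMn ?exp1n.
  rewrite big_seq [leqRHS]big_seq; apply: leq_prod => -[p e] /mem_prime_decomp.
  move=> [pp _ _] /=; rewrite /c; case: ltnP => pB.
    apply: leq_trans (exp_le_exp2 e k0) _; rewrite leq_mul2l.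
    by case: e => [|e]; rewrite ?orbT// leq_exp2r// prime_gt1 ?orbT.
  rewrite mul1n; apply: (@leq_trans (B ^ e)).
    by rewrite /B -expnM mulnC expnM leq_exp2r// ltn_expl.
  by case: e => // e; rewrite leq_exp2r.
rewrite big_split /= leq_mul2r; apply/orP; right.
have -> : \prod_(f <- prime_decomp n) c f.1 = \prod_(p <- primes n) c p.
  by rewrite /primes big_map.
have -> : \prod_(p <- primes n) c p = \prod_(p <- primes n | p < B) A.
  by rewrite [RHS]big_mkcond.
rewrite big_const_seq iter_muln_1 leq_pexp2l// -size_filter -{2}(size_iota 0 B).
apply: uniq_leq_size; first by rewrite filter_uniq// primes_uniq.
by move=> p; rewrite mem_filter mem_iota add0n => /andP[].
Qed.

Local Open Scope ring_scope.

(** * Coincidences of products, from logarithms and Hoelder's inequality *)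

Lemma mixed_coin1 (I J : eqType) (s : seq I) (t : seq J) f (L : J -> int) :
  mixed_coin s t f L 1 = coin [seq (i, j) | i <- s, j <- t] (fun x => f x.1 + L x.2).
Proof.
rewrite mixed_coin_step !coin_pairs sum_allpairs2; apply: eq_bigr => i _.
rewrite [X in X = _]big_seq1; apply: eq_bigr => j _.
rewrite sum_allpairs2; apply: eq_bigr => i' _.
rewrite [X in X = _]big_seq1; apply: eq_bigr => j' _.
by rewrite /wsum !big_nil !addr0.
Qed.

Section RealCoincidences.
Variable R : realType.
Implicit Types (x y z T : R).

Lemma int_norm_le (a : int) (X : nat) :
  a%:~R < (X%:Z + 1)%:~R :> R -> - (X%:Z + 1)%:~R < a%:~R :> R -> `|a| <= X%:Z.
Proof.
by rewrite -rmorphN /= !ltr_int => h1 h2; rewrite ler_norml; apply/andP; split; lia.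
Qed.

Lemma floor_near x y (X : nat) : `|x - y| <= X%:R ->
  `|Num.floor x - Num.floor y| <= X%:Z.
Proof.
move=> h; have /andP[a b] := floor_itv x; have /andP[c d] := floor_itv y.
move: h; rewrite ler_norml => /andP[e f].
have h1 : ((Num.floor x - Num.floor y)%:~R : R) < (X%:Z + 1)%:~R.
  by rewrite !rmorphD/= !rmorphN /= in b d *; lra.
have h2 : ((Num.floor y - Num.floor x)%:~R : R) < (X%:Z + 1)%:~R.
  by rewrite !rmorphD/= !rmorphN /= in b d *; lra.
rewrite !ltr_int in h1 h2; rewrite ler_norml; apply/andP; split; lia.
Qed.

Lemma floor_eq_near x y : Num.floor x = Num.floor y -> `|x - y| < 1.
Proof.
move=> h; have /andP[a b] := floor_itv x; have /andP[c d] := floor_itv y.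
by rewrite h !rmorphD/= in a b c d; rewrite ltr_norml; apply/andP; split; lra.
Qed.

Lemma ln_sub_le x y : 0 < x -> 0 < y -> ln x - ln y <= (x - y) / y.
Proof.
move=> x0 y0; rewrite -ln_div ?posrE//.
have -> : x / y = 1 + (x - y) / y by field; lra.
apply: le_ln1Dx; have -> : (x - y) / y = x / y - 1 by field; lra.
by rewrite ltrBrDr addrC subrr divr_gt0.
Qed.

Lemma ln_near x y z : 0 < z -> z <= x -> z <= y ->
  `|ln x - ln y| <= `|x - y| / z.
Proof.
move=> z0 zx zy; have x0 : 0 < x by lra. have y0 : 0 < y by lra.
have key u v : z <= u -> z <= v -> ln u - ln v <= `|u - v| / z.
  move=> zu zv; have v0 : 0 < v by lra.
  apply: le_trans (ln_sub_le _ v0) _; first by lra.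
  apply: (@le_trans _ _ (`|u - v| / v)).
    by rewrite ler_wpM2r ?invr_ge0 ?(ltW v0)// ler_norm.
  by rewrite ler_wpM2l// lef_pV2 ?posrE.
rewrite ler_norml lerNl opprB; apply/andP; split; last exact: key.
by rewrite distrC; exact: key.
Qed.

Lemma ln_far x y z : 0 < x -> 0 < y -> x <= z -> y <= z ->
  `|x - y| <= z * `|ln x - ln y|.
Proof.
move=> x0 y0 xz yz; have z0 : 0 < z by lra.
have key u v : 0 < u -> 0 < v -> u <= z -> u - v <= z * `|ln u - ln v|.
  move=> u0 v0 uz; have := ln_sub_le v0 u0.
  rewrite ler_pdivlMr// => h.
  have h1 : ln u - ln v <= `|ln u - ln v| := ler_norm _.
  have : (ln u - ln v) * u <= `|ln u - ln v| * z.
    apply: (@le_trans _ _ (`|ln u - ln v| * u)).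
      by rewrite ler_wpM2r// (ltW u0).
    by rewrite ler_wpM2l.
  lra.
rewrite ler_norml lerNl opprB; apply/andP; split; last exact: key.
by rewrite distrC; exact: key.
Qed.

Lemma ln_prod_words (u : seq nat) : all (fun j => (0 < j)%N) u ->
  ln ((\prod_(j <- u) j)%N%:R : R) = \sum_(j <- u) ln j%:R.
Proof.
elim: u => [|j u IH]; first by rewrite !big_nil ln1.
move=> /= /andP[j0 u0]; rewrite !big_cons natrM lnM ?IH// ?posrE ?ltr0n//.
by rewrite big_seq prodn_cond_gt0// => i /(allP u0).
Qed.

Lemma mem_words (J : eqType) r (t : seq J) u :
  u \in words r t -> size u = r /\ {subset u <= t}.
Proof.
elim: r u => [|r IH] u /=; first by rewrite inE => /eqP->.
move=> /allpairsP[[v j] /= [vin jin ->]]; have [sz sub] := IH _ vin.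
split; first by rewrite /= sz.
by move=> k; rewrite inE => /orP[/eqP->//|/sub].
Qed.

Lemma prod_le_exp (t u : seq nat) b r : all (fun j => (j <= b)%N) t ->
  size u = r -> {subset u <= t} -> (\prod_(j <- u) j <= b ^ r)%N.
Proof.
move=> tb <- ut; have := iter_muln_1; rewrite -(count_predT u).
move=> _; rewrite -iter_muln_1 -big_const_seq big_seq [leqRHS]big_seq.
by apply: leq_prod => j /ut /(allP tb).
Qed.

(** Here [D i] lies between [D0] and [D1], and [j] between [J0] and [J1]. The scale
    [T = J0 * D0] is the least possible value of [j * D i], so changing such a
    product by less than one changes [T] times its logarithm by less than one.
    Rounding makes additive integer data [ell i + L j] out of the products. *)
Section OneClass.
Variables (I : eqType) (s : seq I) (D : I -> R) (t : seq nat).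
Variables (D0 D1 : R) (J0 J1 X0 X1 Dv m : nat).
Hypotheses (D0gt0 : 0 < D0) (D0le : {in s, forall i, D0 <= D i})
  (leD1 : {in s, forall i, D i <= D1}).
Hypotheses (J0gt0 : (0 < J0)%N) (J0le : {in t, forall j, J0 <= j}%N)
  (leJ1 : {in t, forall j, j <= J1}%N) (ut : uniq t).
Hypothesis X0P : D1 / (J0%:R * D0) <= X0%:R.
Hypothesis X1P : J1%:R ^+ m.+1 * m.+1%:R / (J0%:R * D0) <= X1%:R.
Hypothesis DvP : forall n, (0 < n <= J1 ^ m.+1)%N -> (size (divisors n) <= Dv)%N.

Let T : R := J0%:R * D0.
Let ell i := Num.floor (T * ln (D i)).
Let L (j : nat) := Num.floor (T * ln (j%:R : R)).

Let T0 : 0 < T. Proof. by rewrite mulr_gt0// ltr0n. Qed.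

Lemma coin_products_le_mixed :
  (coin [seq (i, j) | i <- s, j <- t]
     (fun w => Num.floor (w.2%:R * D w.1)) <= 7 * mixed_coin s t ell L 1)%N.
Proof.
rewrite mixed_coin1 -[7%N]/(2 * 3 + 1)%N; apply: coin_near => x y.
case/allpairsP => -[i j] /= [si tj ->] /=.
case/allpairsP => -[i' j'] /= [si' tj' ->] /= /floor_eq_near h.
have pos k l : k \in s -> l \in t -> [/\ 0 < D k, 0 < l%:R :> R & T <= l%:R * D k].
  move=> sk tl; have Dk := D0le sk; have := J0le tl; rewrite -(ler_nat R) => Jl.
  have J0' : (0:R) < J0%:R by rewrite ltr0n.
  split; [exact: lt_le_trans Dk|exact: lt_le_trans Jl|].
  by rewrite ler_pM// ltW.
have [Di ji Tij] := pos _ _ si tj; have [Di' ji' Tij'] := pos _ _ si' tj'.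
have := ln_near T0 Tij Tij'; rewrite !lnM ?posrE// ler_pdivlMr// mulrC.
rewrite -[in X in X * _](gtr0_norm T0) -normrM => h2.
have {h2 h} : `|T * (ln j%:R + ln (D i) - (ln j'%:R + ln (D i')))| < 1.
  exact: le_lt_trans h2 h.
rewrite /ell /L.
have /andP[a1 b1] := floor_itv (T * ln (D i)).
have /andP[a2 b2] := floor_itv (T * ln (D i')).
have /andP[a3 b3] := floor_itv (T * ln (j%:R : R)).
have /andP[a4 b4] := floor_itv (T * ln (j'%:R : R)).
rewrite ltr_norml => /andP[h1 h2].
set e1 := Num.floor _ in a1 b1 *; set e2 := Num.floor _ in a2 b2 *.
set e3 := Num.floor _ in a3 b3 *; set e4 := Num.floor _ in a4 b4 *.
rewrite !rmorphD/= in b1 b2 b3 b4.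
(* The real sums differ by less than one and each rounding costs less than one,
   in the same direction on either side: three is a bound for the integers. *)
have k1 : ((e1 - e2 + (e3 - e4))%:~R : R) < (3%:Z + 1)%:~R.
  by rewrite !rmorphD !rmorphN /=; lra.
have k2 : (- (3%:Z + 1)%:~R : R) < ((e1 - e2 + (e3 - e4))%:~R : R).
  by rewrite !rmorphD !rmorphN /=; lra.
have -> : e1 + e3 - (e2 + e4) = e1 - e2 + (e3 - e4) by rewrite opprD addrACA.
exact: int_norm_le k1 k2.
Qed.

(** Values up to [D1] whose logarithms agree at scale [T] are within [D1 / T]. *)
Lemma coin_log_le : (coin s ell <= (2 * X0 + 1) * coin s (fun i => Num.floor (D i)))%N.
Proof.
apply: coin_near => i i' si si' /floor_eq_near h.
apply: floor_near; apply: le_trans X0P.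
have Di : 0 < D i by apply: lt_le_trans (D0le si).
have Di' : 0 < D i' by apply: lt_le_trans (D0le si').
apply: le_trans (ln_far Di Di' (leD1 si) (leD1 si')) _.
have D1gt0 : 0 < D1 by apply: lt_le_trans (leD1 si).
rewrite -mulrBr normrM (gtr0_norm T0) in h.
rewrite -/T ler_pM2l// ltW//.
by rewrite -[ltRHS]mul1r ltr_pdivlMr// mulrC.
Qed.

(** The rounded logarithms of a word add up to that of its product with an error
    of at most [m.+1], which leaves [X1] as a bound for the distance of two
    coinciding products; a product leaves few words by the divisor bound. *)
Lemma coin_words_le :
  (coin (words m.+1 t) (wsum L) <=
   (2 * X1 + 1) * (size t ^ m.+1 * Dv ^ m.+1))%N.
Proof.
have tpos : all (fun j => (0 < j)%N) t.
  by apply/allP => j /J0le; apply: leq_trans.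
have tle : all (fun j => (j <= J1)%N) t by apply/allP => j /leJ1.
have wpos u : u \in words m.+1 t -> all (fun j => (0 < j)%N) u.
  by move=> /mem_words[_ ut']; apply/allP => j /ut' /(allP tpos).
have ppos u : u \in words m.+1 t -> (0 < \prod_(j <- u) j)%N.
  by move=> /wpos ua; rewrite big_seq prodn_cond_gt0// => i /(allP ua).
have ple u : u \in words m.+1 t -> (\prod_(j <- u) j <= J1 ^ m.+1)%N.
  by move=> /mem_words[sz sub]; exact: prod_le_exp tle sz sub.
apply: (@leq_trans ((2 * X1 + 1) *
    coin (words m.+1 t) (fun u => (\prod_(j <- u) j)%N%:Z))%N).
  apply: coin_near => u v uw vw huv.
  rewrite -(ler_int R) intr_norm rmorphB /=; apply: le_trans X1P.
  have := @ln_far (\prod_(j <- u) j)%N%:R (\prod_(j <- v) j)%N%:R (J1%:R ^+ m.+1).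
  rewrite !ltr0n -natrX !ler_nat => /(_ (ppos _ uw) (ppos _ vw) (ple _ uw) (ple _ vw)).
  move=> h; apply: le_trans h _; rewrite -mulrA ler_wpM2l// ler_pdivlMr//.
  rewrite -/T mulrC -(gtr0_norm T0) -normrM.
  have err w : w \in words m.+1 t ->
      0 <= T * ln ((\prod_(j <- w) j)%N%:R : R) - (wsum L w)%:~R <= m.+1%:R.
    move=> ww; rewrite ln_prod_words ?wpos// /wsum rmorph_sum /= big_distrr /=.
    have [<- _] := mem_words ww; elim: (w) => [|j w' IH].
      by rewrite !big_nil subrr lexx.
    rewrite !big_cons /=; have /andP[a b] := floor_itv (T * ln (j%:R : R)).
    by rewrite -/(L j) rmorphD /= in a b; move: IH => /andP[c d]; rewrite -natr1; lra.
  have /andP[a b] := err _ uw; have /andP[c d] := err _ vw.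
  by rewrite huv in a b; rewrite mulrBr ler_norml; apply/andP; split; lra.
rewrite leq_mul2l; apply/orP; right.
rewrite -size_words /coin /cross big_seq.
apply: (@leq_trans (\sum_(u <- words m.+1 t) Dv ^ m.+1)%N); last first.
  by rewrite big_const_seq count_predT iter_addn_0 mulnC.
rewrite [leqRHS]big_seq; apply: leq_sum => u uw.
have uB : (0 < \prod_(j <- u) j <= J1 ^ m.+1)%N by rewrite ppos// ple.
apply: leq_trans (words_prod_le ut tpos DvP m.+1 uB).
by apply: leq_sum => v _; rewrite eq_sym eqz_nat.
Qed.

(** Log-convexity of the mixed counts bounds the count for one factor [j] by the
    energy of [D] and by the count for words of [m.+1] factors; for the latter the
    arithmetic of the integers [j] is available. This is Hoelder's inequality for
    the moments behind [mixed_coin]. *)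
Theorem coin_products_class :
  (coin [seq (i, j) | i <- s, j <- t]
     (fun w => Num.floor (w.2%:R * D w.1)) ^ m.+1 <=
   7 ^ m.+1 *
   (((2 * X0 + 1) * coin s (fun i => Num.floor (D i))) ^ m *
    (size s ^ 2 * ((2 * X1 + 1) * (size t ^ m.+1 * Dv ^ m.+1)))))%N.
Proof.
apply: (@leq_trans ((7 * mixed_coin s t ell L 1) ^ m.+1)).
  by rewrite leq_exp2r// coin_products_le_mixed.
rewrite expnMn leq_mul2l; apply/orP; right.
apply: leq_trans (logconvex_first (mixed_coin_logconvex s t ell L) m) _.
rewrite mixed_coin0; apply: leq_mul.
  by case: (m) => // k; rewrite leq_exp2r// coin_log_le.
apply: leq_trans (mixed_coin_le _ _ _ _ _) _.
by rewrite leq_mul2l coin_words_le orbT.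
Qed.

End OneClass.
End RealCoincidences.

(** * Energy of sequences with growing gaps *)

(** The larger index comes first, so that an increasing sequence has positive
    differences. *)
Definition index_pairs (n0 N : nat) : seq (nat * nat) :=
  [seq q <- [seq (a, b) | a <- iota 1 N, b <- iota 1 N] | (n0 <= q.2 < q.1)%N].

Lemma mem_index_pairs n0 N q :
  (q \in index_pairs n0 N) = (n0 <= q.2 < q.1)%N && (0 < q.2)%N && (q.1 <= N)%N.
Proof.
case: q => a b; rewrite mem_filter /=.
apply/andP/andP => [[h /allpairsP[[u v] /= [uN vN [e1 e2]]]]|[/andP[h b0] aN]].
  by move: h uN vN; rewrite e1 e2 /= !mem_iota; lia.
split => //; apply/allpairsP; exists (a, b) => /=; rewrite !mem_iota; split => //; lia.
Qed.

Lemma index_pairs_uniq n0 N : uniq (index_pairs n0 N).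
Proof.
by apply/filter_uniq/allpairs_uniq; rewrite ?iota_uniq// => -[a b] [c d] /= _ _ [-> ->].
Qed.

Lemma size_index_pairs n0 N : (size (index_pairs n0 N) <= N ^ 2)%N.
Proof.
by rewrite size_filter (leq_trans (count_size _ _))// size_allpairs size_iota mulnn.
Qed.

Section Energy.
Variable R : realType.

Lemma lt00_absurd (P : Prop) : (0 : R) < 0 -> P.
Proof. by rewrite ltxx. Qed.

Lemma spaced_le (y : nat -> R) (n0 a k : nat) :
    (forall n, (n0 <= n)%N -> y n + 1 <= y n.+1) -> (n0 <= a)%N ->
  y a + k%:R <= y (a + k)%N.
Proof.
move=> sp na; elim: k => [|k IH]; first by rewrite addr0 addn0.
rewrite addnS -natr1; have := sp (a + k)%N; rewrite (leq_trans na) ?leq_addr//.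
by move=> /(_ isT); lra.
Qed.

Lemma spaced_lt (y : nat -> R) (n0 a b : nat) :
    (forall n, (n0 <= n)%N -> y n + 1 <= y n.+1) -> (n0 <= a)%N -> (a < b)%N ->
  y a + 1 <= y b.
Proof.
move=> sp na ab; have := spaced_le (b - a) sp na.
rewrite subnKC 1?ltnW// => h; apply: le_trans h; rewrite lerD2l.
by rewrite ler1n subn_gt0.
Qed.

(** The centre [c] cuts the interval into two parts of length one, and a
    sequence with gaps at least one has at most one term in each. *)
Lemma spaced_count (y : nat -> R) (n0 : nat) (c : R) (t : seq nat) :
    (forall n, (n0 <= n)%N -> y n + 1 <= y n.+1) -> uniq t ->
  (\sum_(a <- t) ((n0 <= a) && (`|y a - c| < 1)%R) <= 2)%N.
Proof.
move=> sp ut.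
rewrite -big_mkcond /= sum1_count -size_filter.
pose g a := (c <= y a) : nat.
set t' := seq.filter _ t; have : uniq t' by exact: filter_uniq.
have : {in t' &, injective g}.
  move=> a b; rewrite !mem_filter => /andP[/andP[na ha] _] /andP[/andP[nb hb] _].
  rewrite /g; move: ha hb; rewrite !ltr_norml => /andP[h1 h2] /andP[h3 h4] e.
  have e' : (c <= y a) = (c <= y b) by move: e; do 2 case: (c <= _).
  case: (ltngtP a b) => // ab; exfalso.
    have := spaced_lt sp na ab; move: e'.
    by case: (lerP c (y a)); case: (lerP c (y b)) => // *; apply: lt00_absurd; lra.
  have := spaced_lt sp nb ab; move: e'.
  by case: (lerP c (y a)); case: (lerP c (y b)) => // *; apply: lt00_absurd; lra.
move=> gI ut'; rewrite -(size_map g) -[2%N]/(size [:: 0; 1]%N).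
apply: uniq_leq_size; first by rewrite map_inj_in_uniq.
by move=> k /mapP[a _ ->]; rewrite /g; case: (_ <= _).
Qed.

Section Convex.
Variables (x : nat -> R) (n0 N G : nat).
Hypothesis x_spaced : forall n, (n0 <= n)%N -> x n + 1 <= x n.+1.
Hypothesis x_convex : forall n, (n0 <= n)%N ->
  x n.+1 - x n + 1 <= x n.+2 - x n.+1.
Hypothesis G0 : (0 < G)%N.

Let D (q : nat * nat) : R := x q.1 - x q.2.
Let f q := Num.floor (D q).
(** The sum of the numbers of the blocks of length [G] that contain the two
    indices. It increases along a fibre of [f], and determines both block numbers
    there. The minimum only serves to bound it for all pairs. *)
Let c (q : nat * nat) := minn (q.1 %/ G + q.2 %/ G)%N (2 * (N %/ G)).

Lemma shift_spaced k n : (n0 <= n)%N ->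
  (x (n + k.+1)%N - x n) + 1 <= x (n.+1 + k.+1)%N - x n.+1.
Proof.
move=> nn; elim: k => [|k IH]; first by rewrite !addn1; apply: x_convex.
rewrite !(addnS _ k.+1).
have := x_convex (n := (n + k.+1)%N); rewrite (leq_trans nn) ?leq_addr//.
move=> /(_ isT); rewrite -[(n + k.+1).+1]/(n.+1 + k.+1)%N; lra.
Qed.

Let close (a b k b' : nat) : bool :=
  [&& (n0 <= a)%N, (b < b' < b + G)%N & `|(x (a + k)%N - x a) - (x b' - x b)| < 1].

(** For given [b], [b'] and [k] the numbers [x (a + k) - x a] have gaps at least
    one by convexity, which leaves two possibilities for [a]. *)
Lemma close_count : (\sum_(b <- iota 1 N) \sum_(b' <- iota 1 N)
  \sum_(k <- iota 1 G) \sum_(a <- iota 1 N) close a b k b' <= N * (G * (G * 2)))%N.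
Proof.
apply: (@leq_trans (\sum_(b <- iota 1 N) (G * (G * 2)))%N); last first.
  by rewrite big_const_seq count_predT iter_addn_0 size_iota mulnC.
apply: leq_sum => b _.
apply: (@leq_trans (\sum_(b' <- iota 1 N | b < b' < b + G) (G * 2))%N).
  rewrite [leqRHS]big_mkcond; apply: leq_sum => b' _.
  case: ifP => hb; last first.
    by rewrite big1// => k _; rewrite big1// => a _; rewrite /close hb andbF.
  apply: (@leq_trans (\sum_(k <- iota 1 G) 2)%N); last first.
    by rewrite big_const_seq count_predT iter_addn_0 size_iota mulnC.
  rewrite big_seq [leqRHS]big_seq; apply: leq_sum => k.
  rewrite mem_iota => /andP[k1 _].
  apply: leq_trans (spaced_count (y := fun a => x (a + k)%N - x a) (n0 := n0)
    (x b' - x b) _ (iota_uniq 1 N)).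
    by apply: leq_sum => a _; rewrite /close hb.
  by case: k k1 => // k _ n nn; apply: shift_spaced.
rewrite big_const_seq iter_addn_0 mulnC leq_mul2r; apply/orP; right.
rewrite -size_filter -[leqRHS](size_iota b.+1).
apply: uniq_leq_size; first by rewrite filter_uniq// iota_uniq.
by move=> i; rewrite mem_filter !mem_iota; lia.
Qed.

Lemma same_blocks u v u' v' : (u <= u')%N -> (v <= v')%N ->
  (u %/ G + v %/ G = u' %/ G + v' %/ G)%N -> (u' < u + G /\ v' < v + G)%N.
Proof.
move=> uu vv e; have h1 := leq_div2r G uu; have h2 := leq_div2r G vv.
have [e1 e2] : (u %/ G = u' %/ G /\ v %/ G = v' %/ G)%N by lia.
have := divn_eq u G; have := divn_eq u' G; have := divn_eq v G.
have := divn_eq v' G; rewrite e1 e2.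
by have := ltn_pmod u' G0; have := ltn_pmod v' G0; lia.
Qed.

Lemma mem_gap u u' : (u < u')%N -> (u' < u + G)%N -> (u' - u)%N \in iota 1 G.
Proof. by rewrite mem_iota; lia. Qed.

Lemma gap_neq u u' k : (u < u')%N -> k != (u' - u)%N -> (u' == u + k)%N = false.
Proof. by move=> uu' /eqP kn; case: eqP => // e; exfalso; apply: kn; lia. Qed.

(** Order a coincidence of distinct pairs so that the first coordinate grows; then
    the second one grows too, and both growths are less than [G] when the block
    sums agree. The coincidence is determined by the second coordinates [b], [b'],
    the growth [k] of the first one and its starting point [a]. *)
Lemma coin_block : (coin (index_pairs n0 N) (fun q => (f q, c q)) <=
  N ^ 2 + 2 * (N * (G * (G * 2))))%N.
Proof.
pose s := index_pairs n0 N.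
pose up (q r : nat * nat) : nat := (\sum_(k <- iota 1 G)
  (r.1 == q.1 + k) * close q.1 q.2 k r.2)%N.
have split3 q r : q \in s -> r \in s ->
    ((f q, c q) == (f r, c r) <= (q == r) + (up q r + up r q))%N.
  case: q => a b; case: r => a' b'; rewrite !mem_index_pairs /=.
  move=> /andP[/andP[/andP[nb ba] b0] aN] /andP[/andP[/andP[nb' ba'] b0'] aN'].
  rewrite xpair_eqE; case: eqP => //= fE; case: eqP => //= cE.
  have {cE} cE : (a %/ G + b %/ G = a' %/ G + b' %/ G)%N.
    have h1 := leq_div2r G aN; have h2 := leq_div2r G aN'.
    have h3 := leq_div2r G (leq_trans (ltnW ba) aN).
    have h4 := leq_div2r G (leq_trans (ltnW ba') aN').
    by move: cE; rewrite /c /=; lia.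
  have := floor_eq_near fE; rewrite /D /= => near.
  have key u v u' v' : (n0 <= u)%N -> (n0 <= v')%N -> (u < u')%N ->
      (u %/ G + v %/ G = u' %/ G + v' %/ G)%N ->
      `|(x u - x v) - (x u' - x v')| < 1 -> up (u, v) (u', v') = 1%N.
    move=> nu nv uu' e h.
    have vv' : (v < v')%N.
      rewrite ltnNge; apply/negP => le.
      have := spaced_lt x_spaced nu uu'; move: h; rewrite ltr_norml => /andP[h1 h2].
      case: (ltngtP v' v) le => // [lt|e'] _; last by rewrite e' in h1 => ?; apply: lt00_absurd; lra.
      by have := spaced_lt x_spaced nv lt => *; apply: lt00_absurd; lra.
    have [h1 h2] := same_blocks (ltnW uu') (ltnW vv') e.
    have kin := mem_gap uu' h1.
    rewrite /up (bigD1_seq (u' - u)%N) ?iota_uniq//= big1 ?addn0.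
      rewrite /close /= (subnKC (ltnW uu')) eqxx nu vv' h2 /=.
      have -> : (x u' - x u) - (x v' - x v) = - ((x u - x v) - (x u' - x v')) by ring.
      by rewrite normrN h.
    by move=> k kn; rewrite (gap_neq uu' kn).
  have na := leq_trans nb (ltnW ba); have na' := leq_trans nb' (ltnW ba').
  case: (ltngtP a a') => aa'.
  - by rewrite key// addnCA leq_addr.
  - by rewrite (key a' b' a b) 1?distrC// addnA addn1.
  - subst a'; case: (ltngtP b b') => bb'; last by subst b'; rewrite eqxx.
      have := spaced_lt x_spaced nb bb'; move: near; rewrite ltr_norml.
      by move=> /andP[] *; apply: lt00_absurd; lra.
    have := spaced_lt x_spaced nb' bb'; move: near; rewrite ltr_norml.
    by move=> /andP[] *; apply: lt00_absurd; lra.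
have upsum : (\sum_(q <- s) \sum_(r <- s) up q r <= N * (G * (G * 2)))%N.
  apply: leq_trans close_count.
  pose bx := [seq (a, b) | a <- iota 1 N, b <- iota 1 N].
  apply: (@leq_trans (\sum_(q <- bx) \sum_(r <- bx) up q r)%N).
    rewrite /s /index_pairs big_filter [leqLHS]big_mkcond /=; apply: leq_sum => q _.
    case: ifP => // _; rewrite big_filter [leqLHS]big_mkcond /=; apply: leq_sum => r _.
    by case: ifP.
  rewrite /bx sum_allpairs2 exchange_big /=; apply: leq_sum => b _.
  apply: (@leq_trans (\sum_(b' <- iota 1 N) \sum_(a <- iota 1 N)
     \sum_(a' <- iota 1 N) up (a, b) (a', b'))%N).
    rewrite [leqRHS]exchange_big /=; apply: leq_sum => a _.
    by rewrite sum_allpairs2 exchange_big.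
  apply: leq_sum => b' _; rewrite [leqRHS]exchange_big /=; apply: leq_sum => a _.
  rewrite /up exchange_big /=; apply: leq_sum => k _.
  rewrite -big_distrl /= -[leqRHS]mul1n leq_mul2r; apply/orP; right.
  rewrite -[(\sum_(i <- _) _)%N]/(\sum_(i <- iota 1 N) (i == a + k)%N)%N.
  rewrite -big_mkcond /= sum1_count.
  by rewrite (count_uniq_mem _ (iota_uniq _ _)) leq_b1.
apply: (@leq_trans (\sum_(q <- s) \sum_(r <- s) ((q == r) + (up q r + up r q)))%N).
  rewrite /coin /cross big_seq [leqRHS]big_seq; apply: leq_sum => q qs.
  by rewrite big_seq [leqRHS]big_seq; apply: leq_sum => r rs; exact: split3.
under eq_bigr => q _ do rewrite !big_split /=.
rewrite !big_split /= [in X in (_ + (_ + X))%N]exchange_big /= mul2n -addnn.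
apply: leq_add; last exact: leq_add.
apply: leq_trans (size_index_pairs n0 N); rewrite -/s -sum1_size.
apply: leq_sum => q _; rewrite -big_mkcond /= sum1_count.
by rewrite (eq_count (a2 := pred1 q)) ?(count_uniq_mem _ (index_pairs_uniq _ _)) ?leq_b1// => r; rewrite /= eq_sym.
Qed.

(** Along a fibre of the difference both coordinates increase together, so the
    fibre visits at most [2 N / G + 1] pairs of blocks of length [G]; inside one
    pair of blocks, convexity leaves at most two starting points once the two
    shifts are fixed. *)
Theorem convex_energy :
  (coin (index_pairs n0 N) (fun q => Num.floor (x q.1 - x q.2)) <=
   (2 * (N %/ G) + 1) * (N ^ 2 + 4 * (N * G ^ 2)))%N.
Proof.
have cH q : (c q < 2 * (N %/ G) + 1)%N by rewrite /c; lia.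
apply: leq_trans (coin_classes _ f cH) _; rewrite leq_mul2l; apply/orP; right.
rewrite -coin_split//.
by apply: leq_trans coin_block _; rewrite leq_add2l -mulnn; lia.
Qed.

End Convex.
End Energy.

Definition off_diagonal (I B : eqType) (s : seq I) (f : I -> B) : seq (I * I) :=
  [seq p <- [seq (q, r) | q <- s, r <- s] | (f p.1 == f p.2) && (p.1 != p.2)].

Lemma coin_off_diagonal (I B : eqType) (s : seq I) (f : I -> B) : uniq s ->
  (coin s f <= size s + size (off_diagonal s f))%N.
Proof.
move=> us; rewrite /off_diagonal size_filter -sum1_count big_mkcond sum_allpairs2 /=.
rewrite -sum1_size -big_split /=; apply: leq_sum => q _.
apply: (@leq_trans (\sum_(r <- s) ((q == r) + ((f q == f r) && (q != r))))%N).
  by apply: leq_sum => r _; case: (q == r); case: (f q == f r).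
rewrite big_split /= leq_add//.
rewrite -big_mkcond /= sum1_count (eq_count (a2 := pred1 q)).
  by rewrite (count_uniq_mem _ us) leq_b1.
by move=> r; rewrite /= eq_sym.
Qed.

(** * Energy of quadratic polynomials *)

(** In terms of the difference [h] and the sum [m] of the indices, the values
    differ by [(a * m + b) * h]. If this is the same up to less than one for
    [(h, m)] and [(h', m')], then [h * m - h' * m'] is one of two integers that
    depend only on [w = h - h']. Since [h * m - h' * m' - w * m' = h * (m - m')],
    the numbers [w], [m'] and a choice among two determine a nonzero integer of
    which [h] is a divisor. *)
Section QuadraticEnergy.
Variable R : realType.
Variables (a b : R) (n0 N Dv : nat).
Hypothesis a1 : 1 <= a.
Hypothesis steep : forall m : nat, (n0 <= m)%N -> 1 <= a * m%:R + b.
Hypothesis DvP : forall n, (0 < n <= 2 * N ^ 2)%N -> (size (divisors n) <= Dv)%N.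

Let a0 : 0 < a. Proof. exact: lt_le_trans a1. Qed.

Let x (n : nat) : R := a * n%:R ^+ 2 + b * n%:R.
Let f (q : nat * nat) := Num.floor (x q.1 - x q.2).
Let h (q : nat * nat) : nat := q.1 - q.2.
Let m (q : nat * nat) : nat := q.1 + q.2.
Let Y (w : int) : int := Num.floor (- (b / a * w%:~R)).
(** The integer [h * (m - m')], computed from [m'], [w + N] and the choice [k.2]
    among two integers. *)
Let Zc (k : nat * nat * nat) : int :=
  let w := k.1.2%:Z - N%:Z in Y w + k.2%:Z - w * k.1.1%:Z.
Let dvs (n : nat) := if (0 < n <= 2 * N ^ 2)%N then divisors n else [::].
Let K := [seq (k, e) | k <- [seq (i, j) | i <- iota 0 (2 * N + 1), j <- iota 0 (2 * N + 1)],
                       e <- iota 0 2].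
(** A coincidence is encoded by [m'], [h - h'], the choice among two integers and
    the divisor [h]; the shift by [N] avoids negative numbers. *)
Let code (p : (nat * nat) * (nat * nat)) : (nat * nat * nat) * nat :=
  let w := (h p.1)%:Z - (h p.2)%:Z in
  let z := (h p.1)%:Z * (m p.1)%:Z - (h p.2)%:Z * (m p.2)%:Z in
  ((m p.2, h p.1 + N - h p.2, `|(z - Y w)%R|), h p.1)%N.

Let sum_range (u v : nat) : (u <= N)%N -> (v <= N)%N -> (0 <= u + v < 0 + (2 * N + 1))%N.
Proof. lia. Qed.

Let diff_range (u v w : nat) : (u <= N)%N -> (0 <= u - v + N - w < 0 + (2 * N + 1))%N.
Proof. lia. Qed.

Let lt2_iota k : (k < 2)%N -> k \in iota 0 2.
Proof. by case: k => [|[|]]. Qed.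

Let dist_range (u v : nat) : (u <= 2 * N)%N -> (v <= 2 * N)%N -> u != v ->
  (0 < `|(u%:Z - v%:Z)%R| <= 2 * N)%N.
Proof. lia. Qed.

Let shift_inj (u v w : nat) : (v <= N)%N -> (w <= N)%N -> (u + N - v = u + N - w)%N -> v = w.
Proof. lia. Qed.

Let norm_lt1 (u v : nat) : `|u%:Z - v%:Z| < 1 -> u == v.
Proof. lia. Qed.

Let shiftE (u v : nat) : (v <= N)%N -> (u + N - v)%N%:Z - N%:Z = u%:Z - v%:Z.
Proof. lia. Qed.

Let pair_of_hm (q r : nat * nat) : (q.2 < q.1)%N -> (r.2 < r.1)%N ->
  h q = h r -> m q = m r -> q = r.
Proof.
case: q => u v; case: r => u' v'; rewrite /h /m /= => A B C E.
by congr (_, _); lia.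
Qed.

Lemma products_near q r : (q.2 < q.1)%N -> (r.2 < r.1)%N -> f q = f r ->
  `|((h q)%:R * (m q)%:R - (h r)%:R * (m r)%:R +
     b / a * ((h q)%:R - (h r)%:R)) * a| < 1.
Proof.
move=> qq rr /floor_eq_near; rewrite /x /h /m !natrD !natrB 1?ltnW//.
rewrite [X in `|X| < _ -> _](_ : _ = ((q.1%:R - q.2%:R) * (q.1%:R + q.2%:R) -
   (r.1%:R - r.2%:R) * (r.1%:R + r.2%:R) +
     b / a * ((q.1%:R - q.2%:R) - (r.1%:R - r.2%:R))) * a) //.
by field; rewrite gt_eqF.
Qed.

Lemma near_floor (z : int) (y : R) : `|z%:~R - y| < 1 ->
  z = Num.floor y + `|(z - Num.floor y)%R|%N%:Z /\ (`|(z - Num.floor y)%R| < 2)%N.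
Proof.
have /andP[c d] := floor_itv y; rewrite ltr_norml => /andP[e g].
have h1 : ((Num.floor y - 1)%:~R : R) < z%:~R.
  by rewrite rmorphB rmorphD /= in d *; lra.
have h2 : (z%:~R : R) < (Num.floor y + 2)%:~R by rewrite rmorphD /=; lra.
by rewrite !ltr_int in h1 h2; clear -h1 h2; move: (Num.floor y) h1 h2 => k; lia.
Qed.

Lemma norm_lt_div (u : R) : `|u * a| < 1 -> `|u| < 1.
Proof.
rewrite normrM (gtr0_norm a0).
by apply: le_lt_trans; rewrite ler_peMr.
Qed.

Lemma code_in p : p \in off_diagonal (index_pairs n0 N) f ->
  code p \in [seq (k, d) | k <- K, d <- dvs `|Zc k|].
Proof.
case: p => q r; rewrite mem_filter /= => /andP[/andP[/eqP fE qr]].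
case/allpairsP => -[q' r'] /= [qs rs [? ?]]; subst q' r'.
move: qs rs; rewrite !mem_index_pairs => /andP[/andP[/andP[nq qq] q0] qN].
move=> /andP[/andP[/andP[nr rr] r0] rN].
have near := norm_lt_div (products_near qq rr fE).
pose z := (h q)%:Z * (m q)%:Z - (h r)%:Z * (m r)%:Z.
pose w := (h q)%:Z - (h r)%:Z.
have near' : `|(z%:~R : R) - (- (b / a * w%:~R))| < 1.
  by rewrite opprK /z /w !rmorphB !rmorphM.
have [zE e2] := near_floor near'; rewrite -/(Y w) in zE e2.
have hw : ((h q + N - h r)%N%:Z - N%:Z = w).
  by apply: shiftE; apply: leq_trans rN; exact: leq_subr.
have ZE : Zc (m r, h q + N - h r, `|(z - Y w)%R|)%N = (h q)%:Z * ((m q)%:Z - (m r)%:Z).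
  rewrite /Zc /= hw -zE /z /w; ring.
apply/allpairsPdep; exists (m r, h q + N - h r, `|(z - Y w)%R|)%N, (h q).
split => //.
  apply/allpairsP; exists (m r, h q + N - h r, `|(z - Y w)%R|)%N => /=; split => //.
    apply/allpairsP; exists (m r, h q + N - h r)%N => /=; split => //.
      by rewrite mem_iota /m; apply: sum_range rN (leq_trans (ltnW rr) rN).
    by rewrite mem_iota /h; apply: diff_range qN.
  exact: lt2_iota.
rewrite ZE abszM /dvs.
have hq : (0 < h q <= N)%N.
  by rewrite /h subn_gt0 qq (leq_trans (leq_subr _ _)).
have mq : (m q <= 2 * N)%N.
  by rewrite /m mul2n -addnn leq_add// (leq_trans (ltnW qq)).
have mr : (m r <= 2 * N)%N.
  by rewrite /m mul2n -addnn leq_add// (leq_trans (ltnW rr)).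
(* If [m = m'], the values differ by [(h - h') * (a * m + b)], whose second factor
   is at least one: then [h = h'] as well, and the pairs are equal. *)
have hd : m q != m r.
  apply: contra_neq qr => mE; apply: pair_of_hm => //; apply/eqP.
  have := products_near qq rr fE.
  rewrite mE [X in `|X|](_ : _ =
    ((h q)%:R - (h r)%:R) * (a * (m r)%:R + b)); last by field; rewrite gt_eqF.
  have sr := steep (leq_trans nr (leq_addl r.1 r.2)).
  rewrite normrM [X in _ * X]ger0_norm; last exact: le_trans sr.
  move=> lt1; have {}lt1 : `|(h q)%:R - (h r)%:R : R| < 1.
    by apply: le_lt_trans lt1; rewrite ler_peMr.
  move: lt1; rewrite -[(h q)%:R]/(((h q)%:Z)%:~R) -[(h r)%:R]/(((h r)%:Z)%:~R).
  by rewrite -rmorphB /= -intr_norm ltrz1; exact: norm_lt1.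
have : (0 < `|((m q)%:Z - (m r)%:Z)%R| <= 2 * N)%N.
  exact: dist_range.
move: hq; rewrite absz_nat => /andP[hq0 hqN] /andP[d0 dN].
rewrite muln_gt0 hq0 d0 /=.
have -> : (h q * `|((m q)%:Z - (m r)%:Z)%R| <= 2 * N ^ 2)%N.
  by rewrite -mulnn mulnCA leq_mul.
by rewrite -dvdn_divisors ?dvdn_mulr// muln_gt0 hq0.
Qed.

Let code_inj_arith (z z' y : int) : `|(z - y)%R|%N = `|(z' - y)%R|%N ->
  z = y + `|(z - y)%R|%N%:Z -> z' = y + `|(z' - y)%R|%N%:Z -> z = z'.
Proof. by move=> -> -> <-. Qed.

Lemma off_diagonal_near q r : (q, r) \in off_diagonal (index_pairs n0 N) f ->
  let w := (h q)%:Z - (h r)%:Z in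
  let z := (h q)%:Z * (m q)%:Z - (h r)%:Z * (m r)%:Z in
  [/\ (q.2 < q.1)%N, (r.2 < r.1)%N, (r.1 <= N)%N
    & z = Y w + `|(z - Y w)%R|%N%:Z].
Proof.
rewrite mem_filter /= => /andP[/andP[/eqP fE qr]].
case/allpairsP => -[q' r'] /= [qs rs [? ?]]; subst q' r'.
move: qs rs; rewrite !mem_index_pairs => /andP[/andP[/andP[nq qq] q0] qN].
move=> /andP[/andP[/andP[nr rr] r0] rN].
split => //.
have near := norm_lt_div (products_near qq rr fE).
set z := _ - _ * _; set w := (h q)%:Z - _.
have near' : `|(z%:~R : R) - (- (b / a * w%:~R))| < 1.
  by rewrite opprK /z /w !rmorphB !rmorphM.
by have [] := near_floor near'.
Qed.

Lemma code_inj : {in off_diagonal (index_pairs n0 N) f &, injective code}.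
Proof.
move=> [q r] [q' r'] /off_diagonal_near /= [qq rr rN zE].
move=> /off_diagonal_near /= [qq' rr' rN' zE'].
rewrite /code /= => -[mE wE eE hE].
have hrN : (h r <= N)%N by apply: leq_trans rN; exact: leq_subr.
have hrN' : (h r' <= N)%N by apply: leq_trans rN'; exact: leq_subr.
have hrE : h r = h r' by move: wE; rewrite hE; apply: shift_inj.
have rE : r = r' by exact: pair_of_hm.
rewrite rE hE in zE zE' eE *; congr (_, _).
apply: pair_of_hm => //.
have := code_inj_arith eE zE zE'.
move=> /(addIr _) /eqP; rewrite -!PoszM eqz_nat eqn_pmul2l; first by move/eqP.
by rewrite /h subn_gt0.
Qed.

Theorem quadratic_energy :
  (coin (index_pairs n0 N) f <= N ^ 2 + (2 * N + 1) * (2 * N + 1) * 2 * Dv)%N.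
Proof.
apply: leq_trans (coin_off_diagonal f (index_pairs_uniq n0 N)) _.
apply: leq_add; first exact: size_index_pairs.
rewrite -(size_map code).
apply: (@leq_trans (size [seq (k, d) | k <- K, d <- dvs `|Zc k|])).
  apply: uniq_leq_size.
    rewrite (map_inj_in_uniq code_inj); apply/filter_uniq/allpairs_uniq.
    - exact: index_pairs_uniq.
    - exact: index_pairs_uniq.
    - by move=> [? ?] [? ?] /= _ _ [-> ->].
  by move=> c /mapP[p ps ->]; exact: code_in.
rewrite size_allpairs_dep sumnE big_map.
apply: (@leq_trans (\sum_(k <- K) Dv)%N).
  by apply: leq_sum => k _; rewrite /dvs; case: ifP => // /DvP.
by rewrite big_const_seq count_predT iter_addn_0 !size_allpairs !size_iota mulnC.
Qed.

End QuadraticEnergy.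

(** * Growth of polynomials and of their differences *)

Section Growth.
Variable R : realType.
Implicit Types (p q : {poly R}).

Lemma archi_nat (x : R) : exists n : nat, x <= n%:R.
Proof.
by exists (Num.truncn x).+1; apply/ltW/truncnS_gt.
Qed.

Lemma poly_growth q k : size q = k.+1 -> 0 < lead_coef q ->
  exists c C : R, exists n0 : nat, [/\ 0 < c, 0 < C &
    forall n : nat, (n0 <= n)%N -> c * n%:R ^+ k <= q.[n%:R] <= C * n%:R ^+ k].
Proof.
move=> sq lq; pose A : R := \sum_(i < k) `|q`_i|.
have A0 : 0 <= A by apply: sumr_ge0.
have [n1 n1P] := archi_nat (2 * A / lead_coef q).
exists (lead_coef q / 2), (2 * lead_coef q), n1.+1; split; [lra|lra|move=> n n1n].
have n0 : (0 : R) < n%:R by rewrite ltr0n (leq_trans _ n1n).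
have An : A <= lead_coef q / 2 * n%:R.
  have : 2 * A / lead_coef q <= n%:R.
    by apply: le_trans n1P _; rewrite ler_nat ltnW.
  by rewrite ler_pdivrMr//; lra.
have err : `|q.[n%:R] - lead_coef q * n%:R ^+ k| <= lead_coef q / 2 * n%:R ^+ k.
  rewrite horner_coef sq big_ord_recr /= [lead_coef q]lead_coefE sq /= addrK.
  have -> : q`_k = lead_coef q by rewrite lead_coefE sq.
  apply: le_trans (ler_norm_sum _ _ _) _.
  rewrite -(ler_pM2r n0) mulr_suml.
  apply: (@le_trans _ _ (\sum_(i < k) `|q`_i| * n%:R ^+ k)).
    apply: ler_sum => i _; rewrite normrM normrX (gtr0_norm n0) -mulrA -exprSr.
    rewrite ler_wpM2l// -!natrX ler_nat leq_pexp2l//.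
    exact: leq_ltn_trans n1n.
  by rewrite -mulr_suml mulrAC ler_wpM2r// exprn_ge0// ltW.
have nk : 0 <= n%:R ^+ k :> R by rewrite exprn_ge0// ltW.
move: err; rewrite ler_norml => /andP[h1 h2]; apply/andP; split; lra.
Qed.

(** The polynomial [p (X + 1) - p X], written as a Taylor sum so that its degree
    and its leading coefficient can be read off the first term. *)
Definition forward_diff p : {poly R} := \sum_(i < (size p).-1) p^`N(i.+1).

Lemma horner_forward_diff p x : (forward_diff p).[x] = p.[x + 1] - p.[x].
Proof.
have [->|p0] := eqVneq p 0; first by rewrite /forward_diff size_poly0 big_ord0 !horner0 subrr.
rewrite /forward_diff horner_sum nderiv_taylor; last exact: commr1.
have -> : size p = (size p).-1.+1 by rewrite prednK// size_poly_gt0.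
rewrite big_ord_recl /= expr0 mulr1 nderivn0 addrAC subrr add0r.
by apply: eq_bigr => i _; rewrite expr1n mulr1.
Qed.

Lemma size_forward_diff p k : size p = k.+2 -> 0 < lead_coef p ->
  size (forward_diff p) = k.+1 /\ 0 < lead_coef (forward_diff p).
Proof.
move=> sp lp; rewrite /forward_diff sp /= big_ord_recl /= nderivn1.
set r := \sum_(i < k) _.
have dpk : p^`()`_k = p`_k.+1 *+ k.+1 by rewrite coef_deriv.
have lpE : lead_coef p = p`_k.+1 by rewrite lead_coefE sp.
have dp0 : 0 < p^`()`_k by rewrite dpk pmulrn_lgt0// -lpE.
have sd : size p^`() = k.+1.
  apply/eqP; rewrite eqn_leq; apply/andP; split.
    by rewrite -ltnS -sp lt_size_deriv// -size_poly_gt0 sp.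
  by rewrite ltnNge; apply/negP => /leq_sizeP/(_ k (leqnn _)) e; rewrite e ltxx in dp0.
have sr : (size r < size p^`())%N.
  rewrite sd ltnS; apply: leq_trans (size_sum _ _ _) _.
  apply/bigmax_leqP => i _; apply/leq_sizeP => j kj.
  rewrite coef_nderivn nth_default ?mul0rn// sp.
  by rewrite /bump /=; lia.
by rewrite size_polyDl// lead_coefDl// sd lead_coefE sd.
Qed.

End Growth.

(** * Energy of a polynomial sequence *)

Lemma coin_subset (B I : eqType) (s s' : seq I) (f : I -> B) :
  uniq s -> uniq s' -> {subset s <= s'} -> (coin s f <= coin s' f)%N.
Proof.
move=> us us' ss; have pe : perm_eq s [seq i <- s' | i \in s].
  apply: uniq_perm; rewrite ?filter_uniq// => i; rewrite mem_filter.
  by case si : (i \in s) => //=; rewrite ss.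
apply: leq_trans (coin_filter (mem s) s' f); rewrite /coin /cross.
rewrite (perm_big _ pe) /=; apply: leq_sum => i _.
by rewrite (perm_big _ pe).
Qed.

Lemma divisor_bound_power k : (0 < k)%N -> exists2 A, (0 < A)%N &
  forall l n, (0 < n <= l ^ k)%N -> (size (divisors n) <= A * l)%N.
Proof.
move=> k0; have [A AP] := divisor_bound k0; exists A.+1 => // l n /andP[n0 nl].
rewrite -(leq_exp2r _ _ k0) (leq_trans (AP _ n0))// expnMn leq_mul//.
by apply: (leq_trans (leqnSn A)); rewrite -[X in (X <= _)%N]expn1 leq_pexp2l.
Qed.

Lemma pow_ge1 (R : realType) (c : R) (n1 n j : nat) : 0 < c -> c^-1 <= n1%:R ->
  (0 < n)%N -> (n1 <= n)%N -> 1 <= c * n%:R ^+ j.+1.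
Proof.
move=> c0 h n0 n1n; rewrite -ler_pdivrMl// mulr1.
apply: le_trans h _; rewrite -natrX ler_nat; apply: leq_trans n1n _.
by rewrite -[X in (X <= _)%N]expn1 leq_pexp2l.
Qed.

Lemma energy_arith (N A l : nat) : (0 < N)%N -> (0 < A)%N -> (1 < l)%N ->
  (N ^ 2 + (2 * N + 1) * (2 * N + 1) * 2 * (A * l) <= 19 * (A * (l * N ^ 2)))%N.
Proof.
move=> N0 A0 l1; have Al : (0 < A * l)%N by rewrite muln_gt0 A0 ltnW.
rewrite (mulnA A); move: (A * l)%N Al => B B0.
rewrite -mulnn; have : (N * N <= B * (N * N))%N by rewrite leq_pmull.
have : ((2 * N + 1) * (2 * N + 1) <= (3 * N) * (3 * N))%N by apply: leq_mul; lia.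
nia.
Qed.

Lemma convex_arith (G l e : nat) : (2 < e)%N -> (0 < G)%N -> (0 < l)%N ->
  ((15 * G ^ 5) ^ e * G <= 15 ^ e * l ^ e * (G ^ 2) ^ (3 * e - 1))%N.
Proof.
move=> e2 G0 l0; rewrite (expnMn 15 (G ^ 5)%N e) -(mulnA (15 ^ e)%N) -(mulnA (15 ^ e)%N).
rewrite leq_mul2l; apply/orP; right.
rewrite -(expnM G 5 e) -(expnSr G) -(expnM G 2).
apply: (@leq_trans (G ^ (2 * (3 * e - 1)))%N).
  by rewrite leq_pexp2l//; lia.
by rewrite leq_pmull// expn_gt0 l0.
Qed.

Section Polynomial.
Variables (R : realType) (p : {poly R}) (k : nat).
Hypothesis sp : size p = k.+3.
Hypothesis lp : 0 < lead_coef p.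
Local Notation d := k.+2.
Let x (n : nat) : R := p.[n%:R].

Lemma step_growth : exists c : R, exists n0 : nat, 0 < c /\
  forall n : nat, (n0 <= n)%N -> c * n%:R ^+ k.+1 <= x n.+1 - x n /\ x n + 1 <= x n.+1.
Proof.
have [sd ld] := size_forward_diff sp lp.
have [c [C [n0 [c0 C0 h]]]] := poly_growth sd ld.
have [n1 n1P] := archi_nat c^-1.
exists c, (n0 + n1).+1; split => // n nn.
have /andP[h1 _] : c * n%:R ^+ k.+1 <= (forward_diff p).[n%:R] <= C * n%:R ^+ k.+1.
  by apply: h; apply: leq_trans nn; rewrite leqW// leq_addr.
rewrite horner_forward_diff natr1 in h1; split => //.
have n0' : (0 < n)%N by apply: leq_trans nn.
suff : 1 <= c * n%:R ^+ k.+1 by rewrite /x in h1 *; lra.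
apply: pow_ge1 n1P _ _ => //; apply: leq_trans nn.
by rewrite leqW// leq_addl.
Qed.

Lemma value_growth : exists C : R, exists n0 : nat, 0 < C /\
  forall n : nat, (n0 <= n)%N -> 0 <= x n <= C * n%:R ^+ d.
Proof.
have [c [C [n0 [c0 C0 h]]]] := poly_growth sp lp.
exists C, n0; split => // n nn; have /andP[h1 h2] := h _ nn.
by rewrite h2 andbT; apply: le_trans h1; rewrite mulr_ge0 ?(ltW c0)// exprn_ge0.
Qed.

Lemma second_step : (0 < k)%N -> exists n0 : nat, forall n : nat, (n0 <= n)%N ->
  x n.+1 - x n + 1 <= x n.+2 - x n.+1.
Proof.
move: sp; case: k => // k' sp' _.
have [sd ld] := size_forward_diff sp' lp; have [sd2 ld2] := size_forward_diff sd ld.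
have [c [C [n0 [c0 C0 h]]]] := poly_growth sd2 ld2.
have [n1 n1P] := archi_nat c^-1.
exists (n0 + n1).+1 => n nn.
have /andP[h1 _] : c * n%:R ^+ k'.+1 <= (forward_diff (forward_diff p)).[n%:R] <= C * n%:R ^+ k'.+1.
  by apply: h; apply: leq_trans nn; rewrite leqW// leq_addr.
rewrite !horner_forward_diff !natr1 in h1.
have n0' : (0 < n)%N by apply: leq_trans nn.
suff : 1 <= c * n%:R ^+ k'.+1 by rewrite /x in h1 *; lra.
apply: pow_ge1 n1P _ _ => //; apply: leq_trans nn.
by rewrite leqW// leq_addl.
Qed.

Let D (q : nat * nat) : R := x q.1 - x q.2.

Lemma energy_convex : (0 < k)%N -> exists n0, forall G : nat, (0 < G)%N ->
  (coin (index_pairs n0 (G ^ 2)) (fun q => Num.floor (D q)) <= 15 * G ^ 5)%N.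
Proof.
move=> k0; have [n1 n1P] := second_step k0; have [c [n2 [_ n2P]]] := step_growth.
exists (n1 + n2)%N => G G0.
have sp1 n : (n1 + n2 <= n)%N -> x n + 1 <= x n.+1.
  by move=> nn; apply: (n2P _ _).2; apply: leq_trans nn; rewrite leq_addl.
have sp2 n : (n1 + n2 <= n)%N -> x n.+1 - x n + 1 <= x n.+2 - x n.+1.
  by move=> nn; apply: n1P; apply: leq_trans nn; rewrite leq_addr.
(* Blocks of length [G], the square root of the number of points, balance the two
   terms of [convex_energy]. *)
apply: leq_trans (convex_energy (G ^ 2) sp1 sp2 G0) _.
have -> : (G ^ 2 %/ G = G)%N by rewrite expnS expn1 mulKn.
have h : (2 * G + 1 <= 3 * G)%N by lia.
apply: leq_trans (leq_mul h (leqnn _)) _.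
have -> : ((G ^ 2) ^ 2 = G ^ 4)%N by rewrite -expnM.
have -> : (G ^ 2 * G ^ 2 = G ^ 4)%N by rewrite -expnD.
by rewrite (expnS G 4); move: (G ^ 4)%N => G4; nia.
Qed.

(** Multiplying the sequence by a large integer [M] makes its leading coefficient
    at least one, at the cost of a factor [2 M + 1]: equal floors of [D q] put the
    floors of [M * D q] within [M] of each other. *)
Lemma energy_quadratic : k = 0%N -> exists n0, forall c', exists A, forall l,
  (1 < l)%N ->
  (coin (index_pairs n0 ((l ^ c') ^ 2)) (fun q => Num.floor (D q)) <=
   A * l * ((l ^ c') ^ 2) ^ 2)%N.
Proof.
move=> k0; have sp3 : size p = 3 by rewrite sp k0.
have p2 : 0 < p`_2 by move: lp; rewrite lead_coefE sp3.
have [M' M'P] := archi_nat (p`_2)^-1.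
pose M := M'.+1; pose a := M%:R * p`_2; pose b := M%:R * p`_1.
have a1 : 1 <= a.
  rewrite /a -ler_pdivrMr// mul1r; apply: le_trans M'P _.
  by rewrite ler_nat.
have [n0 n0P] := archi_nat (1 - b); exists n0 => c'.
have steep (m : nat) : (n0 <= m)%N -> 1 <= a * m%:R + b.
  rewrite -(ler_nat R) => n0m; have : m%:R <= a * m%:R by rewrite ler_peMl.
  lra.
have [A A0 AP] := divisor_bound_power (isT : 0 < (4 * c').+1)%N.
exists ((2 * M + 1) * (19 * A))%N => l l1.
pose N := ((l ^ c') ^ 2)%N; rewrite -/N.
have N0 : (0 < N)%N by rewrite !expn_gt0 (ltnW l1).
have Dv n : (0 < n <= 2 * N ^ 2)%N -> (size (divisors n) <= A * l)%N.
  move=> /andP[n1 nN]; apply: AP; rewrite n1 (leq_trans nN)//.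
  by rewrite /N -!expnM expnS leq_mul// leq_pexp2l ?(ltnW l1)//; lia.
pose f q := Num.floor (M%:R * D q).
apply: (@leq_trans ((2 * M + 1) * coin (index_pairs n0 N) f)%N).
  apply: coin_near => q r _ _ /floor_eq_near h; apply: floor_near.
  by rewrite -mulrBr normrM normr_nat -[leRHS]mulr1 ler_wpM2l// ltW.
rewrite -!mulnA leq_mul2l; apply/orP; right.
have := quadratic_energy a1 steep Dv.
have -> : coin (index_pairs n0 N) (fun q => Num.floor
    (a * q.1%:R ^+ 2 + b * q.1%:R - (a * q.2%:R ^+ 2 + b * q.2%:R))) =
    coin (index_pairs n0 N) f.
  rewrite /coin /cross; apply: eq_bigr => q _; apply: eq_bigr => r _.
  have fE u : Num.floor
    (a * u.1%:R ^+ 2 + b * u.1%:R - (a * u.2%:R ^+ 2 + b * u.2%:R)) = f u.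
    rewrite /f /D /x !horner_coef sp3 !big_ord_recl !big_ord0 /= /bump /=.
    by congr Num.floor; rewrite /a /b; ring.
  by rewrite !fE.
move=> h; apply: leq_trans h _.
exact: energy_arith.
Qed.

(** A common form for all degrees [d]: with [N = (l ^ c') ^ 2] points, the energy to
    the power [d] is smaller than [N ^ (3 d)] by the factor [N ^ (3 / 2)], up to
    powers of [l]. Convexity gives [N ^ (5 / 2)] per factor, enough for [d >= 3];
    for [d = 2] the energy is nearly [N ^ 2]. *)
Lemma energy_bound c' : exists n0 A, forall l, (1 < l)%N ->
  (coin (index_pairs n0 ((l ^ c') ^ 2)) (fun q => Num.floor (D q)) ^ d * l ^ c' <=
   A * l ^ d * ((l ^ c') ^ 2) ^ (3 * d - 1))%N.
Proof.
have [k0|] := posnP k.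
  have [n0 /(_ c') [A h]] := energy_quadratic k0; exists n0, (A ^ 2)%N => l l1.
  have G0 : (0 < l ^ c')%N by rewrite expn_gt0 (ltnW l1).
  have {h} := h _ l1; rewrite k0.
  move: (coin _ _) => E; move: (l ^ c')%N G0 => G G0 h.
  apply: (@leq_trans ((A * l * (G ^ 2) ^ 2) ^ 2 * G)%N).
    by rewrite leq_mul2r leq_exp2r// h orbT.
  rewrite (expnMn (A * l)%N) (expnMn A) -(mulnA (A ^ 2 * l ^ 2)%N).
  rewrite leq_mul2l -!expnM -expnSr leq_pexp2l//.
  by rewrite orbT.
move=> k0; have [n0 h] := energy_convex k0; exists n0, (15 ^ d)%N => l l1.
have G0 : (0 < l ^ c')%N by rewrite expn_gt0 (ltnW l1).
apply: (@leq_trans ((15 * (l ^ c') ^ 5) ^ d * l ^ c')%N).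
  by rewrite leq_mul2r leq_exp2r// h// orbT.
by apply: convex_arith G0 (ltnW l1); rewrite !ltnS.
Qed.

End Polynomial.

(** * Coincidences of integer multiples of the differences *)

Section Arith.
Local Open Scope nat_scope.

(** The count [c] for one class of multipliers satisfies
    [c ^ d.+1 <= N ^ (4 * d.+1) / G] up to powers of [l]. The exponent of [l] in [G]
    is the sum of all exponents that these powers contribute, including the factor
    [l ^ 2] that is to be gained for each of the [d.+1] copies of [c]. *)
Lemma class_arith (c d l G N E A B0 B1 A2 X0 X1 S T Dv : nat) :
  0 < l -> 0 < N -> 0 < d -> G = l ^ (2 * d ^ 2 + 8 * d + 5) ->
  2 * X0 + 1 <= B0 * l ^ (2 * d) -> 2 * X1 + 1 <= B1 * l ^ (3 * d + 1) ->
  E ^ d * G <= A * l ^ d * N ^ (3 * d - 1) ->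
  S <= N ^ 2 -> T <= l * N -> Dv <= A2 * l ->
  c ^ d.+1 <= 7 ^ d.+1 *
     (((2 * X0 + 1) * E) ^ d * (S ^ 2 * ((2 * X1 + 1) * (T ^ d.+1 * Dv ^ d.+1)))) ->
  c * l ^ 2 <= (7 ^ d.+1 * B0 ^ d * A * B1 * A2 ^ d.+1).+1 * N ^ 4.
Proof.
move=> l0 N0 d0 GE hX0 hX1 hE hS hT hD hc.
set K := 7 ^ d.+1 * B0 ^ d * A * B1 * A2 ^ d.+1.
have G0 : 0 < G by rewrite GE expn_gt0 l0.
rewrite -(leq_exp2r _ _ (ltn0Sn d)) -(leq_pmul2r G0).
apply: (@leq_trans (K * N ^ (4 * d.+1) * G)); last first.
  rewrite leq_mul2r expnMn -(expnM N); apply/orP; right; rewrite leq_mul2r.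
  apply/orP; right; apply: (leq_trans (leqnSn K)).
  by rewrite -[X in X <= _]expn1 leq_pexp2l.
apply: (@leq_trans (7 ^ d.+1 * ((B0 * l ^ (2 * d)) ^ d * (A * l ^ d * N ^ (3 * d - 1)) *
   ((N ^ 2) ^ 2 * ((B1 * l ^ (3 * d + 1)) * ((l * N) ^ d.+1 * (A2 * l) ^ d.+1)))) *
   (l ^ 2) ^ d.+1)).
  rewrite expnMn mulnAC leq_mul2r; apply/orP; right.
  apply: leq_trans (leq_mul hc (leqnn G)) _.
  rewrite -mulnA leq_mul2l; apply/orP; right.
  rewrite mulnAC expnMn -(mulnA (_ ^ d)); apply: leq_mul.
    by apply: leq_mul => //; rewrite leq_exp2r.
  apply: leq_mul; first by rewrite leq_exp2r.
  by apply: leq_mul => //; apply: leq_mul; rewrite leq_exp2r.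
rewrite (expnMn B0 (l ^ (2 * d))) (expnMn l N) (expnMn A2 l).
have -> : (N ^ 2) ^ 2 = N ^ 4 by rewrite -expnM.
rewrite -(expnM l (2 * d)) -(expnM l 2).
have -> : G = l ^ (2 * d * d) * l ^ d * l ^ (3 * d + 1) * l ^ d.+1 * l ^ d.+1 * l ^ (2 * d.+1).
  by rewrite GE -!expnD; congr (l ^ _); rewrite -mulnn; lia.
have -> : N ^ (4 * d.+1) = N ^ (3 * d - 1) * N ^ 4 * N ^ d.+1.
  by rewrite -!expnD; congr (N ^ _); lia.
apply: eq_leq; rewrite /K.
move: (7 ^ d.+1) (B0 ^ d) (A2 ^ d.+1) (l ^ (2 * d * d)) (l ^ d) => x1 x2 x3 x4 x5.
move: (l ^ (3 * d + 1)) (l ^ d.+1) (l ^ (2 * d.+1)) => x6 x7 x8.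
move: (N ^ (3 * d - 1)) (N ^ 4) (N ^ d.+1) => y1 y2 y3; clear.
lia.
Qed.
Lemma affine_le a b : 0 < b -> 2 * (a * b) + 1 <= (2 * a + 1) * b.
Proof. by rewrite mulnDl mulnA mul1n => b0; rewrite leq_add2l. Qed.

Lemma exponent_le i C d : i <= C -> 2 < C ->
  i.+1 * d.+1 <= 3 * d + 1 + i + (C - 2) * d.
Proof.
move=> iC C2; have : i * d <= C * d by rewrite leq_mul2r iC orbT.
rewrite mulnBl; have : 2 * d <= C * d by rewrite leq_mul2r ltnW ?orbT.
by rewrite mulSn mulnS; lia.
Qed.
Lemma leq_expS l j : 0 < l -> 0 < j -> l <= l ^ j.
Proof. by move=> l0 j0; rewrite -[X in X <= _]expn1 leq_pexp2l. Qed.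
End Arith.

(** With [N = l ^ C], the smaller index and the gap are at least [N / l ^ 2]. This
    bounds the differences of a polynomial of degree [d] below by a multiple of
    [(N / l ^ 2) ^ d], and excludes only a proportion of order [l ^ -2] of all pairs. *)
Definition good_pairs (C l : nat) : seq (nat * nat) :=
  [seq q <- index_pairs 1 (l ^ C) | (l ^ (C - 2) <= q.2)%N && (l ^ (C - 2) <= q.1 - q.2)%N].

Lemma mem_good_pairs C l q : q \in good_pairs C l ->
  [/\ (q.2 < q.1)%N, (q.1 <= l ^ C)%N, (l ^ (C - 2) <= q.2)%N & (l ^ (C - 2) <= q.1 - q.2)%N].
Proof.
rewrite mem_filter mem_index_pairs => /andP[/andP[a b] /andP[/andP[/andP[_ c] _] e]].
by split.
Qed.

Lemma good_pairs_uniq C l : uniq (good_pairs C l).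
Proof. exact/filter_uniq/index_pairs_uniq. Qed.

Lemma size_good_pairs C l : (size (good_pairs C l) <= (l ^ C) ^ 2)%N.
Proof.
by rewrite size_filter (leq_trans (count_size _ _))// size_index_pairs.
Qed.

Section Count.
Variables (R : realType) (p : {poly R}) (k : nat).
Hypothesis sp : size p = k.+3.
Hypothesis lp : 0 < lead_coef p.
Local Notation d := k.+2.
Let x (n : nat) : R := p.[n%:R].
Let D (q : nat * nat) : R := x q.1 - x q.2.

Lemma good_pairs_range : exists c0 : R, exists C1 : R, exists n0 : nat, [/\ 0 < c0, 0 < C1 &
  forall C l, (2 < C)%N -> (n0 <= l)%N -> {in good_pairs C l, forall q,
    c0 * (l ^ (C - 2))%:R ^+ d <= D q <= C1 * (l ^ C)%:R ^+ d}].
Proof.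
have [c0 [n1 [c0P n1P]]] := step_growth sp lp.
have [C1 [n2 [C1P n2P]]] := value_growth sp lp.
exists c0, C1, (n1 + n2).+1; split => // C l C2 nl [a b] /mem_good_pairs[/= ba aN hb hab].
have nb : ((n1 + n2).+1 <= b)%N.
  apply: leq_trans hb; apply: (leq_trans nl).
  rewrite -[X in (X <= _)%N]expn1 leq_pexp2l//; first exact: leq_trans nl.
  by rewrite subn_gt0.
have n1b : (n1 <= b)%N by clear -nb; lia.
have n2b : (n2 <= b)%N by clear -nb; lia.
rewrite /D /=; apply/andP; split; last first.
  have /andP[h _] := n2P _ n2b; have /andP[_ h'] := n2P _ (leq_trans n2b (ltnW ba)).
  apply: (@le_trans _ _ (x a)); first by rewrite /x; lra.
  apply: le_trans h' _; rewrite ler_wpM2l ?(ltW C1P)// -!natrX ler_nat.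
  by rewrite leq_exp2r.
have low h : h%:R * (c0 * b%:R ^+ k.+1) <= x (b + h)%N - x b.
  elim: h => [|h IH]; first by rewrite mul0r addn0 subrr.
  have := (n1P _ (leq_trans n1b (leq_addr h b))).1.
  rewrite -[h.+1%:R]natr1 mulrDl mul1r addnS.
  have : c0 * b%:R ^+ k.+1 <= c0 * (b + h)%N%:R ^+ k.+1.
    by rewrite ler_wpM2l ?(ltW c0P)// -!natrX ler_nat leq_exp2r// leq_addr.
  by move: IH; rewrite /x; lra.
have := low (a - b)%N; rewrite subnKC 1?ltnW// => h; apply: le_trans h.
rewrite [leRHS]mulrCA ler_wpM2l ?(ltW c0P)// exprS -!natrX -!natrM ler_nat.
by rewrite leq_mul// leq_exp2r.
Qed.

(** The exponent from [class_arith]; the number of points [l ^ C] is a square. *)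
Let e := (2 * d ^ 2 + 8 * d + 5)%N.
Let C := (e * 2)%N.

Let C_e l : (l ^ C = (l ^ e) ^ 2)%N. Proof. by rewrite expnM. Qed.

Let block (l i : nat) : seq nat := iota (l ^ i) (l ^ i.+1 - l ^ i).

Let mem_block l i j : (0 < l)%N -> (j \in block l i) = (l ^ i <= j < l ^ i.+1)%N.
Proof. by move=> l0; rewrite mem_iota subnKC// leq_pexp2l. Qed.

(** The multipliers [j] go up to [l ^ C.+1], slightly more than the number [N] of
    points, and the differences are of order [N ^ d]. So products of [d.+1]
    multipliers from the class of [j] are at most of order [j * N ^ d] up to powers
    of [l]. This is the scale [T] of [coin_products_class], and [m = d] is the right number of steps. *)
Lemma class_count : exists A l0 : nat, forall l i : nat, (l0 <= l)%N -> (i <= C)%N ->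
  (coin [seq (q, j) | q <- good_pairs C l, j <- block l i]
     (fun w => Num.floor (w.2%:R * D w.1)) * l ^ 2 <= A * (l ^ C) ^ 4)%N.
Proof.
have [c0 [C1 [n0 [c0P C1P range]]]] := good_pairs_range.
have [n1 [AE EP]] := energy_bound sp lp e.
have [A0 A0P] := archi_nat (C1 / c0).
have [A1 A1P] := archi_nat (d.+1%:R / c0).
have [A2 A20 A2P] := divisor_bound_power (isT : (0 < C.+1 * d.+1)%N).
exists (7 ^ d.+1 * (2 * A0 + 1) ^ d * AE * (2 * A1 + 1) * A2 ^ d.+1).+1, (n0 + n1).+2.
move=> l i ll iC.
have l1 : (1 < l)%N by apply: leq_trans ll.
have l0 : (0 < l)%N by apply: ltnW.
have n0l : (n0 <= l)%N by apply: leq_trans ll; rewrite !leqW// leq_addr.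
have n1l : (n1 <= l)%N by apply: leq_trans ll; rewrite !leqW// leq_addl.
have C2 : (2 < C)%N by rewrite /C /e; clear; lia.
have C20 : (0 < C - 2)%N by rewrite subn_gt0.
have rg := range C l C2 n0l.
pose N := (l ^ C)%N; pose D0 : R := c0 * (l ^ (C - 2))%:R ^+ d.
have NE : (N = l ^ (C - 2) * l ^ 2)%N by rewrite -expnD subnK// ltnW.
have D00 : 0 < D0 by rewrite mulr_gt0// exprn_gt0// ltr0n expn_gt0 l0.
have T0 : 0 < (l ^ i)%:R * D0 by apply: mulr_gt0 => //; rewrite ltr0n expn_gt0 l0.
apply: (class_arith (d := d) (G := (l ^ e)%N) (B0 := (2 * A0 + 1)%N)
  (B1 := (2 * A1 + 1)%N) (X0 := (A0 * l ^ (2 * d))%N) (X1 := (A1 * l ^ (3 * d + 1))%N)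
  (E := coin (good_pairs C l) (fun q => Num.floor (D q))) (S := size (good_pairs C l))
  (T := size (block l i)) (Dv := (A2 * l)%N)) => //.
- by rewrite expn_gt0 l0.
- by apply: affine_le; rewrite expn_gt0 l0.
- by apply: affine_le; rewrite expn_gt0 l0.
- have := EP l l1; rewrite -C_e; apply: leq_trans.
  rewrite leq_mul2r leq_exp2r//; apply/orP; right.
  apply: coin_subset; [exact: good_pairs_uniq|exact: index_pairs_uniq|move=> q qg].
  have [ba aN hb _] := mem_good_pairs qg; rewrite mem_index_pairs ba aN.
  have lq : (l <= q.2)%N.
    by apply: leq_trans hb; exact: leq_expS.
  by rewrite (leq_trans n1l lq) (leq_trans l0 lq).
- exact: size_good_pairs.
- rewrite size_iota; apply: leq_trans (leq_subr _ _) _.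
  by rewrite expnS leq_mul2l leq_pexp2l// orbT.
apply: (@coin_products_class R _ (good_pairs C l) D (block l i) D0 (C1 * N%:R ^+ d)
  (l ^ i)%N (l ^ i.+1)%N) => //.
- by move=> q /rg /andP[].
- by move=> q /rg /andP[].
- by rewrite expn_gt0 l0.
- by move=> j; rewrite mem_block// => /andP[].
- by move=> j; rewrite mem_block// => /andP[_ /ltnW].
- exact: iota_uniq.
- rewrite (ler_pdivrMr _ _ T0).
  rewrite NE natrM exprMn -(natrX _ (l ^ 2)%N d) -(expnM l 2) (natrM _ A0) /D0.
  set L := (l ^ (2 * d))%:R; set L' := ((l ^ (C - 2))%:R ^+ d).
  have L0 : 0 <= L by exact: ler0n.
  have L'0 : 0 <= L' by rewrite exprn_ge0.
  have li : 1 <= (l ^ i)%:R :> R by rewrite ler1n expn_gt0 l0.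
  move: A0P; rewrite ler_pdivrMr// => h.
  have h1 : C1 * (L' * L) <= A0%:R * c0 * (L' * L) by rewrite ler_wpM2r// mulr_ge0.
  apply: le_trans h1 _.
  have -> : A0%:R * L * ((l ^ i)%:R * (c0 * L')) =
    (l ^ i)%:R * (A0%:R * c0 * (L' * L)) by ring.
  apply: ler_peMl => //; exact: mulr_ge0 (mulr_ge0 (ler0n _ _) (ltW c0P)) (mulr_ge0 L'0 L0).
- rewrite (ler_pdivrMr _ _ T0).
  rewrite /D0 natrM -!natrX; move: A1P; rewrite ler_pdivrMr// => h.
  have -> : A1%:R * (l ^ (3 * d + 1))%:R * ((l ^ i)%:R * (c0 * ((l ^ (C - 2)) ^ d)%:R)) =
    (l ^ (3 * d + 1 + i + (C - 2) * d))%:R * (A1%:R * c0) :> R.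
    rewrite -(expnM l (C - 2)) !expnD !natrM; ring.
  apply: ler_pM; rewrite ?ler0n//.
  by rewrite ler_nat -(expnM l) leq_pexp2l// exponent_le.
- move=> n /andP[n00 nl]; apply: A2P; rewrite n00 (leq_trans nl)// -expnM.
  by rewrite leq_pexp2l// leq_mul2r ltnS iC orbT.
Qed.

(** Only [C.+1] classes [l ^ i <= j < l ^ i.+1] are needed, and by [coin_classes]
    mixing them costs a constant factor. *)
Lemma count_bound : exists C' A l0 : nat, (2 < C')%N /\ forall l : nat, (l0 <= l)%N ->
  (coin [seq (q, j) | q <- good_pairs C' l, j <- iota 1 (l ^ C'.+1 - 1)]
     (fun w => Num.floor (w.2%:R * D w.1)) * l ^ 2 <= A * (l ^ C') ^ 4)%N.
Proof.
have [A [l0 AP]] := class_count; exists C, (C.+1 * (C.+1 * A))%N, (l0 + 2)%N.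
split; first by rewrite /C /e; clear; lia.
move=> l ll; have l1 : (1 < l)%N by apply: leq_trans ll; rewrite leq_addl.
have ll0 : (l0 <= l)%N by apply: leq_trans ll; rewrite leq_addr.
have l00 : (0 < l)%N by apply: ltnW.
pose c (w : (nat * nat) * nat) := minn (trunc_log l w.2) C.
have cC w : (c w < C.+1)%N by rewrite ltnS geq_minr.
set s := [seq _ | q <- _, j <- _]; set f := fun w => _.
have us : uniq s.
  by apply: allpairs_uniq; [exact: good_pairs_uniq|exact: iota_uniq|move=> [? ?] [? ?] /= _ _ [-> ->]].
apply: leq_trans (leq_mul (coin_classes s f cC) (leqnn _)) _.
rewrite -!mulnA leq_mul2l /=.
apply: (@leq_trans (\sum_(i < C.+1) A * (l ^ C) ^ 4)%N); last first.
  by rewrite sum_nat_const card_ord.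
rewrite big_distrl /=; apply: leq_sum => i _.
have iC : (i <= C)%N by rewrite -ltnS.
apply: leq_trans (AP l i ll0 iC); rewrite leq_mul2r; apply/orP; right.
apply: coin_subset; first exact: filter_uniq.
  by apply: allpairs_uniq; [exact: good_pairs_uniq|exact: iota_uniq|move=> [? ?] [? ?] /= _ _ [-> ->]].
move=> w; rewrite mem_filter => /andP[/eqP cw].
case/allpairsP => -[q j] /= [qg jI wE]; rewrite wE in cw *.
apply/allpairsP; exists (q, j); split => //=; rewrite mem_block//.
move: jI; rewrite mem_iota => /andP[j1 jl].
have {}jl : (j < l ^ C.+1)%N by move: jl; rewrite subnKC// expn_gt0 l00.
have /andP[t1 t2] := trunc_log_bounds l1 j1.
have tC : (trunc_log l j <= C)%N.
  by rewrite -ltnS -(ltn_exp2l _ _ l1) (leq_ltn_trans t1).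
by move: cw; rewrite /c /= (minn_idPl tC) => <-; rewrite t1.
Qed.

(** From some index on the steps are at least one, so the values eventually exceed
    all earlier ones by at least one. *)
Lemma far_apart : exists M0 : nat, forall a b : nat, (b < a)%N -> (M0 <= a)%N ->
  1 <= x a - x b.
Proof.
have [c0 [n1 [c0P n1P]]] := step_growth sp lp.
have sp1 n : (n1 <= n)%N -> x n + 1 <= x n.+1 by move=> h; apply: (n1P _ h).2.
pose S : R := \sum_(i < n1) `|x i|.
have [n2 n2P] := archi_nat (S + 1 - x n1).
exists (n1 + n2)%N => a b ba na; have [bn|bn] := leqP n1 b.
  by have := spaced_lt sp1 bn ba; lra.
have na1 : (n1 <= a)%N by apply: leq_trans na; rewrite leq_addr.
have := spaced_le (a - n1) sp1 (leqnn n1); rewrite subnKC//.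
have : n2%:R <= (a - n1)%N%:R :> R by rewrite ler_nat leq_subRL.
have : x b <= S.
  apply: le_trans (ler_norm _) _; rewrite /S (bigD1 (Ordinal bn)) //= lerDl.
  exact: sumr_ge0.
by move: (x a) (x b) (x n1) n2P => u v w *; lra.
Qed.

End Count.

(** A bad pair has a smaller index or a gap among [l ^ (C - 2)] numbers. *)
Lemma bad_pairs_count C l :
  (size [seq q <- index_pairs 1 (l ^ C) | q \notin good_pairs C l] <= 2 * (l ^ C * l ^ (C - 2)))%N.
Proof.
set N := (l ^ C)%N; set H := (l ^ (C - 2))%N.
pose s1 := [seq (a, b) | a <- iota 1 N, b <- iota 0 H].
pose s2 := [seq (b + h, b)%N | b <- iota 1 N, h <- iota 0 H].
apply: (@leq_trans (size (s1 ++ s2))); last first.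
  by rewrite size_cat !size_allpairs !size_iota mul2n addnn.
apply: uniq_leq_size; first exact/filter_uniq/index_pairs_uniq.
case=> a b; rewrite mem_filter mem_cat mem_index_pairs /= {1}/good_pairs mem_filter mem_index_pairs /=.
case/andP => ng /andP[/andP[/andP[_ ba] b0] aN].
move: ng; rewrite ba b0 aN /= !andbT negb_and -!ltnNge => /orP[h|h].
  apply/orP; left; apply/allpairsP; exists (a, b) => /=; rewrite !mem_iota h.
  by split => //; rewrite (leq_trans b0 (ltnW ba)) add1n ltnS.
apply/orP; right; apply/allpairsP; exists (b, a - b)%N => /=; rewrite !mem_iota h.
by split => //; rewrite ?b0 ?subnKC ?(ltnW ba)// add1n ltnS (leq_trans (ltnW ba)).
Qed.

Local Open Scope classical_set_scope.
Local Open Scope ring_scope.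

(** * Derivatives and elementary bounds for the sine *)

Section Derivatives.
Variable R : realType.
Implicit Types (x y c : R).

Lemma is_derive_sum_seq (I : eqType) (s : seq I) (f : I -> R -> R) (df : I -> R) x :
  (forall i, i \in s -> is_derive x 1 (f i) (df i)) ->
  is_derive x 1 (fun y => \sum_(i <- s) f i y) (\sum_(i <- s) df i).
Proof.
elim: s => [|i s IH] h.
  rewrite big_nil; have -> : (fun y => \sum_(i <- [::]) f i y) = cst 0.
    by apply/funext => y; rewrite big_nil.
  exact: is_derive_cst.
rewrite big_cons; have -> : (fun y => \sum_(j <- i :: s) f j y) =
    (f i \+ (fun y => \sum_(j <- s) f j y)).
  by apply/funext => y; rewrite big_cons.
apply: is_deriveD; first by apply: h; rewrite mem_head.
by apply: IH => j js; apply: h; rewrite inE js orbT.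
Qed.

Lemma is_derive_scale c x : is_derive x 1 (fun y : R => c * y) c.
Proof.
have -> : (fun y : R => c * y) = c \*: id by apply/funext.
by apply: is_derive_eq; rewrite /GRing.scale /= mulr1.
Qed.

Lemma is_derive_sinM c x : is_derive x 1 (fun y => sin (c * y)) (c * cos (c * x)).
Proof.
have h := is_derive_scale c x.
have := @is_derive1_comp R (@sin R) (fun y => c * y) x _ _ (is_derive_sin (c * x)) h.
by move=> /is_derive_eq; apply; rewrite mulrC.
Qed.

Lemma is_derive_cosM c x : is_derive x 1 (fun y => cos (c * y)) (- (c * sin (c * x))).
Proof.
have h := is_derive_scale c x.
have := @is_derive1_comp R (@cos R) (fun y => c * y) x _ _ (is_derive_cos (c * x)) h.
by move=> /is_derive_eq; apply; rewrite mulNr mulrC.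
Qed.

Lemma is_derive_continuous (f : R -> R) df : (forall x, is_derive x 1 f (df x)) -> continuous f.
Proof.
move=> h x; apply: differentiable_continuous; apply/derivable1_diffP.
by case: (h x).
Qed.

Lemma continuous_sum (I : Type) (s : seq I) (f : I -> R -> R) :
  (forall i, continuous (f i)) -> continuous (fun x => \sum_(i <- s) f i x).
Proof.
move=> cf; elim: s => [|i s IH].
  by under [X in continuous X]funext do rewrite big_nil; exact: cst_continuous.
under [X in continuous X]funext do rewrite big_cons.
by move=> x; apply: continuousD; [exact: cf|exact: IH].
Qed.

Lemma mean_value (f df : R -> R) a b : (forall x, is_derive x 1 f (df x)) -> a < b ->
  exists2 c, a < c < b & f b - f a = df c * (b - a).
Proof.
move=> h ab.
have h1 x : x \in `]a, b[ -> is_derive x 1 f (df x) by move=> _; exact: h.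
have h2 : {within `[a, b], continuous f}%classic.
  exact/continuous_subspaceT/is_derive_continuous.
by have [c] := MVT ab h1 h2; rewrite in_itv /= => cab e; exists c.
Qed.

Lemma derive_ge0_mono (f df : R -> R) : (forall x, is_derive x 1 f (df x)) ->
  (forall x, 0 <= df x) -> {homo f : x y / x <= y}.
Proof.
move=> h h0 x y; rewrite le_eqVlt => /orP[/eqP->//|xy].
have [c _ e] := mean_value h xy.
by rewrite -subr_ge0 e mulr_ge0// subr_ge0 ltW.
Qed.

Lemma sin_le_id x : 0 <= x -> sin x <= x.
Proof.
rewrite le_eqVlt => /orP[/eqP<-|x0]; first by rewrite sin0.
have [c _] := mean_value (@is_derive_sin R) x0.
by rewrite sin0 !subr0 => ->; rewrite -[leRHS]mul1r ler_wpM2r ?(ltW x0)// cos_le1.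
Qed.

Lemma sin_ge_half x : 0 <= x <= 1 -> x / 2 <= sin x.
Proof.
move=> /andP[]; rewrite le_eqVlt => /orP[/eqP<-|x0] x1; first by rewrite sin0 mul0r.
have [c /andP[c0 cx]] := mean_value (@is_derive_sin R) x0.
rewrite sin0 !subr0 => ->; rewrite mulrC ler_wpM2r ?(ltW x0)//.
have -> : c = (c / 2) *+ 2 by rewrite mulr2n; lra.
rewrite cos_mulr2n cos2sin2.
have s0 : 0 <= sin (c / 2).
  by apply: sin_ge0_pi; have := pi_ge2 R; lra.
have s1 : sin (c / 2) <= c / 2 by apply: sin_le_id; lra.
have : sin (c / 2) * sin (c / 2) <= (1 / 2) * (1 / 2) by rewrite ler_pM//; lra.
by rewrite expr2; move: (_ * sin _) => t; lra.
Qed.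

Lemma sin_ge_quarter x : 0 <= x <= pi / 2 -> x / 4 <= sin x.
Proof.
move=> /andP[x0 xp]; have [x1|x1] := lerP x 1.
  by have := @sin_ge_half x; rewrite x0 x1 => /(_ isT); lra.
have p1 := pihalf_ge1 R; have p2 := pihalf_lt2 R.
have : sin 1 < sin x.
  by rewrite ltr_sin// in_itv /=; apply/andP; split; lra.
have := @sin_ge_half 1; rewrite ler01 lexx => /(_ isT); lra.
Qed.

End Derivatives.

(** * The Fejer kernel and its antiderivative *)

Section Fejer.
Variable R : realType.
Implicit Types (x y u r : R).

Lemma sum_iota_last (K : nat) (F : nat -> R) : (0 < K)%N ->
  \sum_(j <- iota 1 K) F j = \sum_(j <- iota 1 (K - 1)) F j + F K.
Proof.
case: K => // K _; rewrite subSS subn0.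
by have := iotaD 1 K 1; rewrite addn1 add1n => ->; rewrite big_cat /= big_seq1.
Qed.

(** [K] times the Fejer kernel at [x], in the variable [u = pi * x]. *)
Definition fejer_sum (K : nat) u : R :=
  K%:R + \sum_(j <- iota 1 (K - 1)) (K%:R - j%:R) * (2 * cos (j%:R * (2 * u))).

Lemma dirichlet_sin K u :
  (1 + \sum_(j <- iota 1 K) 2 * cos (j%:R * (2 * u))) * sin u =
  sin ((2 * K%:R + 1) * u).
Proof.
elim: K => [|K IH]; first by rewrite big_nil addr0 mul1r mulr0 add0r mul1r.
rewrite (sum_iota_last _ (ltn0Sn K)) subSS subn0 addrA mulrDl IH.
have -> : (2 * K%:R + 1) * u = K.+1%:R * (2 * u) - u by rewrite -natr1; ring.
have -> : (2 * K.+1%:R + 1) * u = K.+1%:R * (2 * u) + u by ring.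
by rewrite sinB sinD; ring.
Qed.

Lemma fejer_sumS K u : (0 < K)%N -> fejer_sum K.+1 u =
  fejer_sum K u + (1 + \sum_(j <- iota 1 K) 2 * cos (j%:R * (2 * u))).
Proof.
move=> K0; rewrite /fejer_sum subSS subn0.
have -> : \sum_(j <- iota 1 K) (K.+1%:R - j%:R) * (2 * cos (j%:R * (2 * u))) =
  \sum_(j <- iota 1 K) (K%:R - j%:R) * (2 * cos (j%:R * (2 * u))) +
  \sum_(j <- iota 1 K) 2 * cos (j%:R * (2 * u)).
  by rewrite -big_split /=; apply: eq_bigr => j _; rewrite -natr1; ring.
rewrite [X in _ + (X + _)](sum_iota_last _ K0) subrr mul0r addr0 -natr1.
ring.
Qed.

Lemma fejer_sum_sin K u : (0 < K)%N ->
  fejer_sum K u * sin u ^+ 2 = sin (K%:R * u) ^+ 2.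
Proof.
case: K => // K _; elim: K => [|K IH].
  by rewrite /fejer_sum subnn big_nil addr0 !mul1r.
rewrite fejer_sumS// mulrDl IH expr2 mulrA dirichlet_sin.
have -> : (2 * K.+1%:R + 1) * u = K.+1%:R * u + K.+2%:R * u.
  by rewrite -[K.+2%:R]natr1; ring.
have e : u = K.+2%:R * u - K.+1%:R * u by rewrite -[K.+2%:R]natr1; ring.
have -> : sin u = sin (K.+2%:R * u - K.+1%:R * u) by rewrite -e.
rewrite sinD sinB.
have h1 := cos2sin2 (K.+1%:R * u); have h2 := cos2sin2 (K.+2%:R * u).
set a := sin (K.+1%:R * u); set b := cos (K.+1%:R * u).
set c := sin (K.+2%:R * u); set d := cos (K.+2%:R * u).
have -> : a ^+ 2 + (a * d + b * c) * (c * b - d * a) =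
  a ^+ 2 + (c ^+ 2 * b ^+ 2 - a ^+ 2 * d ^+ 2) by ring.
by rewrite h1 h2 -/a -/c; ring.
Qed.

Lemma fejer_sum_ge0 K u : (0 < K)%N -> 0 <= fejer_sum K u.
Proof.
move=> K0; have [s0|s0] := eqVneq (sin u) 0; last first.
  rewrite -(pmulr_lge0 _ (x := sin u ^+ 2)); first by rewrite fejer_sum_sin// sqr_ge0.
  by rewrite exprn_even_gt0.
(* Where the closed form degenerates, all cosines are equal to one. *)
have sj j : sin (j%:R * u) = 0.
  elim: j => [|j IH]; first by rewrite mul0r sin0.
  by rewrite -natr1 mulrDl mul1r sinD IH s0 mul0r mulr0 addr0.
rewrite /fejer_sum addr_ge0// big_seq sumr_ge0// => j.
rewrite mem_iota => /andP[j1 jK].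
have -> : cos (j%:R * (2 * u)) = 1.
  have -> : j%:R * (2 * u) = (j%:R * u) *+ 2 by rewrite mulr2n; ring.
  by rewrite cos_mulr2n cos2sin2 sj expr0n /= subr0 mulr2n addrK.
have : j%:R <= K%:R :> R by rewrite ler_nat; lia.
by move=> h; rewrite mulr_ge0 ?subr_ge0.
Qed.

Definition fejer (K : nat) x : R :=
  1 + \sum_(j <- iota 1 (K - 1)) (1 - j%:R / K%:R) * (2 * cos (2 * pi * j%:R * x)).

(** An odd increasing antiderivative of the Fejer kernel which grows by one over
    each period. For large [K] it is a smoothed step function, close to [1 / 2] on
    the open unit interval. *)
Definition fejer_prim (K : nat) x : R :=
  x + \sum_(j <- iota 1 (K - 1))
        (1 - j%:R / K%:R) * (sin (2 * pi * j%:R * x) / (pi * j%:R)).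

Lemma fejerE K x : (0 < K)%N -> fejer K x = fejer_sum K (pi * x) / K%:R.
Proof.
move=> K0; have K0' : K%:R != 0 :> R by rewrite pnatr_eq0 -lt0n.
rewrite /fejer /fejer_sum [RHS]mulrDl mulfV//; congr (_ + _).
rewrite mulr_suml; apply: eq_bigr => j _.
have -> : 2 * pi * j%:R * x = j%:R * (2 * (pi * x)) by ring.
by field.
Qed.

Lemma fejer_ge0 K x : (0 < K)%N -> 0 <= fejer K x.
Proof. by move=> K0; rewrite fejerE// divr_ge0// fejer_sum_ge0. Qed.

Lemma fejer_le K x : (0 < K)%N -> 0 < x <= 1 / 2 -> fejer K x <= 4 / (K%:R * x ^+ 2).
Proof.
move=> K0 /andP[x0 x1]; have KR : 0 < K%:R :> R by rewrite ltr0n.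
have p2 := pi_ge2 R.
have h : x / 2 <= sin (pi * x).
  have := @sin_ge_quarter R (pi * x).
  have -> : 0 <= pi * x <= pi / 2 by apply/andP; split; nra.
  by move=> /(_ isT); nra.
have h2 : (x / 2) ^+ 2 <= sin (pi * x) ^+ 2 by rewrite ler_sqr ?nnegrE//; lra.
rewrite fejerE// ler_pdivlMr ?mulr_gt0 ?exprn_gt0//.
have e : fejer_sum K (pi * x) / K%:R * (K%:R * x ^+ 2) =
  4 * (fejer_sum K (pi * x) * (x / 2) ^+ 2) by field; rewrite gt_eqF.
rewrite e -[leRHS]mulr1 ler_pM2l//.
apply: le_trans (_ : fejer_sum K (pi * x) * sin (pi * x) ^+ 2 <= _).
  by rewrite ler_wpM2l// fejer_sum_ge0.
by rewrite fejer_sum_sin// sin2cos2 gerBl sqr_ge0.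
Qed.

Lemma cos_2pi_natD (j : nat) x : cos (2 * pi * j%:R * (x + 1)) = cos (2 * pi * j%:R * x).
Proof.
have -> : 2 * pi * j%:R * (x + 1) = 2 * pi * j%:R * x + (pi *+ 2) *+ j.
  by rewrite -[in RHS]mulr_natr -(mulr_natr pi); ring.
exact: (periodicn (@cosD2pi R)).
Qed.

Lemma sin_2pi_natD (j : nat) x : sin (2 * pi * j%:R * (x + 1)) = sin (2 * pi * j%:R * x).
Proof.
have -> : 2 * pi * j%:R * (x + 1) = 2 * pi * j%:R * x + (pi *+ 2) *+ j.
  by rewrite -[in RHS]mulr_natr -(mulr_natr pi); ring.
exact: (periodicn (@sinD2pi R)).
Qed.

Lemma fejerD1 K x : fejer K (x + 1) = fejer K x.
Proof. by rewrite /fejer; under eq_bigr do rewrite cos_2pi_natD. Qed.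

Lemma fejerN K x : fejer K (- x) = fejer K x.
Proof. by rewrite /fejer; under eq_bigr do rewrite mulrN cosN. Qed.

Lemma fejer_primD1 K x : fejer_prim K (x + 1) = fejer_prim K x + 1.
Proof.
by rewrite /fejer_prim; under eq_bigr do rewrite sin_2pi_natD; rewrite addrAC.
Qed.

Lemma fejer_primN K x : fejer_prim K (- x) = - fejer_prim K x.
Proof.
rewrite /fejer_prim opprD -sumrN; congr (_ + _); apply: eq_bigr => j _.
by rewrite mulrN sinN mulNr mulrN.
Qed.

Lemma is_derive_fejer_prim K x : is_derive x 1 (fejer_prim K) (fejer K x).
Proof.
apply: (@is_deriveD _ _ _ id _ x 1 1 _); apply: is_derive_sum_seq => j.
rewrite mem_iota => /andP[j1 _].
have j0 : j%:R != 0 :> R by rewrite pnatr_eq0 -lt0n.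
have p0 : pi != 0 :> R by rewrite gt_eqF// pi_gt0.
have -> : (fun y => (1 - j%:R / K%:R) * (sin (2 * pi * j%:R * y) / (pi * j%:R))) =
   ((1 - j%:R / K%:R) / (pi * j%:R)) \*: (fun y : R => sin (2 * pi * j%:R * y)).
  by apply/funext => y /=; rewrite /GRing.scale /=; ring.
have := is_deriveZ ((1 - j%:R / K%:R) / (pi * j%:R)) (is_derive_sinM (2 * pi * j%:R) x).
move=> /is_derive_eq; apply; rewrite /GRing.scale /=.
move: (1 - _) (cos _) => k c; move: pi p0 => P p0.
by field; rewrite j0 p0.
Qed.

Lemma fejer_prim_mono K : (0 < K)%N -> {homo fejer_prim K : x y / x <= y}.
Proof.
by move=> K0; apply: derive_ge0_mono (is_derive_fejer_prim K) (fun x => fejer_ge0 x K0).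
Qed.

Lemma fejer_prim_half K : fejer_prim K (1 / 2) = 1 / 2.
Proof.
have := fejer_primD1 K (- (1 / 2)); rewrite fejer_primN.
have -> : - (1 / 2) + 1 = 1 / 2 :> R by lra.
by move=> h; lra.
Qed.

(** On [[x, 1 / 2]] the kernel is at most [4 / (K * y ^ 2)], so the antiderivative
    grows by less than [4 / (K * x)] on its way to the value [1 / 2]. *)
Lemma fejer_prim_ge K x : (0 < K)%N -> 0 < x <= 1 / 2 -> 1 / 2 - 4 / (K%:R * x) <= fejer_prim K x.
Proof.
move=> K0 /andP[x0]; have KR : 0 < K%:R :> R by rewrite ltr0n.
rewrite le_eqVlt => /orP[/eqP->|x1].
  by rewrite fejer_prim_half gerBl divr_ge0// mulr_ge0// ltW.
pose h (y : R) := fejer_prim K y + 4 / K%:R * y^-1.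
pose dh (y : R) := fejer K y - 4 / K%:R * y ^- 2.
have dhP y : 0 < y -> is_derive y 1 h (dh y).
  move=> y0; have hv : is_derive y 1 (fun z : R => z^-1) (- y ^- 2).
    have y0' : id y != 0 by rewrite gt_eqF.
    have did : derivable (@id R) y 1 by exact: derivable_id.
    apply: DeriveDef; first exact: (derivableV (f := id)).
    by rewrite (deriveV (f := id))// derive_id /GRing.scale /= mulr1.
  have := is_deriveD (is_derive_fejer_prim K y) (is_deriveZ (4 / K%:R) hv).
  by move=> /is_derive_eq; apply; rewrite /dh /GRing.scale /= mulrN.
have h1 y : y \in `]x, (1 / 2)[ -> is_derive y 1 h (dh y).
  by rewrite in_itv /= => /andP[xy _]; apply: dhP; lra.
have h2 : {within `[x, (1 / 2)], continuous h}%classic.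
  apply: derivable_within_continuous => y; rewrite in_itv /= => /andP[xy _].
  by case: (@dhP y _); first lra.
have [c] := MVT x1 h1 h2; rewrite in_itv /= => /andP[xc c1] e.
have c0 : 0 < c by lra.
have dc : dh c <= 0.
  have := @fejer_le K c K0; rewrite c0 (ltW c1) => /(_ isT).
  rewrite subr_le0 invfM mulrA; exact.
have : dh c * (1 / 2 - x) <= 0 by rewrite mulr_le0_ge0// subr_ge0 ltW.
rewrite -e /h fejer_prim_half subr_le0 => le.
have -> : 4 / (K%:R * x) = 4 / K%:R * x^-1 by rewrite invfM mulrA.
have : 0 <= 4 / K%:R * (1 / 2)^-1 :> R.
  by apply: mulr_ge0; [exact: divr_ge0|rewrite invr_ge0; lra].
by move: le; move: (4 / K%:R) (x^-1) => u v; lra.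
Qed.

(** * Smoothed indicator functions *)

(** The integral of the Fejer kernel from [x - r] to [x + r]: the convolution of
    the kernel with the indicator of the points within [r] of an integer. *)
Definition bump K r x : R := fejer_prim K (x + r) - fejer_prim K (x - r).

Definition bump_coef K r (j : nat) : R :=
  (1 - j%:R / K%:R) * (2 * (sin (2 * pi * j%:R * r) / (pi * j%:R))).

Lemma bumpE K r x : bump K r x =
  2 * r + \sum_(j <- iota 1 (K - 1)) bump_coef K r j * cos (2 * pi * j%:R * x).
Proof.
rewrite /bump /fejer_prim opprD addrACA -sumrB; congr (_ + _); first ring.
apply: eq_bigr => j _; rewrite /bump_coef mulrDr sinD mulrBr sinB; ring.
Qed.

Lemma sin_le_norm x : `|sin x| <= `|x|.
Proof.
have key y : 0 <= y -> `|sin y| <= y.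
  move=> y0; rewrite ler_norml sin_le_id// andbT lerNl -sinN.
  have [y1|y1] := lerP y 1.
    have := @sin_ge_half R y; rewrite y0 y1 => /(_ isT).
    by rewrite sinN; lra.
  by apply: le_trans (sin_le1 _) _; lra.
have [x0|x0] := lerP 0 x; first by rewrite (ger0_norm x0); exact: key.
by rewrite -normrN -sinN (ltr0_norm x0); apply: key; lra.
Qed.

Lemma bump_coef_le K r (j : nat) : 0 <= r -> (0 < j <= K)%N -> `|bump_coef K r j| <= 4 * r.
Proof.
move=> r0 /andP[j0 jK]; have K0 : 0 < K%:R :> R by rewrite ltr0n (leq_trans j0).
have j0' : 0 < j%:R :> R by rewrite ltr0n.
have p0 := pi_gt0 R.
have a1 : `|1 - j%:R / K%:R| <= 1 :> R.
  have h1 : 0 <= j%:R / K%:R :> R by exact: divr_ge0 (ltW j0') (ltW K0).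
  have h2 : j%:R / K%:R <= 1 :> R by rewrite (ler_pdivrMr _ _ K0) mul1r ler_nat.
  by rewrite ler_norml; apply/andP; split; lra.
rewrite /bump_coef normrM -[leRHS]mul1r ler_pM// normrM (ger0_norm (_ : 0 <= 2))//.
have -> : 4 * r = 2 * (2 * r) by ring.
rewrite ler_pM2l// normrM normfV.
rewrite (gtr0_norm (mulr_gt0 p0 j0')) ler_pdivrMr ?mulr_gt0//.
apply: le_trans (sin_le_norm _) _; rewrite normrM (ger0_norm r0) gtr0_norm ?mulr_gt0//.
by move: pi p0 => P p0; lra.
Qed.

Lemma bump_ge0 K r x : (0 < K)%N -> 0 <= r -> 0 <= bump K r x.
Proof. by move=> K0 r0; rewrite subr_ge0 fejer_prim_mono//; lra. Qed.

Lemma bump_le1 K r x : (0 < K)%N -> 2 * r <= 1 -> bump K r x <= 1.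
Proof.
move=> K0 r1; have h : x + r <= x - r + 1 by lra.
by have := fejer_prim_mono K0 h; rewrite fejer_primD1 /bump; lra.
Qed.

Lemma bumpN K r x : bump K r (- x) = bump K r x.
Proof. by rewrite !bumpE; under eq_bigr do rewrite mulrN cosN. Qed.

Lemma bumpD1 K r x : bump K r (x + 1) = bump K r x.
Proof. by rewrite !bumpE; under eq_bigr do rewrite cos_2pi_natD. Qed.

Lemma bumpDz K r x (m : int) : bump K r (x + m%:~R) = bump K r x.
Proof.
have nat_case (n : nat) y : bump K r (y + n%:R) = bump K r y.
  by elim: n => [|n IH]; [rewrite addr0|rewrite -natr1 addrA bumpD1].
case: m => n; first exact: nat_case.
by rewrite NegzE rmorphN /= -[in RHS](subrK n.+1%:R x) nat_case.
Qed.

Lemma bump_inside K r x t : (0 < K)%N -> 0 < t <= 1 / 2 -> `|x| <= r - t ->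
  1 - 8 / (K%:R * t) <= bump K r x.
Proof.
move=> K0 t0; rewrite ler_norml => /andP[h1 h2].
have h := fejer_prim_ge K0 t0.
have a : fejer_prim K t <= fejer_prim K (x + r) by apply: fejer_prim_mono => //; lra.
have b : fejer_prim K (x - r) <= - fejer_prim K t by rewrite -fejer_primN; apply: fejer_prim_mono => //; lra.
by rewrite /bump; move: h a b; move: (fejer_prim K) => f; lra.
Qed.

Lemma bump_outside K r x : (0 < K)%N -> 0 < r < `|x| -> `|x| <= 1 / 2 ->
  bump K r x <= 8 * r / (K%:R * (`|x| - r) ^+ 2).
Proof.
move=> K0; wlog x0 : x / 0 <= x.
  move=> H; have [x0|x0] := lerP 0 x; first exact: H.
  by rewrite -(bumpN K r x) -(normrN x); apply: H; lra.
rewrite (ger0_norm x0) => /andP[r0 rx] x2.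
have K0' : 0 < K%:R :> R by rewrite ltr0n.
have xr : x - r < x + r by lra.
have [c /andP[c1 c2] e] := mean_value (is_derive_fejer_prim K) xr.
have fc : fejer K c <= 4 / (K%:R * (x - r) ^+ 2).
  have mono y : x - r <= y -> y <= 1 / 2 -> fejer K y <= 4 / (K%:R * (x - r) ^+ 2).
    move=> h1 h2; apply: le_trans (fejer_le K0 _) _; first by apply/andP; split; lra.
    have xr0 : 0 < x - r by lra.
    have y0 : 0 < y by lra.
    rewrite ler_pM2l// lef_pV2 ?posrE ?(mulr_gt0 K0') ?exprn_gt0//.
    by rewrite ler_pM2l// ler_sqr ?nnegrE//; lra.
  have [h|h] := lerP c (1 / 2); first by apply: mono => //; lra.
  rewrite -fejerN -fejerD1; apply: mono; lra.
have -> : bump K r x = 2 * r * fejer K c by rewrite /bump e; ring.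
have -> : 8 * r / (K%:R * (x - r) ^+ 2) = 2 * r * (4 / (K%:R * (x - r) ^+ 2)) by ring.
by rewrite ler_wpM2l//; lra.
Qed.

End Fejer.

(** * Almost everywhere convergence from summable integrals *)

Section AlmostEverywhere.
Variable R : realType.
Notation mu := (@lebesgue_measure R).

Lemma integral_derivative (f F : R -> R) (a b : R) : a < b -> continuous f ->
  (forall x : R, is_derive x 1 F (f x)) ->
  (\int[mu]_(x in `[a, b]) (f x)%:E = (F b - F a)%:E)%E.
Proof.
move=> ab cf dF; have cF := is_derive_continuous dF.
rewrite (@continuous_FTC2 R f F a b ab).
- by rewrite EFinB.
- exact: continuous_subspaceT.
- split.
  + by move=> x _; case: (dF x).
  + exact/cvg_at_right_filter/cF.
  + exact/cvg_at_left_filter/cF.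
- by move=> x _; rewrite derive1E; case: (dF x).
Qed.

Lemma sum_inv_sqr (c : R) (n : nat) : 0 <= c ->
  \sum_(0 <= l < n) c / l.+1%:R ^+ 2 <= 2 * c.
Proof.
move=> c0; case: n => [|n]; first by rewrite big_geq// mulr_ge0.
suff : \sum_(0 <= l < n.+1) c / l.+1%:R ^+ 2 <= 2 * c - c / n.+1%:R.
  by move/le_trans; apply; rewrite gerBl divr_ge0.
elim: n => [|n IH]; first by rewrite big_nat1 expr1n !divr1 mulr_natl mulr2n addrK.
rewrite big_nat_recr//= -lerBrDr; apply: le_trans IH _.
have n1 : 0 < n.+1%:R :> R by rewrite ltr0n.
have n2 : 0 < n.+2%:R :> R by rewrite ltr0n.
suff : c / n.+2%:R ^+ 2 <= c / n.+1%:R - c / n.+2%:R.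
  by move: (c / _) (c / _) (c / _) => u v w; lra.
have -> : c / n.+1%:R - c / n.+2%:R = c / (n.+1%:R * n.+2%:R).
  have n3 : n.+1%:R + 1 != 0 :> R by rewrite natr1 gt_eqF.
  rewrite -[n.+2%:R]natr1; move: (n.+1%:R) n1 n3 => a a0 a1.
  by field; rewrite a1 gt_eqF.
rewrite ler_wpM2l// lef_pV2 ?posrE ?mulr_gt0 ?exprn_gt0// expr2.
by rewrite ler_pM2r// ler_nat.
Qed.

(** The sum of the functions has a finite integral, so it is finite almost
    everywhere, and then its terms tend to zero. *)
Lemma ae_cvg0 (a b c : R) (f : nat -> R -> R) : a < b -> 0 <= c ->
  (forall l, continuous (f l)) ->
  (forall l x, a <= x <= b -> 0 <= f l x) ->
  (forall l, (\int[mu]_(x in `[a, b]) (f l x)%:E <= (c / l.+1%:R ^+ 2)%:E)%E) ->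
  mu.-negligible [set x | a <= x <= b /\ ~ (f l x @[l --> \oo] --> (0 : R))].
Proof.
move=> ab c0 cf f0 fc; pose D : set R := [set` `[a, b]].
have mD : measurable (D : set (measurableTypeR R)) by exact: measurable_itv.
have mf l : measurable_fun D (EFin \o f l).
  have h : measurable_fun setT (f l) by exact: continuous_measurable_fun.
  exact/measurable_EFinP/measurable_funTS.
have f0' l x : D x -> (0 <= (EFin \o f l) x)%E.
  by rewrite /D /= in_itv /= => xab; rewrite lee_fin; exact: f0.
pose F x := (\sum_(l <oo) (EFin \o f l) x)%E.
have mF : measurable_fun D F by apply: ge0_emeasurable_sum => // l x Dx _; exact: f0'.
have F0 x : D x -> (0 <= F x)%E by move=> Dx; apply: nneseries_ge0 => l _ _; exact: f0'.
have intF : mu.-integrable D F.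
  apply/integrableP; split => //.
  under eq_integral => x /[!inE] Dx do rewrite gee0_abs ?F0//.
  rewrite /F integral_nneseries//.
  apply: (@le_lt_trans _ _ (2 * c)%:E); last exact: ltry.
  apply: lime_le.
    by apply: is_cvg_nneseries => l _ _; apply: integral_ge0 => x; exact: f0'.
  apply: nearW => n.
  apply: (@le_trans _ _ (\sum_(0 <= l < n) (c / l.+1%:R ^+ 2)%:E)%E).
    by apply: lee_sum => l _; exact: fc.
  by rewrite sumEFin lee_fin sum_inv_sqr.
have [Z [mZ Z0 sZ]] := integrable_ae mD intF; exists Z; split => //.
apply: subset_trans sZ => x /= [xab ncvg] /(_ _).
have Dx : D x by rewrite /D /= in_itv.
move=> /(_ Dx) Ffin; apply: ncvg; apply: cvg_series_cvg_0.
apply: nondecreasing_is_cvgn.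
  apply: nondecreasing_series => l _ _; exact: f0.
exists (fine (F x)) => _ [n _ <-].
rewrite -lee_fin fineK// /series /= -sumEFin.
by apply: nneseries_lim_ge => l _ _; exact: f0'.
Qed.

End AlmostEverywhere.

(** * Moments of cosine polynomials *)

Section Weighted.
Variable R : realType.
Notation mu := (@lebesgue_measure R).
Variable A : R.
Hypothesis A0 : 0 < A.
Implicit Types (c x y : R).

(** The weight [A ^ 2 - x ^ 2] vanishes at both ends of [[- A, A]]. Integrating
    twice by parts, the integral of [wcos c] decays quadratically in [c], which
    the indicator function of the interval would not give. *)
Definition wcos c x : R := (A ^+ 2 - x ^+ 2) * cos (c * x).

Definition wcos_prim c x : R :=
  if c == 0 then A ^+ 2 * x - x ^+ 3 / 3
  else (A ^+ 2 - x ^+ 2) * sin (c * x) / c - 2 * x * cos (c * x) / c ^+ 2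
       + 2 * sin (c * x) / c ^+ 3.

Definition wcos_int c : R := wcos_prim c A - wcos_prim c (- A).

Lemma is_derive_pow (n : nat) x : is_derive x 1 (fun y => y ^+ n.+1) (n.+1%:R * x ^+ n).
Proof.
have -> : (fun y : R => y ^+ n.+1) = (id : R -> R) ^+ n.+1.
  by apply/funext => y; rewrite exprfctE.
by apply: is_derive_eq; rewrite /GRing.scale /= mulr1.
Qed.

Lemma is_derive_mul (f g : R -> R) (a b x : R) : is_derive x 1 f a -> is_derive x 1 g b ->
  is_derive x 1 (fun y => f y * g y) (a * g x + f x * b).
Proof.
move=> hf hg; have -> : (fun y => f y * g y) = f * g by [].
by apply: is_derive_eq; rewrite /GRing.scale /= addrC [g x * a]mulrC.
Qed.

Lemma is_derive_wcos_prim c x : is_derive x 1 (wcos_prim c) (wcos c x).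
Proof.
have w2 := is_derive_pow 1 x; have w3 := is_derive_pow 2 x.
have id1 := is_derive_id x (1 : R).
have dA : is_derive x 1 (fun y => A ^+ 2 - y ^+ 2) (- (2 * x)).
  have := is_deriveB (is_derive_cst (A ^+ 2) x 1) w2.
  by move=> /is_derive_eq; apply; rewrite sub0r expr1.
rewrite /wcos_prim; have [c0|c0] := eqVneq c 0.
  have h1 := is_derive_scale (A ^+ 2) x.
  have h2 := is_deriveZ (3^-1) w3.
  have -> : (fun y => A ^+ 2 * y - y ^+ 3 / 3) =
     ((fun y => A ^+ 2 * y) \- (3^-1 \*: (fun y : R => y ^+ 3))).
    by apply/funext => y /=; rewrite /GRing.scale /= mulrC [3^-1 * _]mulrC mulrC.
  have := is_deriveB h1 h2; move=> /is_derive_eq; apply.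
  by rewrite /wcos c0 mul0r cos0 /GRing.scale /=; field.
have hs := is_derive_sinM c x; have hc := is_derive_cosM c x.
have p1 := is_derive_mul dA hs.
have p2 := is_derive_mul id1 hc.
have -> : (fun y => (A ^+ 2 - y ^+ 2) * sin (c * y) / c - 2 * y * cos (c * y) / c ^+ 2
       + 2 * sin (c * y) / c ^+ 3) =
   ((c^-1 \*: (fun y => (A ^+ 2 - y ^+ 2) * sin (c * y))) \-
    ((2 / c ^+ 2) \*: (fun y => id y * cos (c * y))) \+
    ((2 / c ^+ 3) \*: (fun y => sin (c * y)))).
  by apply/funext => y /=; rewrite /GRing.scale /=; field.
have := is_deriveD (is_deriveB (is_deriveZ c^-1 p1) (is_deriveZ (2 / c ^+ 2) p2))
  (is_deriveZ (2 / c ^+ 3) hs).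
move=> /is_derive_eq; apply; rewrite /wcos /GRing.scale /=.
by move: (sin _) (cos _) => s t; field.
Qed.

Lemma continuous_wcos c : continuous (wcos c).
Proof.
have hc x := is_derive_cosM c x.
have dA x : is_derive x 1 (fun y => A ^+ 2 - y ^+ 2) (- (2 * x)).
  have := is_deriveB (is_derive_cst (A ^+ 2) x 1) (is_derive_pow 1 x).
  by move=> /is_derive_eq; apply; rewrite sub0r expr1.
by apply: is_derive_continuous => x; exact: is_derive_mul (dA x) (hc x).
Qed.

Lemma wcos_int_le1 c : `|wcos_int c| <= 2 * A ^+ 3.
Proof.
have a0 := A0; have NA : - A < A by lra.
have [x /andP[x1 x2] e] := mean_value (is_derive_wcos_prim c) NA.
rewrite /wcos_int e normrM /wcos normrM.
have -> : 2 * A ^+ 3 = (A ^+ 2 * 1) * (2 * A) by ring.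
have h : `|A - - A| = 2 * A.
  by rewrite gtr0_norm; lra.
rewrite h ler_wpM2r ?mulr_ge0 ?(ltW A0)// ler_pM// ?cos_max//.
have x3 : x ^+ 2 <= A ^+ 2.
  by rewrite -ler_sqrt ?sqr_ge0 ?exprn_gt0// !sqrtr_sqr (gtr0_norm A0) ler_norml; apply/andP; split; lra.
by rewrite ger0_norm ?subr_ge0// gerBl sqr_ge0.
Qed.

Lemma wcos_int_le2 c : c ^+ 2 * `|wcos_int c| <= 8 * A.
Proof.
have [->|c0] := eqVneq c 0; first by rewrite expr0n mul0r mulr_ge0// ltW.
have c2 : 0 < c ^+ 2 by rewrite exprn_even_gt0.
have -> : wcos_int c = 4 / c ^+ 2 * (sin (c * A) / c - A * cos (c * A)).
  rewrite /wcos_int /wcos_prim (negbTE c0) mulrN sinN cosN.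
  by move: (sin _) (cos _) => s t; field.
rewrite normrM (gtr0_norm (_ : 0 < 4 / c ^+ 2)) ?divr_gt0// mulrA mulrCA.
rewrite mulfV ?mulr1; last by rewrite gt_eqF.
have -> : 8 * A = 4 * (A + A) by ring.
rewrite ler_pM2l//; apply: le_trans (ler_normB _ _) _; apply: lerD.
  rewrite normrM normfV ler_pdivrMr ?normr_gt0//.
  by apply: le_trans (sin_le_norm _) _; rewrite normrM (gtr0_norm A0) mulrC.
by rewrite normrM (gtr0_norm A0) -[leRHS]mulr1 ler_pM2l// cos_max.
Qed.

Definition decay_const : R := 2 * A ^+ 3 + 8 * A.

Lemma decay_const_ge0 : 0 <= decay_const.
Proof. by rewrite addr_ge0// mulr_ge0// ?exprn_ge0// ltW. Qed.

Lemma wcos_int_le (l : R) : `|wcos_int (2 * pi * l)| <= decay_const / (1 + l ^+ 2).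
Proof.
have l2 : 0 <= l ^+ 2 := sqr_ge0 l.
rewrite ler_pdivlMr; last by lra.
rewrite mulrDr mulr1 lerD ?wcos_int_le1//.
apply: le_trans (wcos_int_le2 (2 * pi * l)).
rewrite mulrC ler_wpM2r// exprMn -[leLHS]mul1r ler_wpM2r//.
by rewrite expr_ge1//; have := pi_ge2 R; lra.
Qed.

Lemma wcos_sum_integral (I : eqType) (s : seq I) (a c : I -> R) :
  (\int[mu]_(x in `[(- A)%R, A])
     (((A ^+ 2 - x ^+ 2) * \sum_(i <- s) a i * cos (c i * x))%R)%:E =
   ((\sum_(i <- s) a i * wcos_int (c i))%R)%:E)%E.
Proof.
have a0 := A0; have NA : - A < A by lra.
pose f x := \sum_(i <- s) a i * wcos (c i) x.
pose F x := \sum_(i <- s) a i * wcos_prim (c i) x.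
have dF x : is_derive x 1 F (f x).
  apply: is_derive_sum_seq => i _.
  have h := is_derive_wcos_prim (c i) x.
  have h2 : is_derive x 1 (a i \*: wcos_prim (c i)) (a i *: wcos (c i) x).
    exact: is_deriveZ.
  exact: h2.
have cf : continuous f.
  by apply: continuous_sum => i x; apply: cvgM; [exact: cvg_cst|exact: continuous_wcos].
have := integral_derivative NA cf dF.
have -> : F A - F (- A) = \sum_(i <- s) a i * wcos_int (c i).
  by rewrite /F -sumrB; apply: eq_bigr => i _; rewrite mulrBr.
move=> <-; apply: eq_integral => x _; congr (_%:E).
by rewrite /f mulr_sumr; apply: eq_bigr => i _; rewrite /wcos mulrCA.
Qed.

End Weighted.

Section Decay.
Variable R : realType.

Lemma sum_inv_1sqr (B : nat) : \sum_(z < B) (1 + z%:R ^+ 2)^-1 <= 3 :> R.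
Proof.
case: B => [|B]; first by rewrite big_ord0.
suff : \sum_(z < B.+1) (1 + z%:R ^+ 2)^-1 <= 3 - 2 / B.+1%:R :> R.
  by move/le_trans; apply; rewrite gerBl divr_ge0.
elim: B => [|B IH].
  by rewrite big_ord1 expr0n /= addr0 invr1; lra.
rewrite big_ord_recr /=.
have b0 : 0 < B.+1%:R :> R by rewrite ltr0n.
rewrite -[B.+2%:R]natr1; move: (B.+1%:R) b0 IH => b b0 IH.
suff : (1 + b ^+ 2)^-1 <= 2 / b - 2 / (b + 1).
  by move: IH; move: (\sum_(z < _) _) (_^-1) (2 / _) (2 / _) => S u v w; lra.
have -> : 2 / b - 2 / (b + 1) = ((b * (b + 1)) / 2)^-1.
  by field; rewrite !gt_eqF//; lra.
have h1 : 0 < 1 + b ^+ 2 by have := sqr_ge0 b; lra.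
have h2 : 0 < b * (b + 1) / 2 by apply: divr_gt0 => //; apply: mulr_gt0; lra.
by rewrite lef_pV2 ?posrE//; nra.
Qed.

(** Group the pairs by the value of [c i j]. *)
Lemma decay_sum (I J : eqType) (s : seq I) (t : seq J) (c : I -> J -> nat) (P : nat) :
  (forall z, \sum_(i <- s) \sum_(j <- t) (c i j == z) <= P)%N ->
  \sum_(i <- s) \sum_(j <- t) (1 + (c i j)%:R ^+ 2)^-1 <= 3 * P%:R :> R.
Proof.
move=> hP; pose B := (\max_(i <- s) \max_(j <- t) c i j).+1.
have cB i j : i \in s -> j \in t -> (c i j < B)%N.
  move=> si tj; rewrite ltnS.
  apply: (@leq_trans (\max_(j' <- t) c i j')%N).
    exact: (@leq_bigmax_seq _ t xpredT (fun j' => c i j') j).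
  exact: (@leq_bigmax_seq _ s xpredT (fun i' => \max_(j' <- t) c i' j')%N i).
have -> : \sum_(i <- s) \sum_(j <- t) (1 + (c i j)%:R ^+ 2)^-1 =
   \sum_(z < B) (1 + z%:R ^+ 2)^-1 * (\sum_(i <- s) \sum_(j <- t) (c i j == z))%N%:R :> R.
  under [RHS]eq_bigr => z _ do rewrite natr_sum mulr_sumr.
  rewrite [RHS]exchange_big /= big_seq [RHS]big_seq; apply: eq_bigr => i si.
  under [RHS]eq_bigr => z _ do rewrite natr_sum mulr_sumr.
  rewrite [RHS]exchange_big /= big_seq [RHS]big_seq; apply: eq_bigr => j tj.
  rewrite (bigD1 (Ordinal (cB i j si tj))) //= eqxx mulr1 big1 ?addr0// => z.
  by rewrite -val_eqE /= eq_sym => /negbTE ->; rewrite mulr0.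
apply: (@le_trans _ _ (\sum_(z < B) (1 + z%:R ^+ 2)^-1 * P%:R)).
  apply: ler_sum => z _; apply: ler_wpM2l; last by rewrite ler_nat hP.
  by rewrite invr_ge0 addr_ge0// sqr_ge0.
by rewrite -mulr_suml ler_wpM2r// sum_inv_1sqr.
Qed.

Lemma floor_weight_le (x y : R) :
  (1 + (x - y) ^+ 2)^-1 <= 3 * (1 + (`|(Num.floor x - Num.floor y)%R|%N)%:R ^+ 2)^-1.
Proof.
have /andP[a b] := floor_itv x; have /andP[c d] := floor_itv y.
set n := `|_|%N; rewrite !rmorphD /= in b d.
have nE : n%:R = `|(Num.floor x)%:~R - (Num.floor y)%:~R| :> R.
  by rewrite -rmorphB /= -intr_norm /n -abszE.
have nn : 0 <= n%:R :> R by [].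
have h : n%:R <= `|x - y| + 1.
  rewrite nE ler_norml; have h1 := ler_norm (x - y); have h2 := ler_norm (- (x - y)).
  by rewrite normrN in h2; apply/andP; split; lra.
rewrite -ler_pdivrMl// -invfM lef_pV2 ?posrE.
- rewrite -[(x - y) ^+ 2]real_normK ?num_real//.
  move: `|x - y| (n%:R) nn h => u v v0 uv.
  have : v * v <= (u + 1) * (u + 1) by rewrite ler_pM.
  have : 0 <= (u - 1) * (u - 1) + u * u by rewrite addr_ge0// -expr2 sqr_ge0.
  by rewrite !expr2; lra.
- by apply: mulr_gt0 => //; apply: ltr_wpDr => //; exact: sqr_ge0.
- by apply: ltr_wpDr => //; exact: sqr_ge0.
Qed.

(** Pairs whose floors differ by [z] are mutual coincidences of the floors with
    their translates by [z] and [- z]; there are no more of them than pairs with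
    equal floors. *)
Lemma floor_decay (I : eqType) (s : seq I) (l : I -> R) :
  \sum_(i <- s) \sum_(j <- s) (1 + (l i - l j) ^+ 2)^-1 <=
  18 * (coin s (fun i => Num.floor (l i)))%:R.
Proof.
pose c i j := `|(Num.floor (l i) - Num.floor (l j))%R|%N.
pose f i := Num.floor (l i).
apply: (@le_trans _ _ (3 * \sum_(i <- s) \sum_(j <- s) (1 + (c i j)%:R ^+ 2)^-1)).
  rewrite mulr_sumr; apply: ler_sum => i _; rewrite mulr_sumr; apply: ler_sum => j _.
  exact: floor_weight_le.
have -> : 18 * (coin s f)%:R = 3 * (3 * (2 * coin s f)%N%:R) :> R by rewrite natrM; ring.
rewrite ler_pM2l//; apply: decay_sum => z.
apply: (@leq_trans (cross s s f (fun j => (f j + z%:Z)%R) +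
                    cross s s f (fun j => (f j - z%:Z)%R))%N).
  rewrite /cross -big_split /=; apply: leq_sum => i _.
  rewrite -big_split /=; apply: leq_sum => j _.
  rewrite /c -/(f i) -/(f j); move: (f i) (f j) => u v.
  case: eqP => //= uv.
  have [->|->] : (u = v + z%:Z)%R \/ (u = v - z%:Z)%R by lia.
    by rewrite eqxx.
  by rewrite eqxx addn1.
rewrite mul2n -addnn; apply: leq_add.
  by apply: (cross_inj_le s f (h := fun x => (x + z%:Z)%R)) => x y /addIr.
by apply: (cross_inj_le s f (h := fun x => (x - z%:Z)%R)) => x y /addIr.
Qed.

End Decay.

Section Bounds.
Variable R : realType.
Notation mu := (@lebesgue_measure R).
Variable A : R.
Hypothesis A0 : 0 < A.

Lemma cos_mul (u v : R) : cos u * cos v = (cos (u - v) + cos (u + v)) / 2.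
Proof. by rewrite cosB cosD; field. Qed.

(** Expanding the square, a pair of frequencies contributes the integrals of
    weighted cosines at [l i - l j] and at [l i + l j]. The frequencies are
    nonnegative, so both decay like [1 / (1 + (l i - l j) ^ 2)]. *)
Theorem second_moment_le (I : eqType) (s : seq I) (a l : I -> R) (al : R) :
  {in s, forall i, 0 <= l i} -> {in s, forall i, `|a i| <= al} ->
  (\int[mu]_(x in `[(- A)%R, A])
     (((A ^+ 2 - x ^+ 2) * (\sum_(i <- s) a i * cos (2 * pi * l i * x)) ^+ 2)%R)%:E <=
   (al ^+ 2 * decay_const A * (18 * (coin s (fun i => Num.floor (l i)))%:R))%R%:E)%E.
Proof.
move=> l0 hal.
pose L := [seq (q, b) | q <- [seq (i, j) | i <- s, j <- s], b <- [:: true; false]].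
pose a' (p : I * I * bool) := a p.1.1 * a p.1.2 / 2.
pose c' (p : I * I * bool) := 2 * pi * (if p.2 then l p.1.1 - l p.1.2 else l p.1.1 + l p.1.2).
have sqE x : (\sum_(i <- s) a i * cos (2 * pi * l i * x)) ^+ 2 =
    \sum_(p <- L) a' p * cos (c' p * x).
  rewrite expr2 big_distrlr /= /L big_allpairs_dep /= big_allpairs_dep /=.
  apply: eq_bigr => i _; apply: eq_bigr => j _.
  rewrite big_cons big_seq1 /a' /c' /= mulrACA cos_mul.
  have -> : 2 * pi * (l i - l j) * x = 2 * pi * l i * x - 2 * pi * l j * x by ring.
  have -> : 2 * pi * (l i + l j) * x = 2 * pi * l i * x + 2 * pi * l j * x by ring.
  by ring.
under eq_integral do rewrite sqE.
rewrite (wcos_sum_integral A0) lee_fin.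
have w0 := decay_const_ge0 A0.
apply: (@le_trans _ _ (al ^+ 2 * decay_const A *
    \sum_(i <- s) \sum_(j <- s) (1 + (l i - l j) ^+ 2)^-1)); last first.
  by apply: ler_wpM2l; [rewrite mulr_ge0// sqr_ge0|exact: floor_decay].
rewrite /L big_allpairs_dep /= big_allpairs_dep /= mulr_sumr.
rewrite big_seq [leRHS]big_seq; apply: ler_sum => i si.
rewrite mulr_sumr big_seq [leRHS]big_seq; apply: ler_sum => j sj.
rewrite big_cons big_seq1 /a' /c' /=.
have ali := hal _ si; have alj := hal _ sj.
have aa : `|a i * a j| <= al ^+ 2 by rewrite normrM expr2 ler_pM.
have li := l0 _ si; have lj := l0 _ sj.
pose W := decay_const A * (1 + (l i - l j) ^+ 2)^-1.
have p1 : 0 < 1 + (l i - l j) ^+ 2 by apply: ltr_wpDr => //; exact: sqr_ge0.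
have W0 : 0 <= W by rewrite mulr_ge0// invr_ge0 ltW.
have b1 : `|wcos_int A (2 * pi * (l i - l j))| <= W by exact: wcos_int_le.
have b2 : `|wcos_int A (2 * pi * (l i + l j))| <= W.
  apply: le_trans (wcos_int_le A0 _) _; rewrite ler_wpM2l// lef_pV2 ?posrE//; last first.
    by apply: ltr_wpDr => //; exact: sqr_ge0.
  rewrite lerD2l -subr_ge0; have -> : (l i + l j) ^+ 2 - (l i - l j) ^+ 2 = 4 * (l i * l j) by ring.
  by rewrite !mulr_ge0.
have key u : `|u| <= W -> a i * a j / 2 * u <= al ^+ 2 * W / 2.
  move=> hu; apply: le_trans (ler_norm _) _.
  rewrite mulrAC normrM (ger0_norm (_ : 0 <= 2^-1)) ?invr_ge0// ler_wpM2r ?invr_ge0//.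
  by rewrite normrM ler_pM.
have -> : al ^+ 2 * decay_const A / (1 + (l i - l j) ^+ 2) = al ^+ 2 * W / 2 + al ^+ 2 * W / 2.
  by rewrite -mulrA -/W; field.
by apply: lerD; exact: key.
Qed.

(** The mean of the bump gives a multiple of [r]. The other coefficients are at
    most [4 r], and their frequencies [j * D i] with [j <= |j * D i|] have summable
    integrals, so they add no more than a multiple of [r], whatever [K] is. *)
Theorem bump_integral_le (I : eqType) (s : seq I) (D : I -> R) (K : nat) (r : R) :
  (0 < K)%N -> 0 <= r -> {in s, forall i, 1 <= `|D i|} ->
  (\int[mu]_(x in `[(- A)%R, A])
     (((A ^+ 2 - x ^+ 2) * \sum_(i <- s) bump K r (D i * x))%R)%:E <=
   ((size s)%:R * (r * (14 * decay_const A)))%R%:E)%E.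
Proof.
move=> K0 r0 hD; have w0 := decay_const_ge0 A0.
pose L := [seq (i, j) | i <- s, j <- 0%N :: iota 1 (K - 1)].
pose a' (p : I * nat) := if p.2 == 0%N then 2 * r else bump_coef K r p.2.
pose c' (p : I * nat) := 2 * pi * (p.2%:R * D p.1).
have bE x : \sum_(i <- s) bump K r (D i * x) = \sum_(p <- L) a' p * cos (c' p * x).
  rewrite /L big_allpairs_dep /=; apply: eq_bigr => i _.
  rewrite bumpE big_cons /a' /c' /= mul0r mulr0 mul0r cos0 mulr1; congr (_ + _).
  rewrite big_seq [RHS]big_seq; apply: eq_bigr => j; rewrite mem_iota => /andP[j1 _].
  by rewrite (gtn_eqF j1); congr (_ * cos _); ring.
under eq_integral do rewrite bE.
rewrite (wcos_sum_integral A0) lee_fin /L big_allpairs_dep /=.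
have -> : (size s)%:R * (r * (14 * decay_const A)) = \sum_(i <- s) r * (14 * decay_const A).
  by rewrite big_const_seq count_predT iter_addr_0 mulr_natl.
rewrite big_seq [leRHS]big_seq; apply: ler_sum => i si.
have D1 : 1 <= D i ^+ 2.
  have := hD _ si => h; rewrite -real_normK ?num_real//.
  by rewrite -[leLHS](expr1n _ 2) ler_sqr ?nnegrE.
rewrite big_cons {1}/a' {1}/c' /= mul0r.
apply: (@le_trans _ _ (2 * r * decay_const A + 4 * r * decay_const A * 3)); last by rewrite le_eqVlt; apply/orP; left; apply/eqP; ring.
apply: lerD.
  apply: ler_wpM2l; first by rewrite mulr_ge0.
  apply: le_trans (ler_norm _) _; apply: le_trans (wcos_int_le A0 _) _.
  by rewrite expr0n /= addr0 divr1.
apply: (@le_trans _ _ (4 * r * decay_const A * \sum_(z < K) (1 + z%:R ^+ 2)^-1)); last first.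
  by apply: ler_wpM2l; [rewrite !mulr_ge0|exact: sum_inv_1sqr].
case: K K0 @a' @L bE => // K _ a' L bE.
rewrite subSS subn0 big_ord_recl mulrDr; apply: ler_wpDl.
  by rewrite !mulr_ge0// invr_ge0 addr_ge0// sqr_ge0.
rewrite -(big_mkord xpredT (fun z => (1 + z.+1%:R ^+ 2)^-1)).
have -> : \sum_(0 <= z < K) (1 + z.+1%:R ^+ 2)^-1 = \sum_(z <- iota 1 K) (1 + z%:R ^+ 2)^-1 :> R.
  by rewrite (iotaDl 1 0 K : iota 1 K = _) big_map /index_iota subn0.
rewrite mulr_sumr big_seq [leRHS]big_seq; apply: ler_sum => j.
rewrite mem_iota => /andP[j1 jK].
apply: le_trans (ler_norm _) _; rewrite normrM /a' /c' /= gtn_eqF//.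
rewrite -[leRHS]mulrA; apply: ler_pM => //.
  by apply: bump_coef_le => //; rewrite j1 /= -ltnS; move: jK; rewrite add1n => /ltnW.
apply: le_trans (wcos_int_le A0 _) _; apply: ler_wpM2l => //.
rewrite lef_pV2 ?posrE.
- by rewrite lerD2l exprMn ler_peMr// sqr_ge0.
- by apply: ltr_wpDr => //; exact: sqr_ge0.
- by apply: ltr_wpDr => //; exact: sqr_ge0.
Qed.

End Bounds.

(** * Pair counts and sums of bumps *)

Section Counting.
Variable R : realType.
Implicit Types (x : R) (y : nat -> R).

Lemma cvg_epsP (f : nat -> R) (l : R) :
  (f @ \oo --> l) <-> (forall e, 0 < e -> exists n0, forall n, (n0 <= n)%N -> `|f n - l| < e).
Proof.
split => [/cvgrPdist_lt h e e0|h].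
  have [n0 _ hn] := h e e0; exists n0 => n nn; rewrite distrC; exact: hn.
apply/cvgrPdist_lt => e e0; have [n0 hn] := h e e0.
by exists n0 => // n nn /=; rewrite distrC; exact: hn.
Qed.

Lemma dist_intP x : exists m : int, dist_int x = `|x - m%:~R| /\ `|x - m%:~R| <= 1 / 2.
Proof.
pose m := Num.floor (x + 1 / 2); have /andP[a b] := floor_itv (x + 1 / 2).
rewrite -/m rmorphD /= in a b.
have near : `|x - m%:~R| <= 1 / 2 by rewrite ler_norml; apply/andP; split; lra.
exists m; split => //; apply/eqP; rewrite eq_le; apply/andP; split.
  by apply: ge_inf; [exists 0 => _ [k _ <-]|exists m].
apply: lb_le_inf; first by exists `|x - m%:~R|, m.
move=> _ [k _ <-]; have [->//|km] := eqVneq k m.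
have : 1 <= `|k%:~R - m%:~R| :> R.
  by rewrite -rmorphB /= -intr_norm ler1z; have := normr_gt0 (k - m); rewrite subr_eq0 km; lia.
have := ler_distD x (k%:~R) (m%:~R : R); rewrite [`|k%:~R - x|]distrC.
by lra.
Qed.

Lemma dist_intN x : dist_int (- x) = dist_int x.
Proof.
congr inf; apply/seteqP; split => _ [m _ <-]; exists (- m) => //=;
  by rewrite rmorphN /= -normrN; congr `|_|; ring.
Qed.

Lemma dist_int_near x (m : int) : dist_int x <= `|x - m%:~R|.
Proof. by apply: ge_inf; [exists 0 => _ [k _ <-]|exists m]. Qed.

Definition close_pairs y (t : R) (N : nat) : nat :=
  (\sum_(i <- iota 1 N) \sum_(j <- iota 1 N) ((i != j) && (dist_int (y i - y j) <= t)%R))%N.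

Lemma pair_countE y (s : R) (N : nat) : pair_count y s N = close_pairs y (s / N%:R) N.
Proof.
rewrite /pair_count -sum1_card big_mkcond /=.
rewrite -(pair_bigA _ (fun i j : 'I_N =>
  if (i, j) \in [pred ij : 'I_N * 'I_N | (ij.1 != ij.2) &&
      (dist_int (y ij.1.+1 - y ij.2.+1) <= s / N%:R)%R] then 1 else 0)%N) /=.
rewrite /close_pairs.
have e (F : nat -> nat) : (\sum_(i <- iota 1 N) F i = \sum_(i < N) F i.+1)%N.
  by rewrite -(big_mkord xpredT (fun i => F i.+1)) (iotaDl 1 0 N : iota 1 N = _)
             big_map /index_iota subn0.
rewrite e; apply: eq_bigr => i _; rewrite e; apply: eq_bigr => j _.
by rewrite inE /= eqSS; case: (_ && _).
Qed.

Lemma close_pairs_le y (t t' : R) (N N' : nat) : t <= t' -> (N <= N')%N ->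
  (close_pairs y t N <= close_pairs y t' N')%N.
Proof.
move=> tt' NN'; rewrite /close_pairs.
have e (F G : nat -> nat) : (forall i, F i <= G i)%N ->
   (\sum_(i <- iota 1 N) F i <= \sum_(i <- iota 1 N') G i)%N.
  move=> FG; rewrite -(subnKC NN') iotaD big_cat /=.
  by apply: (@leq_trans (\sum_(i <- iota 1 N) G i)%N); [exact: leq_sum|exact: leq_addr].
apply: (e _ _) => i; apply: (e _ _) => j; case: (i != j) => //=.
by case: (lerP _ t) => // h; rewrite (le_trans h tt').
Qed.

Definition bump_sum y (K : nat) (r : R) (N : nat) : R :=
  \sum_(i <- iota 1 N) \sum_(j <- iota 1 N | i != j) bump K r (y i - y j).

Lemma natr_close y (t : R) N : (close_pairs y t N)%:R =
  \sum_(i <- iota 1 N) \sum_(j <- iota 1 N | i != j) (dist_int (y i - y j) <= t)%R%:R :> R.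
Proof.
rewrite natr_sum; apply: eq_bigr => i _; rewrite natr_sum [RHS]big_mkcond /=.
by apply: eq_bigr => j _; case: (i != j).
Qed.

Lemma close_le_bump_sum y K r t u N : (0 < K)%N -> 0 <= r -> 0 < u <= 1 / 2 -> t <= r - u ->
  (1 - 8 / (K%:R * u)) * (close_pairs y t N)%:R <= bump_sum y K r N.
Proof.
move=> K0 r0 u0 tr; rewrite natr_close mulr_sumr; apply: ler_sum => i _.
rewrite mulr_sumr; apply: ler_sum => j _.
case: (lerP (dist_int _) t) => h; last by rewrite mulr0 bump_ge0.
rewrite mulr1; have [m [dE _]] := dist_intP (y i - y j).
rewrite -(subrK m%:~R (y i - y j)) bumpDz; apply: bump_inside => //.
by rewrite -dE; apply: le_trans h tr.
Qed.

Lemma inv_sqr_weight (s u c : R) : 0 < s -> s < u -> 0 <= c -> c <= u + 1 ->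
  u ^- 2 <= (3 / s ^+ 2 + 2) * (1 + c ^+ 2)^-1.
Proof.
move=> s0 su c0 cu; have u0 : 0 < u by lra.
have c2 : 0 < 1 + c ^+ 2 by apply: ltr_wpDr => //; exact: sqr_ge0.
have u2 : 0 < u ^+ 2 by rewrite exprn_gt0.
have s2 : 0 < s ^+ 2 by rewrite exprn_gt0.
rewrite ler_pdivlMr// mulrC ler_pdivrMr//.
have su2 : s ^+ 2 <= u ^+ 2 by rewrite ler_sqr ?nnegrE; lra.
have h1 : 3 <= 3 / s ^+ 2 * u ^+ 2 by rewrite mulrAC ler_pdivlMr// ler_pM2l.
have h2 : c ^+ 2 <= (u + 1) ^+ 2 by rewrite ler_sqr ?nnegrE; lra.
have h3 := sqr_ge0 (u - 1).
move: (3 / s ^+ 2) h1 => w h1; rewrite mulrDl; apply: le_trans (_ : 3 + 2 * u ^+ 2 <= _); last first.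
  by rewrite lerD2r.
by move: h2 h3; rewrite !expr2; lra.
Qed.

(** Sort the points of the circle into [N] bins. The distance of two points is
    that of their bins up to [1 / N]; by Cauchy-Schwarz, the bins at any given
    distance share at most as many pairs of points as equal bins do, and points
    in equal bins are within [1 / N] of each other. *)
Lemma tail_sum_le y (N : nat) (s : R) : (0 < N)%N -> 0 < s ->
  \sum_(i <- iota 1 N) \sum_(j <- iota 1 N | (i != j) && (s / N%:R < dist_int (y i - y j))%R)
    (N%:R * dist_int (y i - y j)) ^- 2 <=
  (3 / s ^+ 2 + 2) * (6 * (N%:R + (close_pairs y (1 / N%:R) N)%:R)).
Proof.
move=> N0 s0; have NR : 0 < N%:R :> R by rewrite ltr0n.
pose b i := Num.floor (N%:R * y i).
pose m i j := projT1 (cid (dist_intP (y i - y j))).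
have mP i j : dist_int (y i - y j) = `|y i - y j - (m i j)%:~R|.
  by rewrite /m; case: cid => k [].
pose c i j := `|(b i - b j - N%:Z * m i j)%R|%N.
have bin_near i : (b i)%:~R <= N%:R * y i < (b i)%:~R + 1.
  by have := floor_itv (N%:R * y i); rewrite rmorphD.
have s20 : 0 <= 3 / s ^+ 2 + 2 :> R by rewrite addr_ge0// divr_ge0// sqr_ge0.
apply: (@le_trans _ _ ((3 / s ^+ 2 + 2) *
   \sum_(i <- iota 1 N) \sum_(j <- iota 1 N) (1 + (c i j)%:R ^+ 2)^-1)).
  rewrite mulr_sumr; apply: ler_sum => i _; rewrite mulr_sumr [leLHS]big_mkcond.
  apply: ler_sum => j _; case: ifP => [/andP[_ far]|_]; last first.
    by rewrite mulr_ge0// invr_ge0 addr_ge0// sqr_ge0.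
  set u := N%:R * dist_int (y i - y j).
  have su : s < u by rewrite /u mulrC -ltr_pdivrMr.
  have cu : (c i j)%:R <= u + 1 :> R.
    have -> : (c i j)%:R = `|(b i)%:~R - (b j)%:~R - N%:R * (m i j)%:~R| :> R.
      by rewrite /c -[N%:R]/((N%:Z)%:~R) -rmorphM -!rmorphB /= -intr_norm -abszE.
    have -> : u = `|N%:R * y i - N%:R * y j - N%:R * (m i j)%:~R|.
      by rewrite /u mP -{1}(gtr0_norm NR) -normrM -!mulrBr.
    have := bin_near i; have := bin_near j.
    move: (N%:R * y i) (N%:R * y j) (N%:R * (m i j)%:~R) => p q r.
    move: ((b i)%:~R) ((b j)%:~R) => p' q' /andP[h1 h2] /andP[h3 h4].
    have h5 := ler_norm (p - q - r); have h6 := ler_norm (- (p - q - r)).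
    by rewrite normrN in h6; rewrite ler_norml; apply/andP; split; lra.
  by apply: inv_sqr_weight => //; exact: ler0n.
apply: ler_wpM2l => //.
have -> : 6 * (N%:R + (close_pairs y (1 / N%:R) N)%:R) =
   3 * (2 * (N + close_pairs y (1 / N%:R) N))%N%:R :> R by rewrite natrM natrD; ring.
apply: decay_sum => z.
pose be i := (b i %% N%:Z)%Z.
have near_bin i j : be i = be j -> dist_int (y i - y j) <= 1 / N%:R.
  move=> e; have bi := divz_eq (b i) N%:Z; have bj := divz_eq (b j) N%:Z.
  set k := ((b i %/ N%:Z)%Z - (b j %/ N%:Z)%Z)%R.
  apply: le_trans (dist_int_near _ k) _.
  rewrite ler_pdivlMr// -(gtr0_norm NR) -normrM.
  have -> : (y i - y j - k%:~R) * N%:R =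
     (N%:R * y i - (b i)%:~R) - (N%:R * y j - (b j)%:~R).
    have -> : (b i)%:~R = (b j)%:~R + k%:~R * N%:R :> R.
      rewrite -[N%:R]/((N%:Z)%:~R) -rmorphM -rmorphD /=; congr (_%:~R).
      by rewrite bi bj -/(be i) -/(be j) e /k; ring.
    by ring.
  have /andP[h1 h2] := bin_near i; have /andP[h3 h4] := bin_near j.
  by rewrite ler_norml; apply/andP; split; lra.
have coin_be : (coin (iota 1 N) be <= N + close_pairs y (1 / N%:R) N)%N.
  have -> : (N + close_pairs y (1 / N%:R) N =
      \sum_(i <- iota 1 N) 1 + close_pairs y (1 / N%:R) N)%N.
    by rewrite sum1_size size_iota.
  rewrite /coin /cross /close_pairs -big_split /=.
  apply: leq_sum => i _.
  apply: (@leq_trans (\sum_(j <- iota 1 N) ((j == i) +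
      ((i != j) && (dist_int (y i - y j) <= 1 / N%:R)%R)))%N).
    apply: leq_sum => j _; case: eqP => // e; rewrite near_bin// eq_sym.
    by case: (i == j).
  rewrite big_split /= leq_add2r -big_mkcond /= sum1_count.
  by rewrite (count_uniq_mem _ (iota_uniq _ _)) leq_b1.
have crossb (w : int) : (cross (iota 1 N) (iota 1 N) be (fun j => ((b j + w) %% N%:Z)%Z)
    <= N + close_pairs y (1 / N%:R) N)%N.
  apply: leq_trans coin_be; apply: cross_le_coin; apply: coin_coarser => i j _ _ /eqP.
  by rewrite eqz_modDr => /eqP.
apply: (@leq_trans (cross (iota 1 N) (iota 1 N) be (fun j => ((b j + z%:Z) %% N%:Z)%Z) +
   cross (iota 1 N) (iota 1 N) be (fun j => ((b j - z%:Z) %% N%:Z)%Z))%N); last first.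
  by rewrite mul2n -addnn leq_add.
rewrite /cross -big_split /=; apply: leq_sum => i _.
rewrite -big_split /=; apply: leq_sum => j _.
case: eqP => // cz.
have [e|e] : (b i = (b j + z%:Z) + m i j * N%:Z)%R \/ (b i = (b j - z%:Z) + m i j * N%:Z)%R.
  by move: cz; rewrite /c; move: (b i) (b j) (m i j) => u v w; lia.
  by rewrite /be e [(_ + m i j * _)%R]addrC modzMDl eqxx.
by rewrite /be e [(_ + m i j * _)%R]addrC modzMDl eqxx addn1.
Qed.

End Counting.

(** * From bumps along a sparse subsequence to Poissonian pair correlation *)

(** Along [N l = l ^ C] points the bumps have radius [q / N l], and the order
    [K l = l * N l] of the kernel makes the smoothing finer than this radius by the
    factor [l]. *)
Section SparseSubsequence.
Variables (R : realType) (y : nat -> R) (C : nat).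
Hypothesis C0 : (0 < C)%N.

Let N (l : nat) := (l ^ C)%N.
Let K (l : nat) := (l ^ C.+1)%N.
Let G l (q : R) : R := (N l)%:R^-1 * bump_sum y (K l) (q / (N l)%:R) (N l).
Let cnt l (s : R) : R := (N l)%:R^-1 * (close_pairs y (s / (N l)%:R) (N l))%:R.

Let N_pos l : (0 < l)%N -> (0 < N l)%N. Proof. by rewrite expn_gt0 => ->. Qed.
Let K_pos l : (0 < l)%N -> (0 < K l)%N. Proof. by rewrite expn_gt0 => ->. Qed.
Let l_le_N l : (0 < l)%N -> (l <= N l)%N. Proof. by move=> l0; exact: leq_expS. Qed.
Let KE l : (K l)%:R = l%:R * (N l)%:R :> R. Proof. by rewrite /K expnS natrM. Qed.

(** Close pairs at radius [s < q] lie well inside the bumps, which are close to one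
    there. *)
Lemma cnt_upper (s q e : R) : 0 < s < q -> 0 < e ->
  (forall d : R, 0 < d -> exists l0, forall l, (l0 <= l)%N -> `|G l q - 2 * q| < d) ->
  exists l0, forall l, (l0 <= l)%N -> cnt l s <= 2 * q + e.
Proof.
move=> /andP[s0 sq] e0 H; have e2 : 0 < e / 2 by lra.
have [l1 h1] := H _ e2.
pose d := e / 2 / (2 * q + e).
have d0 : 0 < d by apply: divr_gt0; lra.
have dE : d * (2 * q + e) = e / 2 by rewrite /d mulfVK// gt_eqF//; lra.
have d1 : d < 1 by rewrite /d ltr_pdivrMr; lra.
clearbody d.
have [l2 h2] := archi_nat (8 / ((q - s) * d)).
have [l3 h3] := archi_nat (2 * (q - s)).
exists (l1 + l2 + l3).+1 => l ll.
have l0 : (0 < l)%N by apply: leq_ltn_trans ll.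
have ll1 : (l1 <= l)%N by clear -ll; lia.
have ll2 : l2%:R <= l%:R :> R by rewrite ler_nat; clear -ll; lia.
have ll3 : l3%:R <= (N l)%:R :> R.
  by rewrite ler_nat; apply: leq_trans (l_le_N l0); clear -ll; lia.
have NR : 0 < (N l)%:R :> R by rewrite ltr0n N_pos.
have lR : 0 < l%:R :> R by rewrite ltr0n.
pose u := (q - s) / (N l)%:R.
have u0 : 0 < u <= 1 / 2.
  by rewrite divr_gt0 ?ltr_pdivrMr ?subr_gt0//= ler_pdivrMr//; lra.
have tr : s / (N l)%:R <= q / (N l)%:R - u by rewrite /u mulrBl; lra.
have r0 : 0 <= q / (N l)%:R by rewrite divr_ge0 ?ltW//; lra.
have := close_le_bump_sum y (N l) (K_pos l0) r0 u0 tr.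
have kap : 8 / ((K l)%:R * u) <= d.
  have -> : (K l)%:R * u = l%:R * (q - s) by rewrite KE /u; field; rewrite gt_eqF.
  have qs : 0 < q - s by lra.
  rewrite ler_pdivrMr ?mulr_gt0//.
  move: h2; rewrite ler_pdivrMr ?mulr_gt0// => h2.
  have : l2%:R * ((q - s) * d) <= l%:R * ((q - s) * d) by rewrite ler_wpM2r// ltW// mulr_gt0.
  by lra.
set kk := 8 / _ in kap *; set cl := (close_pairs _ _ _)%:R => hc.
have cnt0 : 0 <= cnt l s by rewrite /cnt mulr_ge0// invr_ge0 ltW.
have hG : (1 - kk) * cnt l s <= G l q.
  by rewrite /cnt /G mulrCA ler_wpM2l// invr_ge0 ltW.
have := h1 _ ll1; rewrite ltr_norml => /andP[_ hG2].
have hd : (1 - d) * cnt l s <= (1 - kk) * cnt l s by rewrite ler_wpM2r//; lra.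
have : (1 - d) * cnt l s <= (1 - d) * (2 * q + e) by rewrite mulrBl [(1 - d) * _]mulrBl dE; lra.
by rewrite ler_pM2l//; lra.
Qed.

(** The bumps are at most one on the close pairs at radius [s > q]. The tails over
    the other pairs are smaller by the factor [l], since [cnt l 1] is bounded by
    the case [q = 2] of [cnt_upper]. *)
Lemma cnt_lower (s q e : R) : 0 < q < s -> 0 < e ->
  (forall d : R, 0 < d -> exists l0, forall l, (l0 <= l)%N -> `|G l q - 2 * q| < d) ->
  (forall d : R, 0 < d -> exists l0, forall l, (l0 <= l)%N -> `|G l 2 - 2 * 2| < d) ->
  exists l0, forall l, (l0 <= l)%N -> 2 * q - e <= cnt l s.
Proof.
move=> /andP[q0 qs] e0 H H2; have e2 : 0 < e / 2 by lra.
have [l1 h1] := H _ e2.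
have one2 : 0 < (1 : R) < 2 by rewrite ltr01 ltr1n.
have [l2 h2] := cnt_upper one2 (@ltr01 R) H2.
have s0 : 0 < s by lra.
pose c := 1 - q / s.
have c0 : 0 < c by rewrite /c subr_gt0 ltr_pdivrMr// mul1r.
pose W := 8 * q / c ^+ 2 * ((3 / s ^+ 2 + 2) * (6 * 6)).
have W0 : 0 < W.
  apply: mulr_gt0; first by rewrite divr_gt0 ?exprn_gt0// mulr_gt0.
  apply: mulr_gt0; last lra.
  by rewrite addr_gt0// divr_gt0// exprn_gt0.
have [l3 h3] := archi_nat (W / (e / 2)).
have [l4 h4] := archi_nat (2 * q).
exists (l1 + l2 + l3 + l4).+1 => l ll.
have l0 : (0 < l)%N by apply: leq_ltn_trans ll.
have ll1 : (l1 <= l)%N by clear -ll; lia.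
have ll2 : (l2 <= l)%N by clear -ll; lia.
have ll3 : l3%:R <= l%:R :> R by rewrite ler_nat; clear -ll; lia.
have ll4 : l4%:R <= (N l)%:R :> R.
  by rewrite ler_nat; apply: leq_trans (l_le_N l0); clear -ll; lia.
have NR : 0 < (N l)%:R :> R by rewrite ltr0n N_pos.
have lR : 0 < l%:R :> R by rewrite ltr0n.
have KR : 0 < (K l)%:R :> R by rewrite ltr0n K_pos.
pose r := q / (N l)%:R.
have r0 : 0 < r by rewrite divr_gt0.
have r1 : 2 * r <= 1 by rewrite /r mulrA ler_pdivrMr// mul1r; lra.
pose kap := 8 * q / c ^+ 2 / l%:R.
have kap0 : 0 <= kap by rewrite divr_ge0 ?divr_ge0 ?mulr_ge0 ?exprn_ge0// ltW.
pose far i j := s / (N l)%:R < dist_int (y i - y j).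
have pw i j : bump (K l) r (y i - y j) <=
    (dist_int (y i - y j) <= s / (N l)%:R)%R%:R +
    (if far i j then kap * ((N l)%:R * dist_int (y i - y j)) ^- 2 else 0).
  rewrite /far; have [m [dE d1]] := dist_intP (y i - y j).
  case: (lerP (dist_int _) (s / (N l)%:R)) => hd.
    by rewrite addr0 bump_le1// K_pos.
  rewrite add0r dE; rewrite dE in hd.
  have -> : bump (K l) r (y i - y j) = bump (K l) r (y i - y j - m%:~R).
    by rewrite -[in RHS](bumpDz _ _ _ m) subrK.
  set x := y i - y j - m%:~R in hd d1 *.
  have rx : r <= q / s * `|x|.
    have -> : r = q / s * (s / (N l)%:R) by rewrite /r; field; rewrite !gt_eqF.
    by rewrite ler_wpM2l ?divr_ge0 ?ltW.
  have x0 : 0 < `|x| by apply: le_lt_trans hd; rewrite divr_ge0 ?ltW.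
  have qs1 : q / s < 1 by rewrite ltr_pdivrMr// mul1r.
  have rx2 : r < `|x|.
    by apply: le_lt_trans rx _; rewrite -[ltRHS]mul1r ltr_pM2r.
  have r0x : 0 < r < `|x| by rewrite r0 rx2.
  apply: le_trans (bump_outside (K_pos l0) r0x d1) _.
  have hx : c * `|x| <= `|x| - r by rewrite /c mulrBl mul1r; lra.
  have -> : kap * ((N l)%:R * `|x|) ^- 2 = 8 * r / ((K l)%:R * (c * `|x|) ^+ 2).
    by rewrite /kap /r KE; field; rewrite !gt_eqF.
  have cx : 0 < c * `|x| by exact: mulr_gt0.
  have xr : 0 < `|x| - r by lra.
  apply: ler_wpM2l; first by rewrite mulr_ge0// ltW.
  rewrite lef_pV2 ?posrE; [|by rewrite mulr_gt0// exprn_gt0|by rewrite mulr_gt0// exprn_gt0].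
  by rewrite ler_pM2l// ler_sqr ?nnegrE// ltW.
have tot : bump_sum y (K l) r (N l) <= (close_pairs y (s / (N l)%:R) (N l))%:R +
    kap * ((3 / s ^+ 2 + 2) * (6 * ((N l)%:R + (close_pairs y (1 / (N l)%:R) (N l))%:R))).
  apply: (@le_trans _ _ ((close_pairs y (s / (N l)%:R) (N l))%:R +
    kap * (\sum_(i <- iota 1 (N l)) \sum_(j <- iota 1 (N l) | (i != j) && far i j)
              ((N l)%:R * dist_int (y i - y j)) ^- 2))); last first.
    by rewrite lerD2l ler_wpM2l// tail_sum_le// N_pos.
  rewrite natr_close mulr_sumr -big_split /=; apply: ler_sum => i _.
  rewrite mulr_sumr big_mkcondr /= -big_split /=; apply: ler_sum => j _.
  exact: pw.
have := h1 _ ll1; rewrite ltr_norml => /andP[hG _].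
have hG2 : G l q <= cnt l s + kap * ((3 / s ^+ 2 + 2) * (6 * (1 + cnt l 1))).
  rewrite /G -/r; apply: le_trans (ler_wpM2l _ tot) _; first by rewrite invr_ge0 ltW.
  rewrite /cnt; move: (close_pairs _ _ _)%:R (close_pairs _ _ _)%:R => a b.
  rewrite le_eqVlt; apply/orP; left; apply/eqP.
  by move: (3 / s ^+ 2 + 2) => v; field; rewrite gt_eqF.
have hc := h2 _ ll2.
have hk : kap * ((3 / s ^+ 2 + 2) * (6 * (1 + cnt l 1))) <= e / 2.
  apply: le_trans (_ : kap * ((3 / s ^+ 2 + 2) * (6 * 6)) <= _).
    rewrite ler_wpM2l// ler_wpM2l//; last by lra.
    by rewrite addr_ge0// divr_ge0// exprn_ge0// ltW.
  have -> : kap * ((3 / s ^+ 2 + 2) * (6 * 6)) = W / l%:R by rewrite /kap /W mulrAC.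
  rewrite ler_pdivrMr//; move: h3; rewrite ler_pdivrMr// => h3.
  have : l3%:R * (e / 2) <= l%:R * (e / 2) by rewrite ler_wpM2r// ltW.
  by lra.
by lra.
Qed.

Lemma bernoulli_le (t : R) k : 0 <= t <= 1 -> 1 - k%:R * t <= (1 - t) ^+ k.
Proof.
move=> /andP[t0 t1]; elim: k => [|k IH]; first by rewrite mul0r subr0.
rewrite exprSr; apply: le_trans (_ : (1 - k%:R * t) * (1 - t) <= _); last first.
  by rewrite ler_wpM2r// subr_ge0.
have : 0 <= k%:R * (t * t) :> R by rewrite mulr_ge0// mulr_ge0.
by rewrite -natr1; lra.
Qed.

Lemma power_ratio (d : R) : 0 < d ->
  exists l0, forall l, (l0 <= l)%N -> (N l.+1)%:R <= (1 + d) * (N l)%:R.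
Proof.
move=> d0; have [l0 h0] := archi_nat (C%:R * (1 + d) / d); exists l0 => l ll.
have l1 : 0 < l.+1%:R :> R by rewrite ltr0n.
pose t : R := l.+1%:R^-1.
have t0 : 0 < t by rewrite invr_gt0.
have t1 : t <= 1 by rewrite invf_le1// ler1n.
have NE : (N l)%:R = (N l.+1)%:R * (1 - t) ^+ C.
  rewrite /N !natrX -exprMn; congr (_ ^+ _).
  by rewrite mulrBr mulr1 /t mulfV ?gt_eqF// -natr1 addrK.
have hb : 1 - C%:R * t <= (1 - t) ^+ C by apply: bernoulli_le; rewrite (ltW t0).
have ct : C%:R * t * (1 + d) <= d.
  rewrite /t mulrAC ler_pdivrMr// mulrC.
  have : C%:R * (1 + d) / d <= l.+1%:R.
    by apply: le_trans h0 _; rewrite ler_nat leqW.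
  by rewrite ler_pdivrMr// mulrC => h; apply: le_trans h _; rewrite mulrC.
have h1 : 1 <= (1 + d) * (1 - t) ^+ C.
  apply: (@le_trans _ _ ((1 + d) * (1 - C%:R * t))); first by lra.
  by rewrite ler_wpM2l//; lra.
by rewrite NE mulrCA ler_peMr.
Qed.

(** Pair counts are monotone in the number of points, so limits along the
    sparse sequence [l ^ C], whose consecutive ratios tend to one, extend to all
    numbers of points. *)
Theorem poissonian_of_bumps :
  (forall q : rat, 0 < q -> forall d : R, 0 < d ->
     exists l0, forall l, (l0 <= l)%N -> `|G l (ratr q) - 2 * ratr q| < d) ->
  poissonian_pair_correlation y.
Proof.
move=> H s s0; apply/cvg_epsP => e e0.
have H2 : forall d : R, 0 < d -> exists l0, forall l, (l0 <= l)%N -> `|G l 2 - 2 * 2| < d.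
  by have := H 2 (ltr0n _ 2); rewrite ratr_nat.
have [|q1] := @rat_in_itvoo R s (s + e / 8); first by lra.
rewrite in_itv /= => /andP[sq1 q1e].
have [|q0] := @rat_in_itvoo R (Num.max (s - e / 8) (s / 2)) s.
  by rewrite gt_max; apply/andP; split; lra.
rewrite in_itv /= gt_max => /andP[/andP[eq0 q0h] q0s].
have q00 : 0 < ratr q0 :> R by lra.
have q10 : 0 < ratr q1 :> R by lra.
have H0 : forall d : R, 0 < d -> exists l0, forall l, (l0 <= l)%N ->
    `|G l (ratr q0) - 2 * ratr q0| < d by apply: H; rewrite ltr0q in q00.
have H1 : forall d : R, 0 < d -> exists l0, forall l, (l0 <= l)%N ->
    `|G l (ratr q1) - 2 * ratr q1| < d by apply: H; rewrite ltr0q in q10.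
move: (ratr q0) (ratr q1) q00 q10 H0 H1 sq1 q1e eq0 q0h q0s => r0 r1 {q0 q1} r00 r10.
move=> H0 H1 sr1 r1e er0 r0h r0s.
pose s1 := (s + r1) / 2; pose s2 := (r0 + s) / 2.
have e8 : 0 < e / 8 by lra.
have c1 : 0 < s1 < r1 by apply/andP; rewrite /s1; split; lra.
have c2 : 0 < r0 < s2 by apply/andP; rewrite /s2; split; lra.
have [l1 h1] := cnt_upper c1 e8 H1.
have [l2 h2] := cnt_lower c2 e8 H0 H2.
have [d [d0 ds1 ds2 de]] : exists d : R, [/\ 0 < d, s * (1 + d) <= s1, s2 * (1 + d) <= s
    & d * (2 * s + e) <= e / 4].
  exists (Num.min ((s1 - s) / s) (Num.min ((s - s2) / s2) (e / 4 / (2 * s + e)))).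
  have s20 : 0 < s2 by rewrite /s2; lra.
  have se : 0 < 2 * s + e by lra.
  set a := (s1 - s) / s; set b := (s - s2) / s2; set c := e / 4 / _.
  have a0 : 0 < a by rewrite divr_gt0// /s1; lra.
  have b0 : 0 < b by rewrite divr_gt0// /s2; lra.
  have c0 : 0 < c by rewrite divr_gt0//; lra.
  have aE : s * a = s1 - s by rewrite /a mulrC mulfVK// gt_eqF.
  have bE : s2 * b = s - s2 by rewrite /b mulrC mulfVK// gt_eqF.
  have cE : c * (2 * s + e) = e / 4 by rewrite /c mulfVK// gt_eqF.
  have m0 : 0 < Num.min a (Num.min b c) by rewrite !lt_min a0 b0 c0.
  have ma : Num.min a (Num.min b c) <= a by rewrite ge_min lexx.
  have mb : Num.min a (Num.min b c) <= b by rewrite !ge_min lexx orbT.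
  have mc : Num.min a (Num.min b c) <= c by rewrite !ge_min lexx !orbT.
  clearbody a b c; move: (Num.min _ _) m0 ma mb mc => m m0 ma mb mc; split => //.
  - by have : s * m <= s * a by [rewrite ler_pM2l|]; lra.
  - by have : s2 * m <= s2 * b by [rewrite ler_pM2l|]; lra.
  - by have : m * (2 * s + e) <= c * (2 * s + e) by [rewrite ler_pM2r|]; lra.
have [l3 h3] := power_ratio d0.
exists (N (l1 + l2 + l3).+1) => n nn.
have exl : exists l, (N l <= n)%N by exists (l1 + l2 + l3).+1.
have bdl l : (N l <= n)%N -> (l <= n)%N.
  by case: l => // l; apply: leq_trans; exact: l_le_N.
have := ex_maxnP exl bdl; case: ex_maxnP => l ln lmax _.
have ll : ((l1 + l2 + l3).+1 <= l)%N by exact: lmax.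
have nl : (n < N l.+1)%N by rewrite ltnNge; apply/negP => /lmax; rewrite ltnn.
have l0 : (0 < l)%N by apply: leq_ltn_trans ll.
have ll1 : (l1 <= l.+1)%N by clear -ll; lia.
have ll2 : (l2 <= l)%N by clear -ll; lia.
have ll3 : (l3 <= l)%N by clear -ll; lia.
have rat := h3 _ ll3; have up := h1 _ ll1; have lo := h2 _ ll2.
have Nl0 : 0 < (N l)%:R :> R by rewrite ltr0n N_pos.
have NS0 : 0 < (N l.+1)%:R :> R by rewrite ltr0n N_pos.
have n0 : 0 < n%:R :> R by rewrite ltr0n (leq_trans (N_pos l0) ln).
have n1 : (N l)%:R <= n%:R :> R by rewrite ler_nat.
have n2 : n%:R <= (N l.+1)%:R :> R by rewrite ler_nat ltnW.
rewrite pair_countE; set P := (close_pairs _ _ _)%:R.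
have upP : P <= (close_pairs y (s1 / (N l.+1)%:R) (N l.+1))%:R.
  rewrite ler_nat close_pairs_le//; last exact: ltnW.
  rewrite ler_pdivrMr// mulrAC ler_pdivlMr//.
  apply: (@le_trans _ _ (s * ((1 + d) * (N l)%:R))); first by rewrite ler_pM2l.
  by rewrite mulrA ler_pM// ?mulr_ge0// ltW//; lra.
have loP : (close_pairs y (s2 / (N l)%:R) (N l))%:R <= P.
  rewrite ler_nat close_pairs_le//.
  rewrite ler_pdivrMr// mulrAC ler_pdivlMr//.
  apply: (@le_trans _ _ (s2 * ((1 + d) * (N l)%:R))).
    rewrite ler_pM2l; first by lra.
    by rewrite /s2; lra.
  by rewrite mulrA ler_wpM2r// ltW.
move: up; rewrite /cnt ler_pdivrMl// => up.
move: lo; rewrite /cnt ler_pdivlMl// => lo.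
have P0 : 0 <= P by [].
have hu : P < n%:R * (2 * s + e).
  apply: le_lt_trans upP _; apply: le_lt_trans up _.
  apply: (@le_lt_trans _ _ ((1 + d) * (N l)%:R * (2 * r1 + e / 8))).
    by rewrite ler_wpM2r//; lra.
  apply: (@le_lt_trans _ _ ((1 + d) * n%:R * (2 * r1 + e / 8))).
    by rewrite ler_wpM2r//; [lra|rewrite ler_pM2l//; lra].
  rewrite mulrAC mulrC ltr_pM2l//.
  apply: (@le_lt_trans _ _ ((1 + d) * (2 * s + 3 * e / 8))).
    by rewrite ler_pM2l; lra.
  have : d * (2 * s + 3 * e / 8) <= d * (2 * s + e) by rewrite ler_pM2l//; lra.
  by lra.
have hl : n%:R * (2 * s - e) < P.
  apply: lt_le_trans loP; apply: lt_le_trans lo.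
  have [neg|pos] := lerP (2 * s - e) 0.
    apply: (@le_lt_trans _ _ ((N l)%:R * (2 * s - e))).
      by rewrite !(mulrC _ (2 * s - e)) ler_wnM2l.
    by rewrite ltr_pM2l//; lra.
  apply: (@le_lt_trans _ _ ((1 + d) * (N l)%:R * (2 * s - e))).
    by rewrite ler_pM2r//; lra.
  rewrite mulrAC mulrC ltr_pM2l//.
  have : d * (2 * s - e) <= d * (2 * s + e) by rewrite ler_pM2l//; lra.
  by lra.
rewrite ltr_norml; apply/andP; split.
  by rewrite ltrBrDl ltr_pdivlMl//; lra.
by rewrite ltrBlDl ltr_pdivrMl//; lra.
Qed.

End SparseSubsequence.

(** * The metric argument *)

Section MetricPairCorrelation.
Variable R : realType.
Notation mu := (@lebesgue_measure R).

Lemma sum_ordered_pairs (N : nat) (F : nat -> nat -> R) : (forall i j, F i j = F j i) ->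
  \sum_(i <- iota 1 N) \sum_(j <- iota 1 N | i != j) F i j =
  2 * \sum_(q <- index_pairs 1 N) F q.1 q.2.
Proof.
move=> FC; rewrite /index_pairs big_filter [in RHS]big_mkcond big_allpairs_dep /=.
rewrite mulr_natl mulr2n [X in _ = _ + X]exchange_big -big_split /=.
rewrite big_seq [RHS]big_seq; apply: eq_bigr => i; rewrite mem_iota => /andP[i1 _].
rewrite -big_split big_mkcond big_seq [RHS]big_seq /=.
apply: eq_bigr => j; rewrite mem_iota => /andP[j1 _].
by rewrite i1 j1 /=; case: ltngtP => // _; rewrite ?addr0 ?add0r.
Qed.

Lemma size_all_pairs (N : nat) : 2 * (size (index_pairs 1 N))%:R = N%:R * (N%:R - 1) :> R.
Proof.
have := @sum_ordered_pairs N (fun _ _ => 1) (fun _ _ => erefl).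
have sum1 (I : Type) (s : seq I) : \sum_(i <- s) 1 = (size s)%:R :> R.
  by rewrite -sum1_size natr_sum.
rewrite sum1 => <-.
transitivity (\sum_(i <- iota 1 N) (N%:R - 1 : R)).
  rewrite big_seq [RHS]big_seq; apply: eq_bigr => i iN.
  have := sum1 _ (iota 1 N); rewrite (bigD1_seq i) ?iota_uniq//= size_iota => <-.
  by rewrite addrC addrK; apply: eq_bigl => j; rewrite eq_sym.
under eq_bigr do rewrite -[_ - _]mul1r.
by rewrite -mulr_suml sum1 size_iota.
Qed.

Lemma continuous_cosM (a c : R) : continuous (fun x : R => a * cos (c * x)).
Proof.
move=> x; apply: continuousM; first exact: cst_continuous.
exact: (is_derive_continuous (is_derive_cosM c)).
Qed.

Lemma continuous_bump K r (c : R) : continuous (fun x : R => bump K r (c * x)).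
Proof.
have -> : (fun x : R => bump K r (c * x)) = (fun x => 2 * r +
    \sum_(j <- iota 1 (K - 1)) bump_coef K r j * cos (2 * pi * j%:R * c * x)).
  by apply/funext => x; rewrite bumpE; under eq_bigr do rewrite mulrA.
move=> x; apply: (@continuousD _ _ _ (cst (2 * r)) _ x); first exact: cst_continuous.
by apply: continuous_sum => j; exact: continuous_cosM.
Qed.

Lemma weight_ge0 (A a : R) : - A <= a <= A -> 0 <= A ^+ 2 - a ^+ 2.
Proof.
by move=> /andP[h1 h2]; rewrite subr_sqr mulr_ge0 ?subr_ge0// -lerBlDl sub0r.
Qed.

Lemma continuous_weighted (A : R) (f : R -> R) : continuous f ->
  continuous (fun x : R => (A ^+ 2 - x ^+ 2) * f x).
Proof.
move=> cf x; apply: cvgM; last exact: cf.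
apply: cvgB; first exact: cvg_cst.
exact: exprn_continuous.
Qed.

Variables (p : {poly R}) (k : nat).
Hypothesis sp : size p = k.+3.
Hypothesis lp : 0 < lead_coef p.
Let x (n : nat) : R := p.[n%:R].
Let D (q : nat * nat) : R := x q.1 - x q.2.

Variable C : nat.
Hypothesis C2 : (2 < C)%N.
Let N (l : nat) := (l ^ C)%N.
Let K (l : nat) := (l ^ C.+1)%N.
Let G (a : R) l (t : R) : R :=
  (N l)%:R^-1 * bump_sum (fun n => a * x n) (K l) (t / (N l)%:R) (N l).

Let cosines (a : R) l (t : R) : R :=
  \sum_(w <- [seq (q, j) | q <- good_pairs C l, j <- iota 1 (K l - 1)])
    bump_coef (K l) (t / (N l)%:R) w.2 * cos (2 * pi * (w.2%:R * D w.1) * a).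

Let bad l := [seq q <- index_pairs 1 (N l) | q \notin good_pairs C l].
Let far_bad l := [seq q <- bad l | 1 <= `|D q|].

Let residue (a : R) l (t : R) : R :=
  \sum_(q <- far_bad l) bump (K l) (t / (N l)%:R) (D q * a).

Lemma good_pairs_perm l : perm_eq [seq q <- index_pairs 1 (N l) | q \in good_pairs C l] (good_pairs C l).
Proof.
apply: uniq_perm; [exact/filter_uniq/index_pairs_uniq|exact: good_pairs_uniq|] => q.
rewrite mem_filter andb_idr// => h.
by move: h; rewrite mem_filter => /andP[].
Qed.

Lemma good_bad_size l :
  (size (good_pairs C l) + size (bad l) = size (index_pairs 1 (N l)))%N.
Proof.
rewrite -(count_predC (mem (good_pairs C l)) (index_pairs 1 (N l))) -!size_filter; congr (_ + _)%N.
by rewrite -(perm_size (good_pairs_perm l)).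
Qed.

Lemma bump_sum_good_bad (a : R) l (t : R) : bump_sum (fun n => a * x n) (K l) (t / (N l)%:R) (N l) =
  2 * ((size (good_pairs C l))%:R * (2 * (t / (N l)%:R)) + cosines a l t +
       (residue a l t + \sum_(q <- bad l | ~~ (1 <= `|D q|)) bump (K l) (t / (N l)%:R) (D q * a))).
Proof.
set r := t / _.
rewrite /bump_sum sum_ordered_pairs; last by move=> i j; rewrite -bumpN opprB.
have bE q : bump (K l) r (a * x q.1 - a * x q.2) = bump (K l) r (D q * a).
  by rewrite -mulrBr mulrC.
under eq_bigr do rewrite bE.
congr (2 * _); rewrite (bigID (mem (good_pairs C l)))/=; congr (_ + _); last first.
  rewrite -big_filter -/(bad l) (bigID (fun q => 1 <= `|D q|)) /=; congr (_ + _).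
  by rewrite /residue big_filter.
rewrite -big_filter (perm_big _ (good_pairs_perm l)).
under eq_bigr do rewrite bumpE.
rewrite big_split /= /cosines big_allpairs_dep /=; congr (_ + _).
  by rewrite -sum1_size natr_sum mulr_suml; apply: eq_bigr => q _; rewrite mul1r.
apply: eq_bigr => q _; apply: eq_bigr => j _; congr (_ * cos _); rewrite -/r; ring.
Qed.

Let N_split l : (N l = l ^ (C - 2) * l ^ 2)%N.
Proof. by rewrite /N -expnD subnK// ltnW. Qed.

Lemma close_bad_count : exists M : nat, forall l,
  (count (fun q => ~~ (1 <= `|D q|)%R) (bad l) <= M)%N.
Proof.
have [M0 h] := far_apart sp lp; exists (M0 ^ 2)%N => l.
apply: leq_trans (size_index_pairs 1 M0); rewrite -size_filter.
apply: uniq_leq_size; first by do 2 apply: filter_uniq; exact: index_pairs_uniq.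
case=> u v h2; rewrite mem_index_pairs /=; move: h2.
rewrite mem_filter => /andP[near]; rewrite mem_filter => /andP[_].
rewrite mem_index_pairs /= => /andP[/andP[uv v0] _]; rewrite uv v0 /=; apply: contraNT near; rewrite -ltnNge => M0u.
have uv' : (v < u)%N by case/andP: uv.
exact: le_trans (h _ _ uv' (ltnW M0u)) (ler_norm _).
Qed.

(** The constant terms of the bumps over the good pairs add up to [2 t] with an
    error of order [1 / l], because nearly all pairs are good. Bad pairs whose
    values differ by less than one are boundedly many and contribute [1 / N l]
    each. *)
Lemma deviation_le (t : R) : 0 < t -> exists W : R, exists l0 : nat, 0 <= W /\
  forall a l, (l0 < l)%N -> `|G a l t - 2 * t| <=
    W / l%:R + `|2 / (N l)%:R * cosines a l t| + 2 / (N l)%:R * residue a l t.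
Proof.
move=> t0; have [M hM] := close_bad_count.
have [l0 h0] := archi_nat (2 * t).
exists (10 * t + 2 * M%:R), l0; split => [|a l ll]; first by rewrite addr_ge0 ?mulr_ge0// ltW.
have l1 : (0 < l)%N by apply: leq_ltn_trans ll.
have N1 : (0 < N l)%N by rewrite expn_gt0 l1.
have K1 : (0 < K l)%N by rewrite expn_gt0 l1.
have lN : (l <= N l)%N by apply: leq_expS => //; apply: leq_ltn_trans C2.
have NR : 0 < (N l)%:R :> R by rewrite ltr0n.
have lR : 0 < l%:R :> R by rewrite ltr0n.
have r0 : 0 <= t / (N l)%:R by rewrite divr_ge0// ltW.
have r1 : 2 * (t / (N l)%:R) <= 1.
  rewrite mulrA ler_pdivrMr// mul1r; apply: le_trans h0 _; rewrite ler_nat.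
  by apply: leq_trans lN; apply: ltnW.
rewrite /G bump_sum_good_bad.
set c := cosines _ _ _; set e := residue _ _ _.
set z := \sum_(q <- _ | _) _.
have z0 : 0 <= z by rewrite sumr_ge0// => q _; exact: bump_ge0.
have zM : z <= M%:R.
  apply: (@le_trans _ _ (count (fun q => ~~ (1 <= `|D q|)) (bad l))%:R).
    by rewrite -sum1_count natr_sum; apply: ler_sum => q _; exact: bump_le1.
  by rewrite ler_nat hM.
have e0 : 0 <= e by rewrite sumr_ge0// => q _; exact: bump_ge0.
have := size_all_pairs (N l); rewrite -good_bad_size natrD.
set g := (size (good_pairs C l))%:R; set b := (size (bad l))%:R => gb.
have b0 : 0 <= b by [].
have bN : b <= 2 * ((N l)%:R * (l ^ (C - 2))%:R).
  by rewrite -!natrM ler_nat; exact: bad_pairs_count.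
have NE : (N l)%:R = (l ^ (C - 2))%:R * l%:R ^+ 2 :> R by rewrite N_split natrM -natrX.
have l1R : 1 <= l%:R :> R by rewrite ler1n.
have lNR : l%:R <= (N l)%:R :> R by rewrite ler_nat.
clearbody c e z g b.
move: (N l)%:R (l ^ (C - 2))%:R l%:R NR lR r0 r1 gb bN NE l1R lNR => n H y NR lR r0 r1 gb bN NE l1R lNR.
have -> : n^-1 * (2 * (g * (2 * (t / n)) + c + (e + z))) - 2 * t =
   2 / n * c + 2 / n * e + (2 / n * z - 2 * t / n - 4 * t * (b / n ^+ 2)).
  have gE : g = (n * (n - 1) - 2 * b) / 2 by rewrite -gb; field.
  by rewrite gE; field; rewrite gt_eqF.
have hn : n^-1 <= y^-1 by rewrite lef_pV2.
have yi : 0 < y^-1 by rewrite invr_gt0.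
have ni : 0 < n^-1 by rewrite invr_gt0.
have hb : b / n ^+ 2 <= 2 / y.
  rewrite ler_pdivrMr ?exprn_gt0//; apply: le_trans bN _.
  have H0 : 0 <= H.
    rewrite leNgt; apply/negP => H0; have : H * y ^+ 2 <= 0.
      by rewrite mulr_le0_ge0 ?exprn_ge0// ltW.
    by rewrite -NE leNgt NR.
  have -> : 2 / y * n ^+ 2 = 2 * n * (H * y).
    by rewrite [in LHS]expr2 {2}NE; field; rewrite gt_eqF.
  by rewrite mulrA ler_pM2l ?mulr_gt0// ler_peMr.
have hb0 : 0 <= b / n ^+ 2 by rewrite divr_ge0// exprn_ge0// ltW.
have nz : n^-1 * z <= y^-1 * M%:R by apply: ler_pM => //; exact: ltW.
have nz0 : 0 <= n^-1 * z by rewrite mulr_ge0// ltW.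
have tn : t * n^-1 <= t * y^-1 by rewrite ler_pM2l.
have tn0 : 0 < t * n^-1 by rewrite mulr_gt0.
have tb : t * (b / n ^+ 2) <= t * (2 / y) by rewrite ler_pM2l.
have tb0 : 0 <= t * (b / n ^+ 2) by rewrite mulr_ge0// ltW.
have ne0 : 0 <= 2 / n * e by rewrite mulr_ge0// divr_ge0// ltW.
have main : `|2 / n * z - 2 * t / n - 4 * t * (b / n ^+ 2)| <= (10 * t + 2 * M%:R) / y.
  by rewrite ler_norml; apply/andP; split; lra.
have h1 := ler_normD (2 / n * c + 2 / n * e) (2 / n * z - 2 * t / n - 4 * t * (b / n ^+ 2)).
have h2 := ler_normD (2 / n * c) (2 / n * e); rewrite (ger0_norm ne0) in h2.
by apply: (le_trans h1); rewrite [leLHS]addrC -[leRHS]addrA lerD.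
Qed.

Variables (Ac lc : nat).
Hypothesis coincidences : forall l, (lc <= l)%N ->
  (coin [seq (q, j) | q <- good_pairs C l, j <- iota 1 (l ^ C.+1 - 1)]
     (fun w => Num.floor (w.2%:R * D w.1)) * l ^ 2 <= Ac * (l ^ C) ^ 4)%N.

Lemma integral_scale_le (A c b : R) (f : R -> R) : 0 <= c -> continuous f ->
  (forall a, - A <= a <= A -> 0 <= f a) ->
  (\int[mu]_(a in `[(- A)%R, A]) (f a)%:E <= b%:E)%E ->
  (\int[mu]_(a in `[(- A)%R, A]) (c * f a)%:E <= (c * b)%:E)%E.
Proof.
move=> c0 cf f0 h; pose I : set R := [set` `[- A, A]].
have mI : measurable (I : set (measurableTypeR R)) by exact: measurable_itv.
under eq_integral do rewrite EFinM.
rewrite ge0_integralZl_EFin//; first by rewrite EFinM lee_wpmul2l// lee_fin.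
by apply/measurable_EFinP; apply: measurable_funTS; exact: continuous_measurable_fun.
Qed.

(** The coefficients are at most [4 t / N l]; after normalization the second moment
    is of order [coin / (N l) ^ 4], and the coincidence bound gains [l ^ 2]. *)
Lemma cosines_integral_le (A t : R) : 0 < A -> 0 < t ->
  exists c : R, exists l0 : nat, 0 <= c /\
  forall l, (l0 < l)%N ->
  (\int[mu]_(a in `[(- A)%R, A])
     ((A ^+ 2 - a ^+ 2) * (2 / (N l)%:R * cosines a l t) ^+ 2)%R%:E <=
   (c / l%:R ^+ 2)%:E)%E.
Proof.
move=> A0 t0; have [c0 [C1 [n0 [c0P C1P range]]]] := good_pairs_range sp lp.
have w0 := decay_const_ge0 A0.
exists (64 * t ^+ 2 * decay_const A * 18 * Ac%:R), (lc + n0)%N; split => [|l ll].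
  by do 4 (apply: mulr_ge0 => //); exact: exprn_ge0 (ltW t0).
have l1 : (0 < l)%N by apply: leq_ltn_trans ll.
have llc : (lc <= l)%N by apply: leq_trans (ltnW ll); rewrite leq_addr.
have lln : (n0 <= l)%N by apply: leq_trans (ltnW ll); rewrite leq_addl.
have K1 : (0 < K l)%N by rewrite expn_gt0 l1.
have NR : 0 < (N l)%:R :> R by rewrite ltr0n expn_gt0 l1.
have lR : 0 < l%:R :> R by rewrite ltr0n.
have r0 : 0 <= t / (N l)%:R by rewrite divr_ge0// ltW.
pose s := [seq (q, j) | q <- good_pairs C l, j <- iota 1 (K l - 1)].
pose al (w : (nat * nat) * nat) := 2 / (N l)%:R * bump_coef (K l) (t / (N l)%:R) w.2.
have cE a : 2 / (N l)%:R * cosines a l t =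
    \sum_(w <- s) al w * cos (2 * pi * (w.2%:R * D w.1) * a).
  by rewrite /cosines mulr_sumr; apply: eq_bigr => w _; rewrite /al [LHS]mulrA.
under eq_integral do rewrite cE.
apply: (le_trans (@second_moment_le _ _ A0 _ s al _ (2 / (N l)%:R * (4 * (t / (N l)%:R))) _ _)).
- move=> w /allpairsP[[q j] [/= qg _ ->]] /=; apply: mulr_ge0 => //.
  have /andP[h _] := range C l C2 lln q qg.
  by apply: le_trans h; rewrite mulr_ge0 ?exprn_ge0// ltW.
- move=> w /allpairsP[[q j] [/= _]]; rewrite mem_iota => /andP[j1 jK] -> /=.
  have jj : (0 < j <= K l)%N by rewrite j1; move: jK; rewrite subnKC// => /ltnW.
  have n20 : 0 <= 2 / (N l)%:R :> R by rewrite divr_ge0 // ltW.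
  by rewrite /al /= normrM (ger0_norm n20) ler_wpM2l// bump_coef_le.
rewrite lee_fin; set co := coin _ _.
have : co%:R * l%:R ^+ 2 <= Ac%:R * (N l)%:R ^+ 4 :> R.
  by rewrite -!natrX -!natrM ler_nat; exact: coincidences.
move: co%:R => c h.
rewrite ler_pdivlMr ?exprn_gt0//.
have -> : 64 * t ^+ 2 * decay_const A * 18 * Ac%:R =
    (64 * t ^+ 2 * decay_const A * 18 / (N l)%:R ^+ 4) * (Ac%:R * (N l)%:R ^+ 4).
  by field; rewrite gt_eqF.
apply: le_trans (ler_wpM2l _ h); last first.
  by rewrite divr_ge0 ?exprn_ge0 ?mulr_ge0 ?exprn_ge0// ltW.
by rewrite le_eqVlt; apply/orP; left; apply/eqP; field; rewrite gt_eqF.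
Qed.

(** The mean of each bump is of order [1 / N l], and the bad pairs are a
    proportion of order [l ^ -2] of all pairs. *)
Lemma residue_integral_le (A t : R) : 0 < A -> 0 < t ->
  exists2 c : R, 0 <= c & forall l, (0 < l)%N ->
  (\int[mu]_(a in `[(- A)%R, A])
     (2 / (N l)%:R * ((A ^+ 2 - a ^+ 2) * residue a l t))%R%:E <=
   (c / l%:R ^+ 2)%:E)%E.
Proof.
move=> A0 t0; have w0 := decay_const_ge0 A0.
exists (56 * t * decay_const A) => [|l l1]; first by rewrite !mulr_ge0// ltW.
have K1 : (0 < K l)%N by rewrite expn_gt0 l1.
have NR : 0 < (N l)%:R :> R by rewrite ltr0n expn_gt0 l1.
have lR : 0 < l%:R :> R by rewrite ltr0n.
have r0 : 0 <= t / (N l)%:R by rewrite divr_ge0// ltW.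
have far : {in far_bad l, forall q, 1 <= `|D q|}.
  by move=> q; rewrite mem_filter => /andP[].
have := @integral_scale_le A (2 / (N l)%:R) _ _ _ _ _ (bump_integral_le A0 K1 r0 far).
move=> h; apply: le_trans (h _ _ _) _.
- by rewrite divr_ge0// ltW.
- apply: continuous_weighted; apply: continuous_sum => q; exact: continuous_bump.
- move=> a Aa; rewrite mulr_ge0//; last by rewrite sumr_ge0// => q _; exact: bump_ge0.
  exact: weight_ge0.
have hs : (size (far_bad l) <= 2 * (l ^ C * l ^ (C - 2)))%N.
  apply: leq_trans (bad_pairs_count C l).
  by rewrite /far_bad [leqLHS]size_filter; exact: count_size.
rewrite lee_fin ler_pdivlMr ?exprn_gt0//.
have NE : (N l)%:R = (l ^ (C - 2))%:R * l%:R ^+ 2 :> R by rewrite N_split natrM -natrX.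
have hs2 : (size (far_bad l))%:R * l%:R ^+ 2 <= 2 * (N l)%:R ^+ 2 :> R.
  have : (size (far_bad l))%:R <= 2 * ((N l)%:R * (l ^ (C - 2))%:R) :> R.
    by rewrite -!natrM ler_nat.
  move/(ler_wpM2r (exprn_ge0 2 (ltW lR))) => /le_trans; apply.
  by rewrite -!mulrA -NE -expr2.
have -> : 56 * t * decay_const A = (28 * t * decay_const A / (N l)%:R ^+ 2) * (2 * (N l)%:R ^+ 2).
  by field; rewrite gt_eqF.
apply: le_trans (ler_wpM2l _ hs2); last first.
  by rewrite divr_ge0 ?exprn_ge0 ?mulr_ge0// ltW.
by rewrite le_eqVlt; apply/orP; left; apply/eqP; field; rewrite gt_eqF.
Qed.

(** The index is shifted beyond the thresholds of the preceding estimates, so that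
    they hold for all terms. The open interval avoids the zeros of the weight. *)
Lemma deviation_ae (A t : R) : 0 < A -> 0 < t ->
  mu.-negligible [set a : R | - A < a < A /\ ~ (forall d : R, 0 < d ->
    exists l0, forall l, (l0 <= l)%N -> `|G a l t - 2 * t| < d)].
Proof.
move=> A0 t0.
have [c1 [l1 [c10 h1]]] := cosines_integral_le A0 t0.
have [c2 c20 h2] := residue_integral_le A0 t0.
have [W [l3 [W0 h3]]] := deviation_le t0.
pose L l := (l + (l1 + l3)).+1.
have AA : - A < A by lra.
have shrink (c : R) l : 0 <= c -> c / (L l)%:R ^+ 2 <= c / l.+1%:R ^+ 2.
  move=> c0; rewrite ler_wpM2l// lef_pV2 ?posrE ?exprn_gt0// ler_sqr ?nnegrE//.
  by rewrite ler_nat ltnS leq_addr.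
pose f1 l (a : R) := (A ^+ 2 - a ^+ 2) * (2 / (N (L l))%:R * cosines a (L l) t) ^+ 2.
pose f2 l (a : R) := 2 / (N (L l))%:R * ((A ^+ 2 - a ^+ 2) * residue a (L l) t).
have K1 l : (0 < K (L l))%N by rewrite expn_gt0.
have N0 l : 0 < 2 / (N (L l))%:R :> R by rewrite divr_gt0// ltr0n expn_gt0.
have r0 l : 0 <= t / (N (L l))%:R by rewrite divr_ge0// ltW.
have res0 a l : 0 <= residue a (L l) t.
  by apply: sumr_ge0 => q _; exact: bump_ge0.
have n1 : mu.-negligible [set a : R | - A <= a <= A /\ ~ (f1 l a @[l --> \oo] --> (0 : R))].
  apply: (ae_cvg0 AA c10).
  - move=> l; apply: continuous_weighted => x0.
    have cc : continuous (fun a => 2 / (N (L l))%:R * cosines a (L l) t).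
      move=> x1; apply: cvgM; first exact: cvg_cst.
      by apply: continuous_sum => w; exact: continuous_cosM.
    exact: (cvgM (cc x0) (cc x0)).
  - by move=> l a /weight_ge0 h; rewrite mulr_ge0// sqr_ge0.
  - move=> l; apply: (le_trans (h1 (L l) _)); last by rewrite lee_fin shrink.
    by rewrite ltnS; clear; lia.
have n2 : mu.-negligible [set a : R | - A <= a <= A /\ ~ (f2 l a @[l --> \oo] --> (0 : R))].
  apply: (ae_cvg0 AA c20).
  - move=> l x0; apply: cvgM; first exact: cvg_cst.
    apply: continuous_weighted; apply: continuous_sum => q; exact: continuous_bump.
  - by move=> l a /weight_ge0 h; rewrite mulr_ge0 ?mulr_ge0// ltW.
  - by move=> l; apply: (le_trans (h2 (L l) _)) => //; rewrite lee_fin shrink.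
apply: negligibleS (negligibleU n1 n2) => a [/andP[aA1 aA2] nH].
have aA : - A <= a <= A by rewrite !ltW.
apply: contrapT => /not_orP[e1 e2]; apply: nH => d d0.
have {}e1 : f1 l a @[l --> \oo] --> (0 : R) by apply: contrapT => e; apply: e1.
have {}e2 : f2 l a @[l --> \oo] --> (0 : R) by apply: contrapT => e; apply: e2.
have wp : 0 < A ^+ 2 - a ^+ 2.
  by rewrite subr_sqr mulr_gt0 ?subr_gt0// -ltrBlDl sub0r.
have d3 : 0 < d / 3 by lra.
have [m1 g1] := (cvg_epsP _ _).1 e1 _ (mulr_gt0 wp (exprn_gt0 2 d3)).
have [m2 g2] := (cvg_epsP _ _).1 e2 _ (mulr_gt0 wp d3).
have [m3 g3] := archi_nat ((W + 1) / (d / 3)).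
exists (m1 + m2 + m3 + (l1 + l3)).+1 => l ll.
have [l' lE] : exists l', l = L l'.
  by exists (l - (l1 + l3).+1)%N; rewrite /L; clear -ll; lia.
have lm1 : (m1 <= l')%N by clear -ll lE; rewrite /L in lE; lia.
have lm2 : (m2 <= l')%N by clear -ll lE; rewrite /L in lE; lia.
have lm3 : (m3 <= l)%N by clear -ll; lia.
have ll3 : (l3 < l)%N by clear -ll; lia.
have lR : 0 < l%:R :> R by rewrite ltr0n lE.
move: (g1 _ lm1) (g2 _ lm2); rewrite !subr0 /f1 /f2 -lE => b1 b2.
have {}b1 : `|2 / (N l)%:R * cosines a l t| < d / 3.
  move: b1; rewrite normrM (gtr0_norm wp) ltr_pM2l// normrX => b1.
  by rewrite -ltr_sqr ?nnegrE// ltW.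
have {}b2 : 2 / (N l)%:R * residue a l t < d / 3.
  by move: (le_lt_trans (ler_norm _) b2); rewrite mulrCA ltr_pM2l.
have b3 : W / l%:R < d / 3.
  rewrite ltr_pdivrMr//; move: g3; rewrite ler_pdivrMr// => g3.
  have : m3%:R * (d / 3) <= l%:R * (d / 3) by rewrite ler_pM2r// ler_nat.
  by lra.
apply: le_lt_trans (h3 a l ll3) _; lra.
Qed.

(** By [poissonian_of_bumps] rational radii suffice, and the line is a countable
    union of bounded intervals: countably many null sets are discarded. *)
Theorem metric_poissonian_values : metric_poissonian x.
Proof.
pose S (n : nat) : set R := if unpickle n is Some (m, q) then
  if 0 < (q : rat) then [set a : R | - m.+1%:R < a < m.+1%:R /\ ~ (forall d : R, 0 < d ->
    exists l0, forall l, (l0 <= l)%N -> `|G a l (ratr q) - 2 * ratr q| < d)] else set0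
  else set0.
have S0 n : mu.-negligible (S n).
  rewrite /S; case: (unpickle n) => [[m q]|]; last exact: negligible_set0.
  case: ifP => q0; last exact: negligible_set0.
  by apply: deviation_ae; rewrite ?ltr0q// ltr0n.
apply: negligibleS (negligible_bigcup S0) => a /= nP.
have [q [q0 nq]] : exists q : rat, 0 < q /\ ~ (forall d : R, 0 < d ->
    exists l0, forall l, (l0 <= l)%N -> `|G a l (ratr q) - 2 * ratr q| < d).
  apply: contrapT => h; apply: nP; apply: (@poissonian_of_bumps _ _ C).
    exact: leq_ltn_trans C2.
  by move=> q q0; apply: contrapT => h'; apply: h; exists q.
have [m hm] := archi_nat `|a|.
exists (pickle (m, q)) => //; rewrite /S pickleK q0; split; last exact: nq.
rewrite -ltr_norml; apply: le_lt_trans hm _; by rewrite ltr_nat.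
Qed.

End MetricPairCorrelation.

Lemma poissonian_opp (R : realType) (y : nat -> R) :
  poissonian_pair_correlation (fun n => - y n) -> poissonian_pair_correlation y.
Proof.
have E s N : pair_count (fun n => - y n) s N = pair_count y s N.
  by apply: eq_card => ij; rewrite !inE -opprD dist_intN.
by move=> h s s0; have := h s s0; under eq_fun do rewrite E.
Qed.

(* [size p] is the degree plus one. *)
Theorem corollary2p5 (R : realType) (p : {poly R}) (hp : (2 < size p)%N) :
  metric_poissonian (fun n : nat => p.[n%:R]).
Proof.
(* The distance to the nearest integer is even, so the sign of [p] is immaterial. *)
have pos (q : {poly R}) : (2 < size q)%N -> 0 < lead_coef q ->
    metric_poissonian (fun n : nat => q.[n%:R]).
  move=> sq lq; have sqE : size q = (size q - 3).+3 by clear -sq; lia.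
  have [C [A [l0 [C2 h]]]] := count_bound sqE lq.
  by have := @metric_poissonian_values R q _ sqE lq C C2 A l0 h.
have lp0 : lead_coef p != 0 by rewrite lead_coef_eq0 -size_poly_gt0; apply: leq_trans hp.
have [lp|lp|lp] := ltgtP (lead_coef p) 0; last by rewrite lp eqxx in lp0.
- have [] := pos (- p); rewrite ?size_polyN ?lead_coefN ?oppr_gt0//.
  move=> B [mB B0 sub]; exists B; split => // a na; apply: sub => pa; apply: na.
  apply: poissonian_opp; move: pa; rewrite /=.
  by under eq_fun do rewrite hornerN mulrN.
- exact: pos.
Qed.
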